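(* Let $f\in L^1$. (i) The following conditions are equivalent. (a) $f\in[T,L^1]$. (b) $\sup_{|h|\le|f|}\|T(h)\|_{L^1}<\infty$. (c) $T(f\chi_A)\in L^1$ for every Borel set $A\subseteq(-1,1)$. (d) $\sup_{A}\|T(f\chi_A)\|_{L^1}<\infty$, the supremum being over all Borel sets $A\subseteq(-1,1)$. (e) $T(\theta f)\in L^1$ for every $\theta\in L^\infty$ with $|\theta|=1$ a.e. (f) $\sup_{|\theta|=1}\|T(\theta f)\|_{L^1}<\infty$, the supremum being over all $\theta\in L^\infty$ with $|\theta|=1$ a.e. (g) $fT(g)\in L^1$ for every $g\in L^\infty$. (ii) Every function $f\in[T,L^1]$ satisfies $$\sup_{A}\|T(\chi_Af)\|_{L^1}\le\sup_{|\theta|=1}\|T(\theta f)\|_{L^1}\le\sup_{|h|\le|f|}\|T(h)\|_{L^1}\le4\sup_{A}\|T(\chi_Af)\|_{L^1}.$$ (iii) For every function $f\in[T,L^1]$ the following Parseval formula holds: $$\int_{-1}^1 f\,T(g)=-\int_{-1}^1 g\,T(f),\qquad g\in L^\infty.$$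
   Context: All functions are complex-valued, Lebesgue measurable on $(-1,1)$, identified when equal a.e.; $L^0$ denotes the space of all of them and $L^p=L^p(-1,1)$. For $f\in L^1$ the finite Hilbert transform is $$T(f)(t)=\lim_{\varepsilon\to0^+}\frac1\pi\Big(\int_{-1}^{t-\varepsilon}+\int_{t+\varepsilon}^1\Big)\frac{f(x)}{x-t}\,dx ,$$ which exists for a.e. $t\in(-1,1)$ and is measurable. Define $$[T,L^1]:=\{f\in L^1:\ T(h)\in L^1\text{ for all } h\in L^0 \text{ with }|h|\le|f|\}.$$ For a measurable function $u\notin L^1$ set $\|u\|_{L^1}=\infty$. $\chi_A$ is the indicator function of $A$. *)

(* Defs.v *)
From HB Require Import structures.
From mathcomp Require Import all_boot all_order all_algebra.
From mathcomp Require Import complex.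
From mathcomp Require Import all_classical all_reals all_analysis.

Set Implicit Arguments.
Unset Strict Implicit.
Unset Printing Implicit Defensive.

Import Order.TTheory GRing.Theory Num.Theory.
Import numFieldNormedType.Exports.

Local Open Scope classical_set_scope.
Local Open Scope ring_scope.
Local Open Scope complex_scope.

(* Functions on (-1,1) are total functions R -> R[i], of which only the values
   on Iab matter; functions that are equal a.e. are not quotiented, instead every
   pointwise condition is imposed almost everywhere on Iab.

   "Lebesgue measurable" refers to the completed (Caratheodory) sigma-algebra,
   on which completed_lebesgue_measure lives; Borel sets are the measurable sets
   of measurableTypeR R. *)

Notation leb R := (@completed_lebesgue_measure R).

Definition Iab {R : realType} : set R := `]-1, 1[.

Definition aeI (R : realType) (P : R -> Prop) : Prop :=
  {ae leb R, forall x : R, Iab x -> P x}.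

Definition cabs (R : realType) (z : R[i]) : R := ComplexField.Normc.normc z.

Definition L0 (R : realType) (f : R -> R[i]) : Prop :=
  [/\ @measurable_fun _ _ (caratheodory_type (wlength idfun)^*%mu) R Iab
        (fun x => complex.Re (f x)) &
      @measurable_fun _ _ (caratheodory_type (wlength idfun)^*%mu) R Iab
        (fun x => complex.Im (f x))].

(* equal to +oo when f is measurable but not integrable on Iab *)
Definition normL1 (R : realType) (f : R -> R[i]) : \bar R :=
  (\int[leb R]_(x in Iab) (cabs (f x))%:E)%E.

Definition L1 (R : realType) (f : R -> R[i]) : Prop :=
  L0 f /\ (normL1 f < +oo)%E.

Definition Linfty (R : realType) (g : R -> R[i]) : Prop :=
  L0 g /\ exists M : R, aeI (fun x => cabs (g x) <= M).

Definition cint (R : realType) (D : set R) (f : R -> R[i]) : R[i] :=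
  (\int[leb R]_(x in D) complex.Re (f x))
    +i* (\int[leb R]_(x in D) complex.Im (f x)).

Definition hilbert_trunc (R : realType) (f : R -> R[i]) (t e : R) : R[i] :=
  (pi^-1)%:C * (cint `]-1, (t - e)[ (fun x => f x / (x - t)%:C)
              + cint `](t + e), 1[ (fun x => f x / (x - t)%:C)).

(* R[i]^o is R[i] with the topology of its norm.  lim has an arbitrary value at
   the points t (a null set for f in L^1) where the limit does not exist. *)
Definition T (R : realType) (f : R -> R[i]) (t : R) : R[i] :=
  lim ((hilbert_trunc f t e : R[i]^o) @[e --> 0^'+]).

Definition chi (R : realType) (A : set R) (x : R) : R[i] := (\1_A x : R)%:C.

Definition borelI (R : realType) : set (set R) :=
  [set A | measurable (A : set (measurableTypeR R)) /\ A `<=` Iab].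

Definition dominated (R : realType) (f : R -> R[i]) : set (R -> R[i]) :=
  [set h | L0 h /\ aeI (fun x => cabs (h x) <= cabs (f x))].

Definition unimodular (R : realType) : set (R -> R[i]) :=
  [set theta | Linfty theta /\ aeI (fun x => cabs (theta x) = 1)].

Definition TL1 (R : realType) (f : R -> R[i]) : Prop :=
  L1 f /\ forall h, dominated f h -> L1 (T h).

Definition sup_dominated (R : realType) (f : R -> R[i]) : \bar R :=
  ereal_sup [set normL1 (T h) | h in dominated f].

Definition sup_borel (R : realType) (f : R -> R[i]) : \bar R :=
  ereal_sup [set normL1 (T (f \* chi A)) | A in @borelI R].

Definition sup_unimodular (R : realType) (f : R -> R[i]) : \bar R :=
  ereal_sup [set normL1 (T (theta \* f)) | theta in @unimodular R].

(* Main.v *)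
(* For finite sums, Boole's identity says that {t : sum_a m_a / (a - t) > lam} has
   measure (sum_a m_a) / lam: after multiplication by prod_a (a - t) the equation
   "sum = lam" becomes a polynomial equation whose roots interlace the poles and
   whose sum of roots is known.  A disjoint family of balls, a discretisation and
   Vitali's covering lemma turn this into the weak type (1,1) bound of the maximal
   truncated Hilbert transform, so that T f exists a.e. and T f_n -> T f a.e. when
   f_n -> f fast in L^1.  The truncated transforms are antisymmetric; iterating the
   weak type bound on pairs of sets shows that the truncated transforms of a bounded
   function are uniformly integrable, which gives Parseval's formula for bounded pairs.

   For a weight w >= 0, N h = int w |T h| is a seminorm that is lower semicontinuous
   for L^1-convergence.  If N (k chi_A) is finite for every Borel set A, then it is
   bounded in A: otherwise it is unbounded near some point c, and a gliding hump
   towards c produces a Borel set with N = +oo.  If N (k chi_A) <= S for all A, then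
   N (phi k) <= 4 S for |phi| <= 1, because a function with values in [0,1] is a limit
   of averages of indicators.  The choice w = 1, k = f yields (c) => (b) and the
   constant 4, the choice w = |f|, k = 1 yields (g) => (a); the bridges between
   T (theta f) and f T g are Parseval's formula for truncations of f.

   For (iii), T (f chi_{|f| <= n}) -> T f in L^1.  Otherwise there are blocks b_j of f,
   living on disjoint sets, with T b_j -> 0 a.e. but not in L^1; averaging |T (sum_j
   +- b_j)| over the signs dominates sup_j |T b_j| by an integrable function, which
   contradicts dominated convergence. *)

Require Import Defs.
From HB Require Import structures.
From mathcomp Require Import all_boot all_order all_algebra.
From mathcomp Require Import complex.
From mathcomp Require Import all_classical all_reals all_analysis.
From mathcomp Require Import polyrcf measurable_realfun.
From mathcomp Require finmap.
From mathcomp Require Import ring lra zify.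

Set Implicit Arguments.
Unset Strict Implicit.
Unset Printing Implicit Defensive.

Import Order.TTheory GRing.Theory Num.Theory.
Import numFieldNormedType.Exports.

Local Open Scope classical_set_scope.
Local Open Scope ring_scope.

(** * Boole's identity *)

(** [T] does not map L^1 into L^1, so there is no norm estimate to start from; the weak type bound
    is the only quantitative input, and no L^2 theory is used. For general f_n it gives convergence
    of [T f_n] almost everywhere along fast sequences, not in norm. Limits are therefore taken by
    Fatou's lemma, which is why the argument speaks of lower semicontinuous seminorms with values up
    to +oo, and it is lower semicontinuity that lets a hump survive the later changes near c. The
    weak type bound alone controls a level set of height lam by 1 / lam, which just fails to be
    integrable. Applied in turn to both arguments of the antisymmetric pairing, it bounds the
    integral of a truncated transform over a set of measure b by a multiple of b log (1 / b),
    uniformly in the truncation; this replaces boundedness on some L^p. The constant 4 counts the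
    positive and negative parts of the real and of the imaginary part. The real transform is treated
    first, without the factor 1 / pi. *)

Lemma mulr_lt0_trans (R : realDomainType) (a b c : R) :
  a * c < 0 -> 0 < c * b -> a * b < 0.
Proof.
move=> ac cb; have : (a * c) * (c * b) < 0 by rewrite nmulr_rlt0.
rewrite mulrA -(mulrA a) -expr2 mulrAC => h; rewrite ltNge; apply/negP => ab.
by move: h; rewrite ltNge mulr_ge0// sqr_ge0.
Qed.

Section Boole.
Variable R : realType.
Implicit Types (s : seq R) (m : R -> R).

(** The equation [sum_a m a / (a - t) = 1] with denominators cleared: off the poles this is
    [prod_b (t - b)] times one minus the sum. The plus sign comes from [a - t = - (t - a)]. *)
Definition boole_poly s m : {poly R} :=
  \prod_(a <- s) ('X - a%:P)
  + \sum_(a <- s) m a *: \prod_(b <- s | b != a) ('X - b%:P).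

(** Only the summand of [q] survives at [q], so positive masses make the signs at successive poles
    alternate. *)
Lemma boole_poly_pole s m q : uniq s -> q \in s ->
  (boole_poly s m).[q] = m q * \prod_(b <- s | b != q) (q - b).
Proof.
move=> us qs; rewrite /boole_poly hornerD (bigD1_seq q)//= hornerM hornerXsubC.
rewrite subrr mul0r add0r horner_sum (bigD1_seq q)//=.
rewrite [X in _ + X]big1_seq ?addr0.
  by rewrite hornerZ horner_prod; congr (_ * _); apply: eq_bigr => b _; rewrite hornerXsubC.
move=> a /andP[aq as_]; rewrite hornerZ -big_filter (bigD1_seq q)/=.
- by rewrite hornerM hornerXsubC subrr mul0r mulr0.
- by rewrite mem_filter eq_sym aq.
- exact: filter_uniq.
Qed.

Lemma boole_poly_horner s m t : uniq s -> t \notin s ->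
  (boole_poly s m).[t] =
  \prod_(b <- s) (t - b) * (1 - \sum_(a <- s) m a / (a - t)).
Proof.
move=> us ts; rewrite /boole_poly hornerD horner_prod mulrBr mulr1; congr (_ + _).
  by apply: eq_bigr => b _; rewrite hornerXsubC.
rewrite horner_sum mulr_sumr -sumrN; apply: eq_big_seq => a as_.
have ta : a - t != 0.
  by apply/eqP => /subr0_eq at_; move: ts; rewrite -at_ as_.
rewrite hornerZ horner_prod (bigD1_seq a)//=.
under eq_bigr do rewrite hornerXsubC.
by field.
Qed.

Lemma size_prod_XsubC_neq s a : uniq s -> a \in s ->
  size (\prod_(b <- s | b != a) ('X - b%:P) : {poly R}) = size s.
Proof.
move=> us as_; rewrite -big_filter size_prod_XsubC -rem_filter// size_rem//.
by case: s as_ {us}.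
Qed.

Lemma size_boole_sum s m : uniq s ->
  (size (\sum_(a <- s) m a *: \prod_(b <- s | b != a) ('X - b%:P) : {poly R})%R <= size s)%N.
Proof.
move=> us; rewrite big_seq.
elim/big_ind : _ => [|p q hp hq|a as_]; first by rewrite size_poly0.
  by rewrite (leq_trans (size_polyD _ _))// geq_max hp.
by rewrite (leq_trans (size_scale_leq _ _))// size_prod_XsubC_neq.
Qed.

Lemma size_boole_poly s m : uniq s -> size (boole_poly s m) = (size s).+1.
Proof.
move=> us; rewrite /boole_poly size_polyDl size_prod_XsubC//.
by rewrite ltnS size_boole_sum.
Qed.

Lemma monic_boole_poly s m : uniq s -> boole_poly s m \is monic.
Proof.
move=> us; rewrite monicE /boole_poly lead_coefDl ?size_prod_XsubC ?ltnS ?size_boole_sum//.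
by rewrite -monicE monic_prod_XsubC.
Qed.

(** By Vieta this coefficient is also minus the sum of the roots; hence poles minus roots add up to
    the total mass, which is Boole's identity. *)
Lemma coef_boole_poly s m : uniq s -> (0 < size s)%N ->
  (boole_poly s m)`_(size s).-1 = \sum_(a <- s) m a - \sum_(a <- s) a.
Proof.
move=> us s0; rewrite /boole_poly coefD coefPn_prod_XsubC -?lt0n// addrC; congr (_ + _).
rewrite coef_sum; apply: eq_big_seq => a as_; rewrite coefZ.
have /monicP : (\prod_(b <- s | b != a) ('X - b%:P) : {poly R}) \is monic.
  by rewrite -big_filter monic_prod_XsubC.
by rewrite lead_coefE size_prod_XsubC_neq// => ->; rewrite mulr1.
Qed.

(* [x] lies so far to the left of the poles that the sum is below 1 there. *)
Lemma boole_poly_left s m : uniq s -> {in s, forall a, 0 < m a} ->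
  exists2 x, {in s, forall a, x < a} &
    0 < (boole_poly s m).[x] * \prod_(b <- s) (x - b).
Proof.
move=> us m0.
have [x0 hx0] : exists x0, {in s, forall a, x0 <= a}.
  elim: s {us m0} => [|a s [x hx]]; first by exists 0.
  exists (Num.min a x) => b; rewrite inE => /predU1P[->|/hx]; first by rewrite ge_min lexx.
  by move=> xb; rewrite ge_min xb orbT.
pose M := \sum_(a <- s) m a.
have M0 : 0 <= M by rewrite /M big_seq sumr_ge0// => a as_; rewrite ltW// m0.
(* Every denominator [a - x] is then at least [M + 1], so the sum at [x] is at most
   [M / (M + 1) < 1]. *)
pose x := x0 - M - 1.
have xlt : {in s, forall a, M + 1 <= a - x} by move=> a /hx0; rewrite /x; lra.
have xs : {in s, forall a, x < a} by move=> a /xlt; move: M0; lra.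
exists x => //.
have xns : x \notin s by apply/negP => /xs; rewrite ltxx.
rewrite boole_poly_horner// mulrAC -expr2; apply: mulr_gt0.
  rewrite exprn_even_gt0//= prodf_seq_neq0; apply/allP => b /xs bx /=.
  by rewrite subr_eq0 lt_eqF.
rewrite subr_gt0 (@le_lt_trans _ _ (M / (M + 1)))//; last first.
  by rewrite ltr_pdivrMr ?mul1r ?ltrDl// ltr_wpDl.
rewrite /M mulr_suml big_seq [leRHS]big_seq; apply: ler_sum => a as_.
by rewrite ler_pM2l ?m0// lef_pV2 ?posrE ?xlt// ?subr_gt0 ?xs// ltr_wpDl.
Qed.

(** For neighbouring poles p < q the two products of differences contain [p - q] and [q - p], whose
    product is negative; every other pole lies on one side of both p and q and contributes a
    positive factor. The point [x] plays the role of a pole to the left of all others. *)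
Lemma boole_poly_consecutive s m x k : sorted <%R s ->
  {in s, forall a, 0 < m a} -> {in s, forall a, x < a} ->
  0 < (boole_poly s m).[x] * \prod_(b <- s) (x - b) -> (k < size s)%N ->
  (boole_poly s m).[nth 0 (x :: s) k] * (boole_poly s m).[nth 0 s k] < 0.
Proof.
move=> ss m0 xs x0 ks.
have us : uniq s by apply: sorted_uniq ss; [exact: lt_trans|exact: ltxx].
have lts i j : (i < j)%N -> (j < size s)%N -> s`_i < s`_j.
  move=> ij js; have := @sorted_ltn_nth _ <%R lt_trans 0 s ss i j.
  by rewrite !inE; apply => //; exact: ltn_trans js.
set q := s`_k; have qs : q \in s by exact: mem_nth.
have [k0|] := posnP k.
  subst k => /=; rewrite (boole_poly_pole m us qs).
  have {}x0 : (boole_poly s m).[x] * \prod_(b <- s | b != q) (x - b) < 0.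
    move: x0; rewrite (bigD1_seq q)//= mulrCA; have := xs q qs.
    by rewrite -subr_lt0 => h; rewrite nmulr_rgt0.
  rewrite mulrCA pmulr_rlt0 ?m0//.
  have sx : 0 < \prod_(b <- s | b != q) (x - b) * \prod_(b <- s | b != q) (q - b).
    rewrite -big_split/= big_seq_cond; apply: prodr_gt0 => b /andP[bs bq].
    rewrite nmulr_lgt0 ?subr_lt0 ?xs// lt_neqAle eq_sym bq/=.
    have /(nthP 0)[j js <-] := bs; have [->//|j0] := posnP j.
    by rewrite ltW// lts.
  exact: mulr_lt0_trans x0 sx.
move=> k0; have pE : nth 0 (x :: s) k = s`_k.-1 by case: k k0 {ks q qs}.
rewrite pE; set p := s`_k.-1.
have kk : (k.-1 < k)%N by rewrite prednK.
have k1s : (k.-1 < size s)%N by exact: ltn_trans ks.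
have ps : p \in s by exact: mem_nth.
have pq : p < q by exact: lts.
rewrite !boole_poly_pole// mulrACA pmulr_rlt0 ?mulr_gt0 ?m0//.
rewrite -big_filter -[X in _ * X]big_filter (bigD1_seq q)/=; last 2 first.
- by rewrite mem_filter qs gt_eqF.
- exact: filter_uniq.
rewrite [X in _ * X](bigD1_seq p)/=; last 2 first.
- by rewrite mem_filter ps lt_eqF.
- exact: filter_uniq.
rewrite mulrACA !big_filter_cond/=.
rewrite nmulr_rlt0 ?nmulr_rlt0 ?subr_gt0 ?subr_lt0//.
under eq_bigl do rewrite andbC.
rewrite -big_split/= big_seq_cond; apply: prodr_gt0 => b /and3P[bs bq bp].
have /(nthP 0)[j js jb] := bs.
have [jk|jk|jk] := ltngtP j k.
- have jk1 : (j < k.-1)%N.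
    rewrite ltn_neqAle -ltnS prednK// jk andbT; apply/eqP => jk1.
    by move: bp; rewrite -jb jk1 eqxx.
  by rewrite -jb mulr_gt0// subr_gt0 lts.
- by rewrite -jb nmulr_lgt0 ?subr_lt0 ?lts// (ltn_trans kk).
- by move: bq; rewrite -jb jk eqxx.
Qed.

(** The intervals are [[r k, s_k]], where [r k] is the root between the pole [s_k] and its left
    neighbour (or [x]). Interlacing produces as many roots as the degree, so the polynomial factors
    completely and the lengths can be summed by Vieta. *)
Lemma boole_cover s m : sorted <%R s -> {in s, forall a, 0 < m a} ->
  exists l : seq (R * R), [/\ {in l, forall p, p.1 <= p.2},
    \sum_(p <- l) (p.2 - p.1) = \sum_(a <- s) m a &
    forall t, t \notin s -> 1 < \sum_(a <- s) m a / (a - t) ->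
      exists2 p, p \in l & p.1 <= t <= p.2].
Proof.
move=> ss m0.
have us : uniq s by apply: sorted_uniq ss; [exact: lt_trans|exact: ltxx].
have [s0|s0] := posnP (size s).
  exists [::]; split=> //; first by rewrite (size0nil s0) !big_nil.
  by move=> t _; rewrite (size0nil s0) big_nil; lra.
have [x xs x0] := boole_poly_left us m0.
have xss : sorted <%R (x :: s).
  by rewrite /= path_min_sorted//; apply/allP => a /xs.
have lts i j : (i < j)%N -> (j <= size s)%N -> (x :: s)`_i < (x :: s)`_j.
  move=> ij js; have := @sorted_ltn_nth _ <%R lt_trans 0 (x :: s) xss i j.
  by rewrite !inE !ltnS; apply => //; exact: leq_trans (ltnW ij) js.
have [r hr] : exists r : nat -> R, forall k, (k < size s)%N ->
    (x :: s)`_k < r k < s`_k /\ root (boole_poly s m) (r k).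
  suff /choice[r hr] : forall k, exists y, (k < size s)%N ->
    (x :: s)`_k < y < s`_k /\ root (boole_poly s m) y by exists r.
  move=> k; have [ks|_] := ltnP k (size s); last by exists 0.
  have lt1 : (x :: s)`_k < s`_k by exact: (lts k k.+1).
  have [y yin yr] := poly_ivtoo (ltW lt1) (boole_poly_consecutive ss m0 xs x0 ks).
  by exists y => _; split => //; move: yin; rewrite in_itv.
pose rs := [seq r k | k <- iota 0 (size s)].
have rlt i j : (i < j)%N -> (j < size s)%N -> r i < r j.
  move=> ij js; have [/andP[_ h1] _] := hr i (ltn_trans ij js).
  have [/andP[h2 _] _] := hr j js.
  apply: lt_trans h1 (le_lt_trans _ h2); have [<-//|] := eqVneq i.+1 j.
  by move=> nij; apply/ltW/(lts i.+1); [rewrite ltn_neqAle nij|exact: ltnW].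
have urs : uniq rs.
  rewrite map_inj_in_uniq ?iota_uniq// => i j.
  rewrite !mem_iota !add0n /= => ik jk rij.
  by have [h|h|//] := ltngtP i j; have := rlt _ _ h; rewrite rij ltxx => /(_ _)/[!(ik,jk)]/(_ isT).
have srs : size rs = size s by rewrite size_map size_iota.
have Drs : boole_poly s m = \prod_(y <- rs) ('X - y%:P).
  have -> : boole_poly s m = lead_coef (boole_poly s m) *: \prod_(y <- rs) ('X - y%:P).
    apply: all_roots_prod_XsubC.
  - by rewrite size_boole_poly// srs.
  - apply/allP => y /mapP[k]; rewrite mem_iota add0n => /= ks ->.
    by have [] := hr k ks.
  - by rewrite uniq_rootsE.
  by rewrite (monicP (monic_boole_poly m us)) scale1r.
have rsE (F : R -> R) : \sum_(y <- rs) F y = \sum_(0 <= k < size s) F (r k).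
  by rewrite big_map /index_iota subn0.
have sE (F : R -> R) : \sum_(a <- s) F a = \sum_(0 <= k < size s) F s`_k.
  by rewrite (big_nth 0).
exists [seq (r k, s`_k) | k <- iota 0 (size s)]; split.
- move=> p /mapP[k]; rewrite mem_iota add0n => /= ks ->/=.
  by have [/andP[_ /ltW]] := hr k ks.
- rewrite big_map /= -{1}[iota 0 _](_ : index_iota 0 (size s) = _); last first.
    by rewrite /index_iota subn0.
  rewrite big_split/= sumrN -(sE id) -(rsE id).
  have := coef_boole_poly m us s0; rewrite Drs -srs coefPn_prod_XsubC; last by rewrite srs -lt0n.
  by lra.
- move=> t ts h; apply: contrapT => ht.
  (* Outside the intervals, [t] is on the same side of each root as of its pole, so the polynomial
     has the sign of [prod_b (t - b)] and the sum is below 1. *)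
  have {}ht k : (k < size s)%N -> 0 < (t - r k) * (t - s`_k).
    move=> ks; have [/andP[_ rs_] _] := hr k ks.
    have [tr|rt] := ltP t (r k).
      by rewrite nmulr_lgt0 subr_lt0// (lt_trans tr).
    have [ts'|st] := leP t s`_k.
      exfalso; apply: ht; exists (r k, s`_k); last by rewrite rt.
      by apply/mapP; exists k => //; rewrite mem_iota.
    by rewrite mulr_gt0// subr_gt0// (lt_trans rs_).
  have : 0 < (boole_poly s m).[t] * \prod_(b <- s) (t - b).
    rewrite Drs horner_prod big_map [X in _ * X](big_nth 0) /index_iota subn0 -big_split/=.
    rewrite big_seq; apply: prodr_gt0 => k; rewrite mem_iota add0n => /= ks.
    by rewrite hornerXsubC ht.
  rewrite boole_poly_horner// mulrAC -expr2 ltNge => /negP; apply.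
  by rewrite mulr_ge0_le0 ?sqr_ge0// subr_le0 ltW.
Qed.
End Boole.

(** * Maximal function of a finite sum of poles *)

Section BooleSigned.
Variable R : realType.
Implicit Types (s : seq R) (m : R -> R) (l : seq (R * R)).

(* The poles themselves are covered by degenerate intervals, so that the junk
   value of the sum at a pole does not matter. *)
Lemma boole_superlevel s m (lam : R) : sorted <%R s -> {in s, forall a, 0 <= m a} ->
  0 < lam ->
  exists l, [/\ {in l, forall p, p.1 <= p.2},
    \sum_(p <- l) (p.2 - p.1) = (\sum_(a <- s) m a) / lam &
    forall t, lam < \sum_(a <- s) m a / (a - t) ->
      exists2 p, p \in l & p.1 <= t <= p.2].
Proof.
(* Atoms without mass are dropped, because [boole_cover] needs positive masses. *)
move=> ss m0 lam0; pose s' := [seq a <- s | 0 < m a].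
have m0' a : a \in s -> ~~ (0 < m a) -> m a = 0.
  by move=> /m0; rewrite le_eqVlt => /predU1P[<-//|->].
have ss' : sorted <%R s' by apply: sorted_filter ss; exact: lt_trans.
have [|l [l1 l2 l3]] := @boole_cover R s' (fun a => m a / lam) ss'.
  by move=> a; rewrite mem_filter => /andP[ma _]; rewrite divr_gt0.
exists (l ++ [seq (a, a) | a <- s]); split.
- move=> p; rewrite mem_cat => /orP[/l1//|/mapP[a _ ->]/=]; exact: lexx.
- rewrite big_cat/= big_map/= [X in _ + X]big1; last by move=> a _; rewrite subrr.
  rewrite addr0 l2 -mulr_suml big_filter; congr (_ / _).
  rewrite [RHS](bigID (fun a => 0 < m a))/= [X in _ = _ + X]big_seq_cond.
  by rewrite [X in _ = _ + X]big1 ?addr0// => a /andP[] /m0' h /h.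
- move=> t h; have [ts|ts] := boolP (t \in s).
    exists (t, t); last by rewrite /= lexx.
    by rewrite mem_cat; apply/orP; right; apply/mapP; exists t.
  have [||p pl pt] := l3 t.
  + by rewrite mem_filter negb_and ts orbT.
  + rewrite big_filter; under eq_bigr do rewrite mulrAC.
    rewrite -mulr_suml ltr_pdivlMr// mul1r (lt_le_trans h)// le_eqVlt; apply/orP; left.
    rewrite [X in X == _](bigID (fun a => 0 < m a))/= [X in _ + X == _]big_seq_cond.
    rewrite [X in _ + X == _]big1 ?addr0// => a /andP[] /m0' h' /h' ->.
    by rewrite mul0r.
  + by exists p => //; rewrite mem_cat pl.
Qed.

(** The reflection [t -> - t] changes the sign of the sum and reverses the order of the poles, hence
    the [rev]. *)
Lemma boole_sublevel s m (lam : R) : sorted <%R s -> {in s, forall a, 0 <= m a} ->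
  0 < lam ->
  exists l, [/\ {in l, forall p, p.1 <= p.2},
    \sum_(p <- l) (p.2 - p.1) = (\sum_(a <- s) m a) / lam &
    forall t, \sum_(a <- s) m a / (a - t) < - lam ->
      exists2 p, p \in l & p.1 <= t <= p.2].
Proof.
move=> ss m0 lam0; pose s' := rev [seq - a | a <- s].
have ss' : sorted <%R s'.
  rewrite rev_sorted sorted_map; apply: sub_sorted ss => a b /=.
  by rewrite ltrN2.
have [|//|l [l1 l2 l3]] := @boole_superlevel s' (fun a => m (- a)) lam ss'.
  by move=> a; rewrite mem_rev => /mapP[b /m0 mb ->]; rewrite opprK.
exists [seq (- p.2, - p.1) | p <- l]; split.
- by move=> p /mapP[q /l1 h ->]/=; rewrite lerN2.
- rewrite big_map/=; under eq_bigr do rewrite opprK addrC.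
  rewrite l2 big_rev big_map/=; congr (_ / _).
  by apply: eq_bigr => a _; rewrite opprK.
- move=> t; rewrite ltrNr => h; have [|p pl pt] := l3 (- t).
    rewrite (lt_le_trans h)// le_eqVlt; apply/orP; left; apply/eqP.
    rewrite big_rev big_map/= -sumrN; apply: eq_bigr => a _.
    by rewrite opprK -opprD invrN mulrN.
  exists (- p.2, - p.1); first by apply/mapP; exists p.
  by rewrite /= lerNl lerNr andbC.
Qed.

Definition itv_union l : set R := \bigcup_(p in [set` l]) `[p.1, p.2]%classic.

Lemma measurable_itv_union l : measurable (itv_union l).
Proof. by apply: fin_bigcup_measurable => // p _; exact: measurable_itv. Qed.

Lemma measure_itv_union l : {in l, forall p, p.1 <= p.2} ->
  (lebesgue_measure (itv_union l) <= (\sum_(p <- l) (p.2 - p.1))%:E)%E.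
Proof.
elim: l => [_|p l ih hl].
  by rewrite /itv_union big_nil set_nil bigcup_set0 measure0.
rewrite /itv_union bigcup_seq big_cons big_cons EFinD -bigcup_seq.
apply: (le_trans (measureU2 _ _ _)) => /=.
- exact: measurable_itv.
- exact: measurable_itv_union.
apply: leeD; last by apply: ih => q ql; apply: hl; rewrite inE ql orbT.
rewrite lebesgue_measure_itv/= lte_fin -EFinB; case: ifPn => // _.
by rewrite lee_fin subr_ge0 hl// mem_head.
Qed.

Definition ballp (p : R * R) : set R := ball p.1 p.2.

(* To the right of the centre [t] of a ball, the contribution of the atoms
   outside the ball is at least its value at [t]. *)
Lemma discrete_maximal s m (lam : R) (F : seq (R * R)) :
  sorted <%R s -> {in s, forall a, 0 <= m a} -> 0 < lam ->
  uniq F -> {in F, forall p, 0 < p.2} -> trivIset [set` F] ballp ->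
  {in F, forall p, lam < \sum_(a <- s | p.2 <= `|a - p.1|) m a / (a - p.1)} ->
  \sum_(p <- F) p.2 <= 4 * (\sum_(a <- s) m a) / lam.
Proof.
move=> ss m0 lam0 uF F0 tF hF.
have l20 : 0 < lam / 2 by rewrite divr_gt0.
have [l [l1 l2 l3]] := boole_superlevel ss m0 l20.
pose near_atoms (p : R * R) := [seq a <- s | `|a - p.1| < p.2].
have near_s p a : a \in near_atoms p -> a \in s by rewrite mem_filter => /andP[].
have /choice[lp hlp] : forall p, exists l, [/\ {in l, forall p, p.1 <= p.2},
    \sum_(p <- l) (p.2 - p.1) = (\sum_(a <- near_atoms p) m a) / (lam / 2) &
    forall t, \sum_(a <- near_atoms p) m a / (a - t) < - (lam / 2) ->
      exists2 p, p \in l & p.1 <= t <= p.2].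
  move=> p; apply: boole_sublevel => //; last by move=> a /near_s /m0.
  by apply: sorted_filter ss; exact: lt_trans.
(* Only the right half of each ball is used; its length [p.2] is what the conclusion sums. *)
pose J (p : R * R) : set R := `]p.1, p.1 + p.2[%classic.
have Jball p : J p `<=` ballp p.
  move=> t; rewrite /J/= in_itv/= => /andP[h1 h2].
  by rewrite /ballp /ball/= distrC ger0_norm; lra.
(* On [J p] the far atoms contribute more than [lam]. Either the full sum exceeds [lam / 2], or the
   near atoms must contribute less than [- (lam / 2)]. *)
have Jsub p : p \in F -> J p `<=` (J p `&` itv_union l) `|` itv_union (lp p).
  move=> pF t Jt; have [_ _ h3] := hlp p.
  have tJ := Jt; move: Jt; rewrite /J/= in_itv/= => /andP[h1 h2].
  have far : lam < \sum_(a <- s | p.2 <= `|a - p.1|) m a / (a - t).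
    apply: (lt_le_trans (hF _ pF)); rewrite big_seq_cond [leRHS]big_seq_cond.
    apply: ler_sum => a /andP[as_ pa]; rewrite ler_wpM2l ?m0//.
    have := F0 _ pF => p20; have [ap|ap] := lerP 0 (a - p.1).
      rewrite ger0_norm// in pa; rewrite lef_pV2 ?posrE; lra.
    by rewrite ltr0_norm// in pa; rewrite lef_nV2 ?negrE; lra.
  have [h|h] := ltP (lam / 2) (\sum_(a <- s) m a / (a - t)).
    left; split => //; have [q ql qt] := l3 t h.
    by exists q => //=; rewrite in_itv.
  right; have [|q ql qt] := h3 t; last by exists q => //=; rewrite in_itv.
  move: h; rewrite (bigID (fun a => p.2 <= `|a - p.1|))/= /near_atoms big_filter.
  under [X in _ + X <= _]eq_bigl do rewrite -ltNge.
  by move: far; lra.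
have mJ p : measurable (J p) by exact: measurable_itv.
have muJ p : p \in F -> lebesgue_measure (J p) = (p.2)%:E.
  move=> /F0 p0; rewrite /J lebesgue_measure_itv/= lte_fin ltrDl p0.
  by rewrite -EFinB; congr EFin; lra.
(* The balls are disjoint, so each atom is near to at most one centre. *)
have nearsum : \sum_(p <- F) \sum_(a <- near_atoms p) m a <= \sum_(a <- s) m a.
  under eq_bigr do rewrite /near_atoms big_filter.
  rewrite (exchange_big_dep xpredT)//= big_seq [leRHS]big_seq; apply: ler_sum => a as_.
  have [[p pF pa]|nop] := pselect (exists2 p, p \in F & `|a - p.1| < p.2).
    rewrite -big_filter (bigD1_seq p)/= ?mem_filter ?pa ?filter_uniq//.
    rewrite big_seq_cond big1 ?addr0// => q /andP[]; rewrite mem_filter => /andP[qa qF].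
    move=> /eqP qp; exfalso; apply: qp; apply: tF => //=; exists a.
    by rewrite /ballp /ball/= !(distrC _ a); split.
  by rewrite big_seq_cond big1 ?m0// => p /andP[pF pa]; exfalso; apply: nop; exists p.
rewrite -lee_fin -sumEFin.
rewrite (@le_trans _ _ (lebesgue_measure (itv_union l) +
    \sum_(p <- F) lebesgue_measure (itv_union (lp p)))%E)//.
  have -> : (\sum_(p <- F) (p.2)%:E = \sum_(p <- F) lebesgue_measure (J p))%E.
    by apply: eq_big_seq => p /muJ.
  apply: (@le_trans _ _ (\sum_(p <- F) (lebesgue_measure (J p `&` itv_union l) +
     lebesgue_measure (itv_union (lp p))))%E).
    rewrite big_seq [leRHS]big_seq; apply: lee_sum => p pF.
    apply: (@le_trans _ _ (lebesgue_measure ((J p `&` itv_union l) `|` itv_union (lp p)))).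
      apply: le_measure; rewrite ?inE; [exact: mJ| |exact: Jsub].
      apply: measurableU; last exact: measurable_itv_union.
      by apply: measurableI; [exact: mJ|exact: measurable_itv_union].
    have m1 : measurable (J p `&` itv_union l).
      by apply: measurableI; [exact: mJ|exact: measurable_itv_union].
    have m2 : measurable (itv_union (lp p)) by exact: measurable_itv_union.
    exact: measureU2.
  rewrite big_split/= leeD2r// fsbig_seq// -measure_fin_bigcup//=.
  - apply: le_measure; rewrite ?inE//.
    + apply: fin_bigcup_measurable; [exact: finite_seq|move=> p _].
      by apply: measurableI; [exact: mJ|exact: measurable_itv_union].
    + exact: measurable_itv_union.
    + by apply: bigcup_sub => p _; exact: subIsetr.
  - exact: finite_seq.
  - move=> p q pF qF [x [[px _] [qx _]]]; apply: tF => //.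
    by exists x; split; exact: Jball.
  - move=> p _; by apply: measurableI; [exact: mJ|exact: measurable_itv_union].
apply: (@le_trans _ _ ((\sum_(a <- s) m a) / (lam / 2) +
    \sum_(p <- F) (\sum_(a <- near_atoms p) m a) / (lam / 2))%:E).
  rewrite EFinD -sumEFin; apply: leeD; first by rewrite -l2; exact: measure_itv_union.
  apply: lee_sum => p _; have [h1 h2 _] := hlp p.
  by rewrite -h2; exact: measure_itv_union.
rewrite lee_fin -mulr_suml -mulrDl ler_pdivrMr//.
(* The full sum and the near atoms each cost the total mass divided by [lam / 2]. *)
have -> : 4 * (\sum_(a <- s) m a) / lam * (lam / 2) = 2 * \sum_(a <- s) m a.
  by field; rewrite gt_eqF.
by rewrite mulr_natl mulr2n lerD2l.
Qed.

End BooleSigned.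

(** * Integration over (-1,1) *)

Notation LT R := (caratheodory_type (wlength (@idfun R))^*%mu).

Section IntegrationToolkit.
Context d (X : measurableType d) (R : realType) (mu : {measure set X -> \bar R}).
Variables (D : set X) (mD : measurable D).
Local Notation RI f := (mu.-integrable D (EFin \o f)).
Implicit Types f g h : X -> R.

Lemma RI_measurable f : RI f -> measurable_fun D f.
Proof. by move=> /measurable_int /measurable_EFinP. Qed.

Lemma le_RI f g : measurable_fun D f -> RI g -> (forall x, D x -> `|f x| <= g x) -> RI f.
Proof.
move=> mf ig fg; apply: (le_integrable mD _ _ ig); first exact/measurable_EFinP.
by move=> x Dx; rewrite /= lee_fin (le_trans (fg _ Dx))// ler_norm.
Qed.

Lemma RI_mul_bounded f h (M : R) : RI f -> measurable_fun D h ->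
  (forall x, D x -> `|h x| <= M) -> RI (fun x => f x * h x).
Proof.
move=> fi mh hM.
have : mu.-integrable D ((EFin \o f) \* (EFin \o h))%E.
  apply: integrableMl => //; exists M; split; first exact: num_real.
  by move=> N MN x Dx; apply: le_trans (hM x Dx) _; exact: ltW.
by apply: eq_integrable => // x _; rewrite /= EFinM.
Qed.

Lemma RI_D f g : RI f -> RI g -> RI (fun x => f x + g x).
Proof. by move=> fi gi; have := integrableD mD fi gi; apply: eq_integrable. Qed.

Lemma RI_B f g : RI f -> RI g -> RI (fun x => f x - g x).
Proof. by move=> fi gi; have := integrableB mD fi gi; apply: eq_integrable. Qed.

Lemma RI_N f : RI f -> RI (fun x => - f x).
Proof. by move=> fi; have := integrableN fi; apply: eq_integrable. Qed.

Lemma RI_Zl (c : R) f : RI f -> RI (fun x => c * f x).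
Proof. by move=> fi; have := integrableZl mD c fi; apply: eq_integrable. Qed.

Lemma RI_abs f : RI f -> RI (fun x => `|f x|).
Proof. exact: integrable_norm. Qed.

Lemma RintegralN f : RI f -> \int[mu]_(x in D) (- f x) = - \int[mu]_(x in D) f x.
Proof.
move=> fi; rewrite -mulN1r -RintegralZl//; apply: eq_Rintegral => x _.
by rewrite mulN1r.
Qed.

Lemma RI_sum (I : eqType) (s : seq I) (F : I -> X -> R) :
  {in s, forall i, RI (F i)} -> RI (fun x => \sum_(i <- s) F i x).
Proof.
elim: s => [_|i s ih h].
  have := integrable0 mu D; apply: eq_integrable => // x _ /=.
  by rewrite big_nil.
have hs : {in s, forall i, RI (F i)} by move=> j js; apply: h; rewrite inE js orbT.
have := RI_D (h i (mem_head _ _)) (ih hs).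
by apply: eq_integrable => // x _ /=; rewrite big_cons.
Qed.

Lemma Rintegral_sum (I : eqType) (s : seq I) (F : I -> X -> R) :
  {in s, forall i, RI (F i)} ->
  \int[mu]_(x in D) (\sum_(i <- s) F i x) = \sum_(i <- s) \int[mu]_(x in D) F i x.
Proof.
elim: s => [_|i s ih h].
  rewrite big_nil; under eq_Rintegral do rewrite big_nil.
  by rewrite Rintegral_cst// mul0r.
have hs : {in s, forall i, RI (F i)} by move=> j js; apply: h; rewrite inE js orbT.
rewrite big_cons -ih//; under eq_Rintegral do rewrite big_cons.
by rewrite RintegralD//; [exact: h (mem_head _ _)|exact: RI_sum].
Qed.

Lemma Rintegral_ae_eq f g : measurable_fun D f -> measurable_fun D g ->
  {ae mu, forall x, D x -> f x = g x} ->
  \int[mu]_(x in D) f x = \int[mu]_(x in D) g x.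
Proof.
move=> mf mg fg; rewrite /Rintegral; congr fine; apply: ae_eq_integral => //.
- exact/measurable_EFinP.
- exact/measurable_EFinP.
- by apply: filterS fg => x h Dx; rewrite h.
Qed.

Lemma RI_ae_eq f g : measurable_fun D g -> {ae mu, forall x, D x -> f x = g x} ->
  RI f -> RI g.
Proof.
move=> mg fg fi; have mf := RI_measurable fi.
have /integrableP[_ fy] := fi.
apply/integrableP; split; first exact/measurable_EFinP.
rewrite (@ae_eq_integral _ _ _ mu D (abse \o (EFin \o f)))//.
- by do 2 apply: measurableT_comp => //.
- by do 2 apply: measurableT_comp => //.
- by apply: filterS fg => x h Dx; rewrite /= h.
Qed.

Lemma Rintegral_dominated (F : nat -> X -> R) f g :
  (forall n, measurable_fun D (F n)) -> measurable_fun D f ->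
  {ae mu, forall x, D x -> F ^~ x @ \oo --> f x} -> RI g ->
  {ae mu, forall x, forall n, D x -> `|F n x| <= g x} ->
  RI f /\ \int[mu]_(x in D) F n x @[n --> \oo] --> \int[mu]_(x in D) f x.
Proof.
move=> mF mf Ff gi Fg.
have [||||fi _ c] := @dominated_convergence _ _ _ mu D mD (fun n => EFin \o F n) (EFin \o f)
  (EFin \o g) _ _ _ gi _.
- by move=> n; exact/measurable_EFinP.
- exact/measurable_EFinP.
- by apply: filterS Ff => x h Dx; apply: cvg_EFin; [exact: nearW|exact: h].
- by apply: filterS Fg => x h n Dx; rewrite /= lee_fin h.
split=> //; apply: fine_cvg; rewrite /Rintegral fineK//; exact: integrable_fin_num.
Qed.

Lemma Rintegral_norm_le f g : measurable_fun D f -> RI g ->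
  (forall x, D x -> `|f x| <= g x) ->
  `|\int[mu]_(x in D) f x| <= \int[mu]_(x in D) g x.
Proof.
move=> mf gi fg; have fi := le_RI mf gi fg.
by rewrite (le_trans (le_normr_Rintegral mD fi))// le_Rintegral//; exact: RI_abs.
Qed.

End IntegrationToolkit.

Section LebBasics.
Variable R : realType.

Lemma lebE (A : set R) : leb R A = lebesgue_measure A.
Proof. by []. Qed.

Lemma borel_leb (A : set R) : measurable (A : set (measurableTypeR R)) ->
  measurable (A : set (LT R)).
Proof. exact: sub_caratheodory. Qed.

Lemma measurable_id_leb : measurable_fun [set: LT R] (idfun : LT R -> measurableTypeR R).
Proof. by move=> _ A mA; rewrite setTI; exact: borel_leb. Qed.

Lemma measurable_borel_leb d (T : measurableType d) (D : set R) (f : R -> T) :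
  measurable_fun [set: measurableTypeR R] f -> measurable_fun (D : set (LT R)) f.
Proof.
move=> mf; apply: measurable_funTS; exact: (measurableT_comp mf measurable_id_leb).
Qed.

Lemma measurable_Iab : measurable (Iab : set (LT R)).
Proof. by apply: borel_leb; exact: measurable_itv. Qed.

Lemma leb_Iab : leb R Iab = 2%:E.
Proof.
rewrite lebE lebesgue_measure_itv/= lte_fin gtrN//.
by rewrite -EFinB opprK; congr EFin; lra.
Qed.
End LebBasics.

(** * The truncated Hilbert transform *)

Section Truncation.
Variable R : realType.
Implicit Types (u v phi : R -> R) (e t lam : R) (n : nat).

Definition IL1 u := (leb R).-integrable Iab (EFin \o u).

Lemma IL1_N u : IL1 u -> IL1 (fun x => - u x).
Proof. by move=> ui; apply: RI_N ui; exact: measurable_Iab. Qed.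

Lemma IL1_D u v : IL1 u -> IL1 v -> IL1 (fun x => u x + v x).
Proof. by move=> ui vi; apply: RI_D ui vi; exact: measurable_Iab. Qed.

Lemma IL1_B u v : IL1 u -> IL1 v -> IL1 (fun x => u x - v x).
Proof. by move=> ui vi; apply: RI_B ui vi; exact: measurable_Iab. Qed.

Lemma IL1_Zl c u : IL1 u -> IL1 (fun x => c * u x).
Proof. by move=> ui; apply: RI_Zl ui; exact: measurable_Iab. Qed.

Lemma IL1_abs u : IL1 u -> IL1 (fun x => `|u x|).
Proof. by move=> ui; apply: RI_abs ui; exact: measurable_Iab. Qed.

Definition normI u : R := \int[leb R]_(x in Iab) `|u x|.

Definition hker e (s : R) : R := if e < `|s| then s^-1 else 0.

(** The truncated transform of a real function, without the factor 1 / pi, which returns in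
    [TrC]. *)
Definition htr u e t : R := \int[leb R]_(x in Iab) (u x * hker e (x - t)).

Lemma hker_le e s : 0 < e -> `|hker e s| <= e^-1.
Proof.
move=> e0; rewrite /hker; case: ifPn => [es|_].
  by rewrite normfV lef_pV2 ?posrE//; [exact: ltW|exact: lt_trans es].
by rewrite normr0 invr_ge0 ltW.
Qed.

Lemma measurable_invr : measurable_fun [set: measurableTypeR R] (@GRing.inv R).
Proof.
have -> : @GRing.inv R = (fun s : R => if s == 0 then 0 else s^-1).
  by apply/funext => s; case: eqP => // ->; rewrite invr0.
apply: measurable_fun_if => //=; first exact: measurable_fun_eqr.
apply: (@open_continuous_measurable_fun R).
  rewrite setTI (_ : _ @^-1` _ = ~` [set 0]); first exact/closed_openC/closed_eq.
  by apply/seteqP; split => [x /= /eqP//|x /= /eqP/negbTE].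
move=> x; rewrite inE/= => -[_ /negbT x0]; exact: inv_continuous.
Qed.

Lemma measurable_hker e : measurable_fun [set: measurableTypeR R] (hker e).
Proof.
apply: measurable_fun_ifT => //=; last exact: measurable_invr.
by apply: measurable_fun_ltr.
Qed.

Lemma measurable_hker_shift e t (D : set R) :
  measurable_fun (D : set (LT R)) (fun x : R => hker e (x - t)).
Proof.
apply: measurable_borel_leb; apply: (measurableT_comp (measurable_hker e)).
exact: measurable_funB.
Qed.

Lemma htr_integrable u e t : IL1 u -> 0 < e -> IL1 (fun x => u x * hker e (x - t)).
Proof.
move=> ui e0; have k x : Iab x -> `|hker e (x - t)| <= e^-1 by move=> _; exact: hker_le.
exact (RI_mul_bounded (@measurable_Iab R) ui (@measurable_hker_shift e t Iab) k).
Qed.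

Lemma htrD u v e t : IL1 u -> IL1 v -> 0 < e ->
  htr (fun x => u x + v x) e t = htr u e t + htr v e t.
Proof.
move=> ui vi e0; rewrite /htr -RintegralD//; last 3 first.
- exact: measurable_Iab.
- exact: htr_integrable.
- exact: htr_integrable.
by apply: eq_Rintegral => x _; rewrite mulrDl.
Qed.

Lemma htrZ u c e t : IL1 u -> 0 < e ->
  htr (fun x => c * u x) e t = c * htr u e t.
Proof.
move=> ui e0; rewrite /htr -RintegralZl//; last 2 first.
- exact: measurable_Iab.
- exact: htr_integrable.
by apply: eq_Rintegral => x _; rewrite mulrA.
Qed.

Lemma htrN u e t : IL1 u -> 0 < e -> htr (fun x => - u x) e t = - htr u e t.
Proof.
move=> ui e0; rewrite -mulN1r -htrZ//; congr htr.
by apply/funext => x; rewrite mulN1r.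
Qed.

Lemma htrB u v e t : IL1 u -> IL1 v -> 0 < e ->
  htr (fun x => u x - v x) e t = htr u e t - htr v e t.
Proof.
move=> ui vi e0; rewrite htrD// ?htrN//.
exact: IL1_N.
Qed.

Definition grid_pt n (x : R) : R := (Num.floor (n.+1%:R * x))%:~R / n.+1%:R.

(** The multiples of [1 / (n + 1)] in [[-1, 1[]. The point -1 is included, since points of (-1,1)
    near -1 are rounded down to it. *)
Definition grid n : seq R :=
  [seq (k%:R - n.+1%:R) / n.+1%:R | k <- iota 0 (n.+1).*2].

Lemma sorted_grid n : sorted <%R (grid n).
Proof.
rewrite sorted_map; apply: sub_sorted (iota_ltn_sorted _ _) => i j /= ij.
by rewrite /relpre/= ltr_pM2r ?invr_gt0// ltrD2r ltr_nat.
Qed.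

Lemma grid_pt_itv n x : grid_pt n x <= x < grid_pt n x + n.+1%:R^-1.
Proof.
have /andP[h1 h2] := floor_itv (n.+1%:R * x).
rewrite /grid_pt ler_pdivrMr// (mulrC x) h1/=.
by rewrite -[X in _ < _ + X]mul1r -mulrDl ltr_pdivlMr// (mulrC x) (lt_le_trans h2)// intrD.
Qed.

Lemma mem_grid n x : Iab x -> grid_pt n x \in grid n.
Proof.
rewrite /Iab/= in_itv/= => /andP[x1 x2].
have n0 : (0 : R) < n.+1%:R by [].
pose k := Num.floor (n.+1%:R * x).
have k1 : (- (n.+1%:Z) <= k)%R.
  by rewrite /k floor_ge_int rmorphN/= -mulrN1 ler_pM2l// ltW.
have k2 : (k < n.+1%:Z)%R.
  by rewrite /k floor_lt_int -[X in _ < X]mulr1 ltr_pM2l.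
apply/mapP; exists (absz (k + n.+1%:Z)%R).
  rewrite mem_iota/= add0n -addnn; lia.
rewrite /grid_pt -/k; congr (_ / _).
have : ((absz (k + n.+1%:Z)%R)%:Z = k + n.+1%:Z)%R by lia.
move=> /(congr1 (fun z : int => z%:~R : R)); rewrite intrD -!pmulrn => ->; by rewrite addrK.
Qed.

Lemma cvg_grid_pt x : grid_pt ^~ x @ \oo --> x.
Proof.
apply/cvgrPdist_lt => e e0; near=> n.
have /andP[h1 h2] := grid_pt_itv n x.
rewrite ger0_norm ?subr_ge0// ltrBlDl (lt_trans h2)// ltrD2l.
near: n; exact: near_infty_natSinv_lt (PosNum e0).
Unshelve. all: by end_near. Qed.

Lemma measurable_grid_pt n : measurable_fun [set: measurableTypeR R] (grid_pt n).
Proof.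
apply: nondecreasing_measurable => // x y xy.
by rewrite /grid_pt ler_pM2r ?invr_gt0// ler_int le_floor// ler_pM2l.
Qed.

Definition grid_mass n u (a : R) : R :=
  \int[leb R]_(x in Iab) (u x * (grid_pt n x == a)%:R).

Lemma grid_mass_integrable n u a : IL1 u -> IL1 (fun x => u x * (grid_pt n x == a)%:R).
Proof.
move=> ui; apply: (RI_mul_bounded (@measurable_Iab R) ui (M := 1)).
- apply: measurable_borel_leb.
  rewrite (_ : (fun x => _) = fun x => if grid_pt n x == a then 1 else 0); last first.
    by apply/funext => x; case: eqP.
  apply: measurable_fun_ifT => //; apply: measurable_fun_eqr => //.
  exact: measurable_grid_pt.
- by move=> x _; case: eqP; rewrite ?normr1 ?normr0.
Qed.

(** Rounding the argument of [phi] amounts to replacing the measure [u dx] by finitely many atoms,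
    to which the bounds for sums of poles apply. *)
Lemma grid_sum n u phi : IL1 u ->
  \int[leb R]_(x in Iab) (u x * phi (grid_pt n x)) =
  \sum_(a <- grid n) grid_mass n u a * phi a.
Proof.
move=> ui.
transitivity (\int[leb R]_(x in Iab)
    (\sum_(a <- grid n) phi a * (u x * (grid_pt n x == a)%:R))).
  apply: eq_Rintegral => x; rewrite inE => Ix.
  have ug : uniq (grid n).
    by apply: sorted_uniq (sorted_grid n); [exact: lt_trans|exact: ltxx].
  rewrite (bigD1_seq (grid_pt n x))/= ?mem_grid// eqxx mulr1 mulrC.
  by rewrite big1 ?addr0// => a /negbTE; rewrite eq_sym => ->; rewrite !mulr0.
rewrite Rintegral_sum.
- apply: eq_bigr => a _; rewrite mulrC RintegralZl//; first exact: measurable_Iab.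
  exact: grid_mass_integrable.
- exact: measurable_Iab.
- by move=> a _; apply: RI_Zl; [exact: measurable_Iab|exact: grid_mass_integrable].
Qed.

Lemma grid_mass_ge0 n u a : (forall x, Iab x -> 0 <= u x) -> 0 <= grid_mass n u a.
Proof. by move=> u0; apply: Rintegral_ge0 => x Ix; rewrite mulr_ge0 ?u0. Qed.

Lemma grid_mass_sum n u : IL1 u ->
  \sum_(a <- grid n) grid_mass n u a = \int[leb R]_(x in Iab) u x.
Proof.
move=> ui; have := grid_sum n (fun=> 1) ui.
under eq_Rintegral do rewrite mulr1.
by move=> ->; apply: eq_bigr => a _; rewrite mulr1.
Qed.

End Truncation.

(** * The weak type (1,1) inequality *)

Lemma filter_in_seq (T : Type) (I : eqType) (s : seq I) (F : set_system T)
    (P : I -> T -> Prop) : Filter F ->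
  {in s, forall i, \forall x \near F, P i x} ->
  \forall x \near F, {in s, forall i, P i x}.
Proof.
move=> FF; elim: s => [_|i s ih h]; first by apply: nearW => x j; rewrite in_nil.
have h1 := h _ (mem_head i s).
have h2 : \forall x \near F, {in s, forall i, P i x}.
  by apply: ih => j js; apply: h; rewrite inE js orbT.
near=> x => j; rewrite inE => /predU1P[->|js]; first by near: x.
by move: j js; near: x.
Unshelve. all: by end_near. Qed.

Section MaximalInequality.
Variable R : realType.
Implicit Types (u v : R -> R) (e t lam : R) (n : nat) (F : seq (R * R)).

(** Reflection through 0, applied to the atoms and to the centres of the balls. *)
Lemma discrete_maximalN (s : seq R) m lam F :
  sorted <%R s -> {in s, forall a, 0 <= m a} -> 0 < lam ->
  uniq F -> {in F, forall p, 0 < p.2} -> trivIset [set` F] (@ballp R) ->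
  {in F, forall p, \sum_(a <- s | p.2 <= `|a - p.1|) m a / (a - p.1) < - lam} ->
  \sum_(p <- F) p.2 <= 4 * (\sum_(a <- s) m a) / lam.
Proof.
move=> ss m0 lam0 uF F0 tF hF.
pose s' := rev [seq - a | a <- s]; pose F' := [seq (- p.1, p.2) | p <- F].
have bF (p : R * R) x : ballp (- p.1, p.2) x -> ballp p (- x).
  by rewrite /ballp /ball/= opprK -opprD normrN.
have injF : injective (fun p : R * R => (- p.1, p.2)).
  by move=> [a b] [a' b'] /= [/oppr_inj -> ->].
have := @discrete_maximal R s' (fun a => m (- a)) lam F'.
rewrite big_map/= /s' big_rev big_map/=.
under [X in _ <= 4 * X / _]eq_bigr do rewrite opprK.
apply => //.
- rewrite rev_sorted sorted_map; apply: sub_sorted ss => a b /=.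
  by rewrite ltrN2.
- by move=> a; rewrite mem_rev => /mapP[b /m0 mb ->]; rewrite opprK.
- by rewrite map_inj_uniq.
- by move=> p /mapP[q /F0 h ->].
- move=> _ _ /mapP[p pF ->] /mapP[q qF ->] [x [px qx]].
  by rewrite (tF p q)//; exists (- x); split; exact: bF.
- move=> _ /mapP[p /hF h ->]/=; rewrite ltrNr in h.
  rewrite (lt_le_trans h)// big_rev big_map -sumrN le_eqVlt; apply/orP; left; apply/eqP.
  apply: eq_big => [a|a _]; first by rewrite -normrN opprD.
  by rewrite -[- a - _]opprD invrN mulrN opprK.
Qed.

Lemma aeI_S (P Q : R -> Prop) : (forall x, Iab x -> P x -> Q x) -> aeI P -> aeI Q.
Proof.
move=> PQ; apply: (@filterS _ _ (ae_filter_ringOfSetsType (leb R))) => x Px Ix.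
exact: PQ (Px Ix).
Qed.

Lemma aeI_W (P : R -> Prop) : (forall x, Iab x -> P x) -> aeI P.
Proof. by move=> h; apply: aeW. Qed.

Lemma aeI_and (P Q : R -> Prop) : aeI P -> aeI Q -> aeI (fun x => P x /\ Q x).
Proof.
move=> aP aQ; apply: (@filterS2 _ _ (ae_filter_ringOfSetsType (leb R)) _ _ _ _ aP aQ).
by move=> x Px Qx Ix; split; [exact: Px|exact: Qx].
Qed.

Lemma aeI_forall (P : nat -> R -> Prop) : (forall n, aeI (P n)) ->
  aeI (fun x => forall n, P n x).
Proof.
move=> aP; have : forall n, (leb R).-negligible (~` [set x | Iab x -> P n x]) by [].
move=> /negligible_bigcup; apply: negligibleS => x /= /not_implyP[Ix /existsNP[n nP]].
by exists n => //= h; exact: nP (h Ix).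
Qed.

Lemma aeI_not_countable (C : set R) : countable C -> aeI (fun x => ~ C x).
Proof.
move=> cC; exists C; split.
- by apply: borel_leb; exact: countable_measurable.
- by rewrite lebE countable_lebesgue_measure0.
- by move=> x /= /not_implyP[_ /contrapT].
Qed.

Definition mfI u := measurable_fun (Iab : set (LT R)) u.

Lemma IL1_mfI u : IL1 u -> mfI u.
Proof. exact: RI_measurable. Qed.

Lemma le_IL1 u v : mfI u -> IL1 v -> (forall x, Iab x -> `|u x| <= v x) -> IL1 u.
Proof. by apply: le_RI; exact: measurable_Iab. Qed.

Lemma mfI_M u v : mfI u -> mfI v -> mfI (fun x => u x * v x).
Proof. exact: measurable_funM. Qed.

Lemma mfI_borel u : measurable_fun [set: measurableTypeR R] u -> mfI u.
Proof. exact: measurable_borel_leb. Qed.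

Lemma IL1_mul_bounded u v (M : R) : IL1 u -> mfI v ->
  (forall x, Iab x -> `|v x| <= M) -> IL1 (fun x => u x * v x).
Proof. by apply: RI_mul_bounded; exact: measurable_Iab. Qed.

Lemma IL1_dominated (F : nat -> R -> R) u v :
  (forall n, mfI (F n)) -> mfI u -> aeI (fun x => F ^~ x @ \oo --> u x) -> IL1 v ->
  aeI (fun x => forall n, `|F n x| <= v x) ->
  IL1 u /\ \int[leb R]_(x in Iab) F n x @[n --> \oo] --> \int[leb R]_(x in Iab) u x.
Proof.
move=> mF mu_ Fu vi Fv.
apply: (@Rintegral_dominated _ _ _ (leb R) Iab (@measurable_Iab R) F u v) => //.
apply: (@filterS _ _ (ae_filter_ringOfSetsType (leb R))) Fv => x h n Ix.
exact: h.
Qed.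

(** Dominated convergence: away from the cut the kernel is continuous along the rounded arguments,
    and it is bounded by [1 / e]. *)
Lemma htr_grid_cvg u e t : IL1 u -> 0 < e ->
  \sum_(a <- grid R n | e <= `|a - t|) grid_mass n u a / (a - t) @[n --> \oo]
    --> htr u e t.
Proof.
move=> ui e0; pose phi (y : R) := if e <= `|y - t| then (y - t)^-1 else 0.
have phi_le y : `|phi y| <= e^-1.
  rewrite /phi; case: ifPn => [h|_]; last by rewrite normr0 invr_ge0 ltW.
  by rewrite normfV lef_pV2 ?posrE// (lt_le_trans e0).
have mphi : measurable_fun [set: measurableTypeR R] phi.
  apply: measurable_fun_ifT => //=.
    apply: measurable_fun_ler => //; apply: measurableT_comp => //.
    exact: measurable_funB.
  apply: (measurableT_comp (@measurable_invr R)); exact: measurable_funB.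
have E n : \sum_(a <- grid R n | e <= `|a - t|) grid_mass n u a / (a - t) =
    \int[leb R]_(x in Iab) (u x * phi (grid_pt n x)).
  rewrite grid_sum// big_mkcond/=; apply: eq_bigr => a _; rewrite /phi.
  by case: ifPn => // _; rewrite mulr0.
under eq_cvg do rewrite E.
have mu_ : mfI u by exact: IL1_mfI.
apply: (@IL1_dominated (fun n x => u x * phi (grid_pt n x))
  (fun x => u x * hker e (x - t)) (fun x => e^-1 * `|u x|) _ _ _ _ _).2.
- move=> n; apply: (mfI_M mu_); apply: mfI_borel.
  by apply: (measurableT_comp mphi); exact: measurable_grid_pt.
- apply: (mfI_M mu_); exact: measurable_hker_shift.
- have cC : countable [set t - e; t + e] by exact/finite_set_countable.
  apply: aeI_S (aeI_not_countable cC) => x Ix xC.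
  apply: cvgMr => //; rewrite /hker.
  have xte : `|x - t| != e.
    apply/eqP => xte; apply: xC => /=; move: xte.
    by case: (ger0P (x - t)) => _ h; [right|left]; lra.
  have cabs_ : `|grid_pt n x - t| @[n --> \oo] --> `|x - t|.
    by apply: cvg_norm; apply: cvgB; [exact: cvg_grid_pt|exact: cvg_cst].
  have [lt1|ge1] := ltP e `|x - t|.
    have h : \forall n \near \oo, (grid_pt n x - t)^-1 = phi (grid_pt n x).
      near=> n; rewrite /phi ifT//; apply: ltW.
      by near: n; exact: cvgr_gt lt1.
    apply: (cvg_trans (near_eq_cvg h)); apply: cvgV.
      by rewrite -normr_gt0 (lt_trans e0).
    by apply: cvgB; [exact: cvg_grid_pt|exact: cvg_cst].
  have lt2 : `|x - t| < e by rewrite lt_neqAle xte.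
  have h : \forall n \near \oo, 0 = phi (grid_pt n x).
    near=> n; rewrite /phi ifF//; apply/negbTE; rewrite -ltNge.
    by near: n; exact: cvgr_lt lt2.
  by apply: (cvg_trans (near_eq_cvg h)); exact: cvg_cst.
- by apply: IL1_Zl; exact: IL1_abs.
- apply: aeI_W => x Ix n; rewrite normrM mulrC ler_wpM2r//; exact: phi_le.
Unshelve. all: by end_near. Qed.

(** The family is finite and its inequalities are strict, so one grid realises all of them at
    once. *)
Lemma htr_maximal_ge0 u lam F : IL1 u -> (forall x, Iab x -> 0 <= u x) ->
  0 < lam -> uniq F -> {in F, forall p, 0 < p.2} -> trivIset [set` F] (@ballp R) ->
  {in F, forall p, lam < htr u p.2 p.1} ->
  \sum_(p <- F) p.2 <= 4 * (\int[leb R]_(x in Iab) u x) / lam.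
Proof.
move=> ui u0 lam0 uF F0 tF hF.
have /filter_ex[n hn] : \forall n \near \oo, {in F, forall p,
    lam < \sum_(a <- grid R n | p.2 <= `|a - p.1|) grid_mass n u a / (a - p.1)}.
  apply: filter_in_seq => p pF; have := @htr_grid_cvg u p.2 p.1 ui (F0 p pF).
  by move=> /cvgr_gt; apply; exact: hF.
rewrite -(grid_mass_sum n ui); apply: discrete_maximal hn => //.
- exact: sorted_grid.
- by move=> a _; exact: grid_mass_ge0.
Qed.

Lemma htr_maximal_ge0N u lam F : IL1 u -> (forall x, Iab x -> 0 <= u x) ->
  0 < lam -> uniq F -> {in F, forall p, 0 < p.2} -> trivIset [set` F] (@ballp R) ->
  {in F, forall p, htr u p.2 p.1 < - lam} ->
  \sum_(p <- F) p.2 <= 4 * (\int[leb R]_(x in Iab) u x) / lam.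
Proof.
move=> ui u0 lam0 uF F0 tF hF.
have /filter_ex[n hn] : \forall n \near \oo, {in F, forall p,
    \sum_(a <- grid R n | p.2 <= `|a - p.1|) grid_mass n u a / (a - p.1) < - lam}.
  apply: filter_in_seq => p pF; have := @htr_grid_cvg u p.2 p.1 ui (F0 p pF).
  by move=> /cvgr_lt; apply; exact: hF.
rewrite -(grid_mass_sum n ui); apply: discrete_maximalN hn => //.
- exact: sorted_grid.
- by move=> a _; exact: grid_mass_ge0.
Qed.

(** For [A] and [B] the transforms of the positive and negative parts: a large difference forces one
    of them beyond [lam / 2] in absolute value, so each ball is counted by at least one of the four
    one-sided cases. *)
Lemma le_sum_large_part (A B lam p : R) : 0 < p -> lam < `|A - B| ->
  p <= (if lam / 2 < A then p else 0) + (if A < - (lam / 2) then p else 0)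
    + (if lam / 2 < B then p else 0) + (if B < - (lam / 2) then p else 0).
Proof.
move=> p0 AB; have ge0 (b : bool) : 0 <= if b then p else 0 by case: b => //; exact: ltW.
case: ifPn => h1; first by rewrite -!addrA lerDl !addr_ge0.
case: ifPn => h2; first by rewrite add0r -!addrA lerDl !addr_ge0.
case: ifPn => h3; first by rewrite !add0r lerDl.
case: ifPn => h4; first by rewrite !add0r.
exfalso; move: AB; rewrite ltNge => /negP; apply.
rewrite -!leNgt in h1 h2 h3 h4.
apply: (le_trans (ler_normB _ _)); rewrite [leRHS]splitr.
by apply: lerD; rewrite ler_norml ?h1 ?h2 ?h3 ?h4.
Qed.

(** Splitting [u] into its positive and negative parts and each transform by sign gives four
    families at level [lam / 2]. Each part of [u] occurs in two of them with constant 8, which makes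
    16. *)
Lemma htr_maximal u lam F : IL1 u ->
  0 < lam -> uniq F -> {in F, forall p, 0 < p.2} -> trivIset [set` F] (@ballp R) ->
  {in F, forall p, lam < `|htr u p.2 p.1|} ->
  \sum_(p <- F) p.2 <= 16 * normI u / lam.
Proof.
move=> ui lam0 uF F0 tF hF.
have l20 : 0 < lam / 2 by rewrite divr_gt0.
have uip : IL1 u^\+ by exact/integrable_funrpos/ui/measurable_Iab.
have uin : IL1 u^\- by exact/integrable_funrneg/ui/measurable_Iab.
have sub (P : pred (R * R)) : [/\ uniq ([seq p <- F | P p]),
    {in [seq p <- F | P p], forall p, 0 < p.2} & trivIset [set` [seq p <- F | P p]] (@ballp R)].
  split; first exact: filter_uniq.
    by move=> p; rewrite mem_filter => /andP[_ /F0].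
  by move=> p q /=; rewrite !mem_filter => /andP[_ ?] /andP[_ ?]; exact: tF.
have hE p : p \in F -> htr u p.2 p.1 = htr u^\+ p.2 p.1 - htr u^\- p.2 p.1.
  by move=> /F0 p0; rewrite -htrB//; congr htr; rewrite -[LHS](funrposBneg u).
pose P1 (p : R * R) := lam / 2 < htr u^\+ p.2 p.1.
pose P2 (p : R * R) := htr u^\+ p.2 p.1 < - (lam / 2).
pose P3 (p : R * R) := lam / 2 < htr u^\- p.2 p.1.
pose P4 (p : R * R) := htr u^\- p.2 p.1 < - (lam / 2).
have lam20 : 0 < lam / 2 by rewrite divr_gt0.
have up0 x : Iab x -> 0 <= u^\+ x by [].
have un0 x : Iab x -> 0 <= u^\- x by rewrite funrneg_ge0.
have [a1 b1 c1] := sub P1; have [a2 b2 c2] := sub P2.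
have [a3 b3 c3] := sub P3; have [a4 b4 c4] := sub P4.
have H1 : \sum_(p <- F | P1 p) p.2 <= 4 * (\int[leb R]_(x in Iab) u^\+ x) / (lam / 2).
  rewrite -big_filter; apply: (htr_maximal_ge0 uip up0 lam20 a1 b1 c1).
  by move=> p; rewrite mem_filter => /andP[].
have H2 : \sum_(p <- F | P2 p) p.2 <= 4 * (\int[leb R]_(x in Iab) u^\+ x) / (lam / 2).
  rewrite -big_filter; apply: (htr_maximal_ge0N uip up0 lam20 a2 b2 c2).
  by move=> p; rewrite mem_filter => /andP[].
have H3 : \sum_(p <- F | P3 p) p.2 <= 4 * (\int[leb R]_(x in Iab) u^\- x) / (lam / 2).
  rewrite -big_filter; apply: (htr_maximal_ge0 uin un0 lam20 a3 b3 c3).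
  by move=> p; rewrite mem_filter => /andP[].
have H4 : \sum_(p <- F | P4 p) p.2 <= 4 * (\int[leb R]_(x in Iab) u^\- x) / (lam / 2).
  rewrite -big_filter; apply: (htr_maximal_ge0N uin un0 lam20 a4 b4 c4).
  by move=> p; rewrite mem_filter => /andP[].
have uE : normI u = \int[leb R]_(x in Iab) u^\+ x + \int[leb R]_(x in Iab) u^\- x.
  rewrite -RintegralD//; last exact: measurable_Iab.
  by apply: eq_Rintegral => x _; rewrite -[RHS]/((u^\+ + u^\-) x) funrposDneg.
have : \sum_(p <- F) p.2 <= \sum_(p <- F | P1 p) p.2 + \sum_(p <- F | P2 p) p.2
    + \sum_(p <- F | P3 p) p.2 + \sum_(p <- F | P4 p) p.2.
  rewrite [X in X + _ + _ + _]big_mkcond [X in _ + X + _ + _]big_mkcond.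
  rewrite [X in _ + _ + X + _]big_mkcond [X in _ + _ + _ + X]big_mkcond.
  rewrite -!big_split/= big_seq [leRHS]big_seq; apply: ler_sum => p pF.
  have p0 := F0 p pF; have := hF p pF; rewrite hE// /P1 /P2 /P3 /P4.
  exact: le_sum_large_part.
move=> /le_trans; apply; apply: (le_trans (lerD (lerD (lerD H1 H2) H3) H4)).
rewrite uE le_eqVlt; apply/orP; left; apply/eqP; field.
by rewrite gt_eqF.
Qed.

(* Vitali covering: the balls [ball t e] with [lam < |htr u e t|] have a union of
   measure at most [3 * 2] times the bound for disjoint families. *)
Lemma htr_weak11 u lam : IL1 u -> 0 < lam -> exists U : set R,
  [/\ open U, forall t e, 0 < e -> lam < `|htr u e t| -> U t &
     (leb R U <= (96 * normI u / lam)%:E)%E].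
Proof.
move=> ui lam0.
pose S : set (R * R) := [set p | 0 < p.2 /\ lam < `|htr u p.2 p.1|].
(* The union of whole balls is open, so measurability of the maximal function itself is never an
   issue. *)
pose U := \bigcup_(p in S) ballp p.
have oU : open U by apply: bigcup_open => p _; exact: ball_open.
exists U; split => //.
  by move=> t e e0 h; exists (t, e) => //; exact: ballxx.
(* By inner regularity it suffices to bound compact subsets, which finitely many of the balls
   cover. *)
rewrite lebE lebesgue_regularity_inner_sup; last exact: open_measurable.
apply: ge_ereal_sup => _ [K [cK KU] <-].
have mK := compact_measurable cK; rewrite compact_cover in cK.
have oB p : S p -> open (ballp p) by move=> _; exact: ball_open.
have [D' D'S KD'] := cK _ S (@ballp R) oB KU.
(* The radius 1 is a default: the covering lemma wants nonempty balls for all indices, not only for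
   those in [S]. *)
pose B (p : R * R) := ball p.1 (if 0 < p.2 then p.2 else 1).
have BE p : S p -> B p = ballp p by move=> -[p0 _]; rewrite /B p0.
have B0 p : B p !=set0.
  by exists p.1; apply: ballxx; case: ifPn.
have [D [uD DD' tD cov]] := @vitali_lemma_finite_cover R _ B
  (fun p => is_ball_ball _ _) B0 (finmap.enum_fset D').
have K0 p : p \in D -> S p by move=> /DD' /D'S /set_mem.
have KB p : p \in finmap.enum_fset D' -> S p by move=> /D'S /set_mem.
have Kcov : K `<=` itv_union [seq (p.1 - 3 * p.2, p.1 + 3 * p.2) | p <- D].
  move=> x /KD' [p pD' px].
  have [|q qD] := cov x; first by exists p => //; rewrite BE//; exact: KB.
  rewrite /= /B (K0 q qD).1 scale_ballE// /ball/= => xq.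
  exists (q.1 - 3 * q.2, q.1 + 3 * q.2); first by apply/mapP; exists q.
  by rewrite /= in_itv/=; move: xq; rewrite ltr_norml; lra.
apply: (@le_trans _ _ (lebesgue_measure
    (itv_union [seq (p.1 - 3 * p.2, p.1 + 3 * p.2) | p <- D]))).
  apply: le_measure; [exact: mem_set| |exact: Kcov].
  by apply: mem_set; exact: measurable_itv_union.
apply: (le_trans (measure_itv_union _)).
  by move=> _ /mapP[p /K0[p0 _] ->]/=; lra.
rewrite lee_fin big_map/=.
have -> : \sum_(p <- D) (p.1 + 3 * p.2 - (p.1 - 3 * p.2)) = 6 * \sum_(p <- D) p.2.
  by rewrite mulr_sumr; apply: eq_bigr => p _; lra.
have -> : 96 * normI u / lam = 6 * (16 * normI u / lam) by lra.
rewrite ler_pM2l//; apply: htr_maximal => //.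
- by move=> p /K0[].
- move=> p q pD qD pq; apply: tD => //; rewrite !BE//; exact: K0.
- by move=> p /K0[].
Qed.
End MaximalInequality.

(** * Approximation and almost everywhere existence *)

Section BorelVersion.
Variable R : realType.
Implicit Types (u v w : R -> R).

(** The completed sigma-algebra differs from the Borel one by subsets of Borel null sets only. *)
Lemma caratheodory_borel (A : set R) : measurable (A : set (LT R)) ->
  exists BN : set R * set R, [/\ measurable (BN.1 : set (measurableTypeR R)),
    measurable (BN.2 : set (measurableTypeR R)), leb R BN.2 = 0,
    BN.1 `<=` A & A `\` BN.1 `<=` BN.2].
Proof.
move=> mA; have : (completed_algebra_gen (@lebesgue_measure R)).-sigma.-measurable A.
  by rewrite completed_caratheodory_measurable.
rewrite g_sigma_completed_algebra_genE => -[B mB [N' [N [mN N0 N'N]]] <-].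
by exists (B, N); split => // x /= [[Bx /(_ Bx)//|/N'N]].
Qed.

(** The sublevel sets of [u] at rational heights are Borel up to Borel null sets; off the countable
    union [N] of these null sets [u] is Borel, and it is set to 0 on [N] and outside (-1,1). This
    gives access to density and reflection arguments for Borel functions. *)
Lemma borel_version u : mfI u -> exists w,
  measurable_fun [set: measurableTypeR R] w /\ aeI (fun x => u x = w x).
Proof.
(* An enumeration of the rationals, with value 0 at numbers that code none. *)
move=> mu_; pose q (n : nat) : R := ratr (odflt 0 (choice.unpickle n : option rat)).
have mq n : measurable ((Iab `&` [set x | u x < q n]) : set (LT R)).
  have := mu_ (@measurable_Iab R) `]-oo, q n[%classic (measurable_itv _).
  by rewrite (_ : _ @^-1` _ = [set x | u x < q n])//; apply/seteqP; split=> x /=; rewrite in_itv.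
have /choice[BN hBN] : forall n, exists BN : set R * set R,
    [/\ measurable (BN.1 : set (measurableTypeR R)),
    measurable (BN.2 : set (measurableTypeR R)), leb R BN.2 = 0,
    BN.1 `<=` Iab `&` [set x | u x < q n] &
    (Iab `&` [set x | u x < q n]) `\` BN.1 `<=` BN.2].
  by move=> n; exact: caratheodory_borel (mq n).
pose N : set (measurableTypeR R) := \bigcup_n (BN n).2.
have mN : measurable N by apply: bigcupT_measurable => n; have [] := hBN n.
have mD : measurable (Iab `\` N : set (measurableTypeR R)).
  by apply: measurableD => //; exact: measurable_itv.
exists (u \_ (Iab `\` N)); split.
  apply/(measurable_restrictT _ mD).
  apply: (measurability (@RGenInftyO.G R)) => [|/= _ [_ [c ->] <-]].
    exact: RGenInftyO.measurableE.
  (* [u x < c] holds as soon as [u x < q n < c] for some rational, so the sublevel set is a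
     countable union of the Borel sets already chosen. *)
  rewrite (_ : _ `&` _ = (Iab `\` N) `&` \bigcup_(n in [set n | q n < c]) (BN n).1).
    apply: measurableI => //; apply: bigcup_measurable => n _.
    by have [] := hBN n.
  apply/seteqP; split => x /= [[Ix Nx]]; rewrite in_itv/=.
    move=> uc; split => //.
    have [r] := rat_in_itvoo uc; rewrite in_itv/= => /andP[ur rc].
    have qE : q (choice.pickle r) = ratr r by rewrite /q choice.pickleK.
    exists (choice.pickle r) => /=; first by rewrite qE.
    apply: contrapT => xB; apply: Nx; exists (choice.pickle r) => //.
    have [_ _ _ _ h] := hBN (choice.pickle r).
    by apply: h; split => //; split => //=; rewrite qE.
  move=> [n /= qc xB]; split => //.
  have [_ _ _ h _] := hBN n.
  by have [_ /= uq] := h _ xB; exact: lt_trans qc.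
have negN : (leb R).-negligible (N : set (LT R)).
  apply: negligible_bigcup => n; have [_ mN0 N0 _ _] := hBN n.
  exists (BN n).2; split => //; exact: borel_leb.
apply: negligibleS negN => x /= /not_implyP[Ix uw].
apply: contrapT => Nx; apply: uw; rewrite patchE ifT//.
by apply: mem_set.
Qed.

(** The identity is measurable from the completed to the Borel sigma-algebra and carries one measure
    to the other; change of variables along it moves integrals of Borel functions between them. *)
Lemma integral_pushforward_leb (D : set R) (f : measurableTypeR R -> \bar R) :
  (\int[pushforward (leb R) (idfun : LT R -> measurableTypeR R)]_(x in D) f x
    = \int[lebesgue_measure]_(x in D) f x)%E.
Proof.
by apply: eq_measure_integral => [|A mA AD]; first exact: measurable_id_leb.
Qed.

Lemma integral_leb_borel (D : set R) (w : R -> R) :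
  measurable (D : set (measurableTypeR R)) ->
  measurable_fun [set: measurableTypeR R] w -> (leb R).-integrable D (EFin \o w) ->
  lebesgue_measure.-integrable (D : set (measurableTypeR R)) (EFin \o w) /\
  \int[leb R]_(x in D) w x = \int[lebesgue_measure]_(x in (D : set (measurableTypeR R))) w x.
Proof.
move=> mD mw wi.
have mEw : measurable_fun [set: measurableTypeR R] (EFin \o w) by exact/measurable_EFinP.
have eqm := integral_pushforward_leb D.
split.
  have /integrableP[mf fy] := @integrable_pushforward _ _ _ _ _ _ (@measurable_id_leb R)
    (leb R) D _ mEw wi mD.
  by apply/integrableP; split => //; rewrite -eqm.
congr fine; rewrite -eqm.
by rewrite (@integral_pushforward _ _ _ _ _ _ (@measurable_id_leb R) (leb R) D _ mEw wi mD).
Qed.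

Lemma ge0_integral_leb_borel (D : set R) (w : R -> \bar R) :
  measurable (D : set (measurableTypeR R)) ->
  measurable_fun [set: measurableTypeR R] w -> (forall x, 0 <= w x)%E ->
  (\int[leb R]_(x in D) w x = \int[lebesgue_measure]_(x in (D : set (measurableTypeR R))) w x)%E.
Proof.
move=> mD mw w0.
have eqm := integral_pushforward_leb D.
rewrite -eqm (@ge0_integral_pushforward _ _ _ _ _ _ (@measurable_id_leb R))//.
exact: measurable_funTS.
Qed.

End BorelVersion.

(** * Principal values at points of local constancy *)

Section Existence.
Variable R : realType.
Implicit Types (u v w : R -> R) (e t lam : R) (n : nat).

Lemma hkerN e (s : R) : hker e (- s) = - hker e s.
Proof. by rewrite /hker normrN; case: ifPn => _; rewrite ?oppr0// invrN. Qed.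

(** [k] is odd about [t / 2], and the reflection [x -> t - x] preserves Lebesgue measure because it
    preserves the length of intervals. *)
Lemma integral_odd0 (k : R -> R) (t : R) :
  lebesgue_measure.-integrable [set: measurableTypeR R] (EFin \o k) ->
  measurable_fun [set: measurableTypeR R] k ->
  (forall x, k (t - x) = - k x) -> \int[lebesgue_measure]_x k x = 0.
Proof.
move=> ki mk kt.
have mr : measurable_fun [set: measurableTypeR R] ((fun x => t - x) : R -> measurableTypeR R).
  exact: measurable_funB.
have mEk : measurable_fun [set: measurableTypeR R] (EFin \o k) by exact/measurable_EFinP.
have E : (\int[pushforward (@lebesgue_measure R) ((fun x => t - x)%R : R -> measurableTypeR R)]_x (k x)%:E
    = \int[lebesgue_measure]_x (k x)%:E)%E.
  apply: eq_measure_integral => A mA _ /=.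
  apply/esym.
  rewrite (@lebesgue_measure_unique _ (pushforward (@lebesgue_measure R) ((fun x => t - x)%R : R -> measurableTypeR R))) //.
  move=> _ [[a b]] _ <-/=; rewrite /pushforward.
  rewrite (_ : _ @^-1` _ = `[t - b, t - a[%classic).
    rewrite !lebesgue_measure_itv/= !lte_fin ltrD2l ltrN2.
    by case: ifPn => // _; rewrite -!EFinB; congr EFin; lra.
  by apply/seteqP; split => x /=; rewrite !in_itv/= => /andP[? ?]; apply/andP; split; lra.
have ki' : lebesgue_measure.-integrable
    (((fun x => t - x)%R : measurableTypeR R -> measurableTypeR R) @^-1` [set: measurableTypeR R])
    ((EFin \o k) \o (fun x => t - x)%R).
  rewrite preimage_setT; have := integrableN ki; apply: eq_integrable => // x _ /=.
  by rewrite kt EFinN.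
have := @integral_pushforward _ _ _ _ _ _ mr lebesgue_measure setT _ mEk ki' measurableT.
rewrite E preimage_setT => /(congr1 fine).
rewrite -[LHS]/(\int[lebesgue_measure]_x k x) -[RHS]/(\int[lebesgue_measure]_x k (t - x)%R).
under [X in _ = X -> _]eq_Rintegral do rewrite kt.
rewrite RintegralN//; lra.
Qed.

Lemma IL1_bounded u (M : R) : mfI u -> (forall x, Iab x -> `|u x| <= M) -> IL1 u.
Proof.
move=> mu_ uM; apply: measurable_bounded_integrable => //.
- exact: measurable_Iab.
- by apply: (@le_lt_trans _ _ 2%:E); [rewrite -(leb_Iab R)|rewrite ltry].
- exists M; split; first exact: num_real.
  by move=> N MN x Ix; apply: le_trans (uM x Ix) _; exact: ltW.
Qed.

Lemma IL1_cst (c : R) : IL1 (fun=> c).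
Proof. by apply: (@IL1_bounded _ `|c|) => //; exact: measurable_cst. Qed.

(** The difference of the two kernels is odd about [t] and lives on [e < |x - t| <= e']; the bound
    on [e'] keeps this annulus inside (-1,1). *)
Lemma integral_hker_annulus e e' t : 0 < e -> e < e' -> e' < 1 - `|t| ->
  \int[leb R]_(x in Iab) (hker e (x - t) - hker e' (x - t)) = 0.
Proof.
move=> e0 ee' e'1; have e'0 := lt_trans e0 ee'.
pose k (x : R) : R := hker e (x - t) - hker e' (x - t).
have mk : measurable_fun [set: measurableTypeR R] k.
  by apply: measurable_funB; apply: (measurableT_comp (@measurable_hker R _));
    exact: measurable_funB.
have ki : IL1 k.
  have hi e1 : 0 < e1 -> IL1 (fun x => hker e1 (x - t)).
    move=> /(htr_integrable t (IL1_cst 1)); congr (is_true (_.-integrable _ _)).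
    by apply/funext => x /=; rewrite mul1r.
  by apply: IL1_B; exact: hi.
have mI : measurable (Iab : set (measurableTypeR R)) by exact: measurable_itv.
have [ki' E] := integral_leb_borel mI mk ki.
(* Since [k] vanishes off (-1,1), the integral may be taken over the whole line, on which the
   reflection acts. *)
have kI : k \_ Iab = k.
  apply/funext => x; rewrite patchE; case: ifPn => // /negP xI.
  have : e' < `|x - t|.
    rewrite ltNge; apply/negP => xt; apply: xI; apply: mem_set; rewrite /Iab/= in_itv/=.
    rewrite -ltr_norml -(subrK t x) (le_lt_trans (ler_normD _ _))//; lra.
  move=> xt; rewrite /k /hker xt (lt_trans ee' xt) subrr//.
rewrite E Rintegral_mkcond kI; apply: (@integral_odd0 k (t + t)) => //.
  have := (@integrable_mkcond _ (measurableTypeR R) R lebesgue_measure _ (EFin \o k) mI).1 ki'.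
  by rewrite restrict_EFin kI.
move=> x; rewrite /k (_ : t + t - x - t = - (x - t)); last by lra.
by rewrite !hkerN; lra.
Qed.

(** Changing the truncation adds [v t] times the integral of the kernel over an annulus, which
    vanishes. So the principal value exists at [t], the truncations being eventually constant. *)
Lemma htr_locally_constant v t d e e' : IL1 v ->
  (forall x, `|x - t| < d -> v x = v t) -> d <= 1 - `|t| ->
  0 < e -> e < d -> 0 < e' -> e' < d -> htr v e t = htr v e' t.
Proof.
move=> vi vt d1; wlog ee' : e e' / e <= e'.
  move=> h e0 ed e'0 e'd; have [/h->//|/ltW/h h'] := leP e e'.
  by apply/esym; exact: h'.
move=> e0 ed e'0 e'd; have [<-//|ne] := eqVneq e e'.
have {ne ee'}ee' : e < e' by rewrite lt_neqAle ne.
apply/eqP; rewrite -subr_eq0; apply/eqP.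
have mI := @measurable_Iab R.
rewrite /htr -RintegralB//; [|exact: htr_integrable..].
have k0 := integral_hker_annulus e0 ee' (lt_le_trans e'd d1).
rewrite -[RHS](mulr0 (v t)) -k0 -RintegralZl//; last first.
  have hi e1 : 0 < e1 -> IL1 (fun x => hker e1 (x - t)).
    move=> /(htr_integrable t (IL1_cst 1)); congr (is_true (_.-integrable _ _)).
    by apply/funext => x /=; rewrite mul1r.
  by apply: IL1_B; exact: hi.
apply: eq_Rintegral => x _; rewrite -mulrBr.
have [xt|tx] := ltP e' `|x - t|; last by rewrite vt// (le_lt_trans tx).
by rewrite /hker xt (lt_trans ee' xt) subrr !mulr0.
Qed.

End Existence.

(** * Density of step functions in L^1 *)

Section Density.
Variable R : realType.
Implicit Types (u v w : R -> R) (e t lam : R) (n : nat).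

Lemma normI_ge0 u : 0 <= normI u.
Proof. by apply: Rintegral_ge0. Qed.

Lemma le_normI u v : IL1 u -> IL1 v -> (forall x, Iab x -> `|u x| <= `|v x|) ->
  normI u <= normI v.
Proof.
move=> ui vi uv; apply: le_Rintegral => //; first exact: measurable_Iab.
- exact: IL1_abs.
- exact: IL1_abs.
Qed.

Lemma normI_triangle u v w : IL1 u -> IL1 v -> IL1 w ->
  normI (fun x => u x - w x) <= normI (fun x => u x - v x) + normI (fun x => v x - w x).
Proof.
move=> ui vi wi; rewrite /normI -RintegralD; last 3 first.
- exact: measurable_Iab.
- by apply: IL1_abs; exact: IL1_B.
- by apply: IL1_abs; exact: IL1_B.
apply: le_Rintegral.
- exact: measurable_Iab.
- by apply: IL1_abs; exact: IL1_B.
- by apply: IL1_D; apply: IL1_abs; exact: IL1_B.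
by move=> x _; rewrite -[u x - w x](subrKA (v x)) ler_normD.
Qed.

Lemma mfI_norm u : mfI u -> mfI (fun x => `|u x|).
Proof. by move=> mu_; apply: measurableT_comp mu_. Qed.

Lemma mfI_B u v : mfI u -> mfI v -> mfI (fun x => u x - v x).
Proof. exact: measurable_funB. Qed.

Lemma mfI_D u v : mfI u -> mfI v -> mfI (fun x => u x + v x).
Proof. exact: measurable_funD. Qed.

Lemma IL1_ae_eq u v : mfI v -> aeI (fun x => u x = v x) -> IL1 u -> IL1 v.
Proof. by apply: RI_ae_eq; exact: measurable_Iab. Qed.

Lemma Rintegral_aeI u v : mfI u -> mfI v -> aeI (fun x => u x = v x) ->
  \int[leb R]_(x in Iab) u x = \int[leb R]_(x in Iab) v x.
Proof. by apply: Rintegral_ae_eq; exact: measurable_Iab. Qed.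

Lemma continuous_dense u (eta : R) : IL1 u -> 0 < eta ->
  exists g, [/\ continuous g, IL1 g & normI (fun x => u x - g x) < eta].
Proof.
move=> ui eta0; have mI : measurable (Iab : set (measurableTypeR R)) by exact: measurable_itv.
have [w [mw uw]] := borel_version (IL1_mfI ui).
have wi : IL1 w by apply: IL1_ae_eq uw ui; exact: mfI_borel.
have [wi' _] := integral_leb_borel mI mw wi.
have muI : (@lebesgue_measure R Iab < +oo)%E.
  by apply: (@le_lt_trans _ _ 2%:E); [rewrite -(leb_Iab R)|rewrite ltry].
have [g_ [cg gi gcvg]] := approximation_continuous_integrable mI muI wi'.
have [n] : exists n, (\int[lebesgue_measure]_(z in Iab) `|(w z - g_ n z)%:E| < eta%:E)%E.
  move/fine_cvgP : gcvg => [fin cv].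
  suff : \forall n \near \oo,
    (\int[lebesgue_measure]_(z in Iab) `|(w z - g_ n z)%:E| < eta%:E)%E by exact: filter_ex.
  near=> n; rewrite -[X in (X < _)%E]fineK; last by near: n.
  by rewrite lte_fin; near: n; apply: (cvgr_lt _ cv).
move=> h; have mg : measurable_fun [set: measurableTypeR R] (g_ n).
  exact: continuous_measurable_fun.
have mwg : measurable_fun [set: measurableTypeR R] (fun z => `|(w z - g_ n z)%:E|%E).
  apply: measurableT_comp => //; apply/measurable_EFinP.
  exact: measurable_funB.
have wgE := ge0_integral_leb_borel mI mwg (fun z => abse_ge0 _).
have gI : IL1 (g_ n).
  apply/integrableP; split; first by apply/measurable_EFinP; exact: mfI_borel.
  have /integrableP[_] := gi n.
  rewrite -(@ge0_integral_leb_borel _ _ (fun z => `|(g_ n z)%:E|%E))//.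
  by apply: measurableT_comp => //; apply/measurable_EFinP.
exists (g_ n); split => //.
rewrite -lte_fin; apply: le_lt_trans h.
rewrite -wgE /normI /Rintegral fineK.
  rewrite le_eqVlt; apply/orP; left; apply/eqP.
  apply: ae_eq_integral; first exact: measurable_Iab.
  - apply/measurable_EFinP; apply: mfI_norm; apply: mfI_B; first exact: IL1_mfI.
    exact: mfI_borel.
  - exact: measurable_borel_leb.
  - by apply: aeI_S uw => x _ ->.
apply: integrable_fin_num; first exact: measurable_Iab.
by apply: IL1_abs; exact: IL1_B.
Unshelve. all: by end_near. Qed.

Lemma grid_pt_locally_constant n t : (~ exists k : int, t = k%:~R / n.+1%:R) ->
  exists2 d, 0 < d & forall x, `|x - t| < d -> grid_pt n x = grid_pt n t.
Proof.
move=> tk; have /andP[h1 h2] := grid_pt_itv n t.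
have {}h1 : grid_pt n t < t.
  rewrite lt_neqAle h1 andbT; apply/eqP => h; apply: tk.
  by exists (Num.floor (n.+1%:R * t)).
exists (Num.min (t - grid_pt n t) (grid_pt n t + n.+1%:R^-1 - t)).
  by rewrite lt_min !subr_gt0 h1.
move=> x; rewrite lt_min !ltr_norml => /andP[/andP[a1 a2] /andP[a3 a4]].
rewrite {1}/grid_pt /grid_pt; congr (_%:~R / _); apply: floor_def.
have n0 : (0 : R) < n.+1%:R by [].
have b1 : grid_pt n t <= x by rewrite -(lerD2r (- t)) ltW//; move: a1; rewrite opprB.
have b2 : x < grid_pt n t + n.+1%:R^-1 by rewrite -(ltrD2r (- t)).
move: b1 b2; rewrite /grid_pt -[X in _ < _ + X]mul1r -mulrDl ler_pdivrMr// ltr_pdivlMr//.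
by rewrite (mulrC x) intrD => -> ->.
Qed.

(** Continuous functions are not enough, since a continuous function may lack principal values at
    some points. Rounding the argument of a continuous approximation makes it locally constant off a
    countable set, as [htr_locally_constant] requires. *)
Lemma step_dense u (eta : R) : IL1 u -> 0 < eta ->
  exists v, [/\ IL1 v, normI (fun x => u x - v x) < eta &
    exists2 C : set R, countable C & forall t, ~ C t ->
      exists2 d, 0 < d & forall x, `|x - t| < d -> v x = v t].
Proof.
move=> ui eta0.
have [g [cg gi ug]] := continuous_dense ui (divr_gt0 eta0 (ltr0Sn R 1)).
(* The closed interval is needed because the rounded argument can be -1. *)
have [M hM] : exists M, forall x : R, x \in `[-1, 1] -> `|g x| <= M.
  have /compact_bounded[M [_ hM]] : compact (g @` `[-1, 1]%classic).
    apply: continuous_compact; last exact: segment_compact.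
    exact: continuous_subspaceT.
  exists (M + 1) => x x1; apply: hM; first by rewrite ltrDl.
  by exists x.
have mg n : measurable_fun [set: measurableTypeR R] (g \o grid_pt n).
  apply: (measurableT_comp (continuous_measurable_fun cg)).
  exact: measurable_grid_pt.
have gridI n (x : R) : Iab x -> grid_pt n x \in `[-1, 1].
  move=> Ix; have := mem_grid n Ix => /mapP[k]; rewrite mem_iota add0n => /= kn ->.
  have n0 : (0 : R) < n.+1%:R by [].
  rewrite in_itv/= ler_pdivlMr// ler_pdivrMr// mulN1r mul1r lerBlDr -natrD addnn ler_nat.
  by rewrite (ltnW kn) andbT lerBrDr addNr.
have vi n : IL1 (g \o grid_pt n).
  apply: (@IL1_bounded _ _ M); first by apply: mfI_borel; exact: mg.
  by move=> x /(gridI n) /hM.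
have [_ cv] : IL1 (fun=> 0 : R) /\ normI (fun x => g x - (g \o grid_pt n) x) @[n --> \oo]
   --> \int[leb R]_(x in Iab) (0 : R).
  apply: (@IL1_dominated _ _ _ (fun=> M + M)).
  - by move=> n; apply: mfI_norm; apply: mfI_B; [exact: IL1_mfI|exact: IL1_mfI].
  - exact: measurable_cst.
  - apply: aeI_W => x Ix; rewrite -[X in _ --> X](normr0 R) -(subrr (g x)).
    apply: cvg_norm; apply: cvgB; first exact: cvg_cst.
    exact: (cvg_comp _ _ (@cvg_grid_pt R x) (cg x)).
  - exact: IL1_cst.
  - apply: aeI_W => x Ix n; rewrite normr_id (le_trans (ler_normB _ _))// lerD//.
      by apply: hM; apply: subset_itv_oo_cc.
    by apply: hM; exact: gridI.
rewrite Rintegral_cst ?mul0r in cv; last exact: measurable_Iab.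
have e20 : 0 < eta / 2 by rewrite divr_gt0.
have /filter_ex[n hn] : \forall n \near \oo,
    normI (fun x => g x - (g \o grid_pt n) x) < eta / 2 by exact: (cvgr_lt _ cv).
exists (g \o grid_pt n); split => //.
  apply: (le_lt_trans (normI_triangle ui gi (vi n))).
  by rewrite [ltRHS]splitr ltrD.
exists [set (k%:~R / n.+1%:R : R) | k in [set: int]].
  exact: (sub_countable (card_image_le _ _) (countableP _)).
move=> t Ct; have [|d d0 hd] := @grid_pt_locally_constant n t.
  by move=> [k tk]; apply: Ct; exists k.
by exists d => // x /hd /= ->.
Qed.

End Density.

(** * Almost everywhere existence of the principal value *)

Section PrincipalValue.
Variable R : realType.
Implicit Types (u v w : R -> R) (e t lam : R) (n : nat).

Lemma negligible_leb_small (A : set R) :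
  (forall e : R, 0 < e -> exists U : set R,
    [/\ measurable (U : set (LT R)), A `<=` U & (leb R U <= e%:E)%E]) ->
  (leb R).-negligible (A : set (LT R)).
Proof.
move=> h; have /choice[U hU] : forall n : nat, exists U : set R,
    [/\ measurable (U : set (LT R)), A `<=` U & (leb R U <= (n.+1%:R^-1 : R)%:E)%E].
  by move=> n; apply: h; rewrite invr_gt0.
exists (\bigcap_n U n); split.
- by apply: bigcapT_measurable => n; have [] := hU n.
- apply/eqP; rewrite eq_le measure_ge0 andbT; apply/lee_addgt0Pr => e e0.
  rewrite add0e; have [n ne] : exists n : nat, (n.+1%:R^-1 : R) < e.
    by have /filter_ex[n] := near_infty_natSinv_lt (PosNum e0); exists n.
  have [mU _ Un] := hU n; apply: le_trans (_ : leb R (U n) <= _)%E.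
    apply: le_outer_measure; exact: bigcap_inf.
  by apply: (le_trans Un); rewrite lee_fin ltW.
- by move=> x Ax n _; have [_ h' _] := hU n; exact: h'.
Qed.

(** Approximate [u] by step functions [v n] within [2^-n]. By the weak type bound all truncated
    transforms of [u - v n] at [t] are at most [1 / (j + 1)] unless [t] lies in a set [U (n, j)] of
    measure at most [96 (j + 1) / 2^n]. Those of [v n] are constant for small [e], so the
    truncations of [u] at [t] are Cauchy as soon as each [j] has some good [n]. *)
Lemma htr_cvg u : IL1 u -> aeI (fun t => cvg (htr u e t @[e --> 0^'+])).
Proof.
move=> ui.
have /choice[v hv] : forall n : nat, exists v, [/\ IL1 v, normI (fun x => u x - v x) < 2^-1 ^+ n &
    exists2 C : set R, countable C & forall t, ~ C t ->
      exists2 d, 0 < d & forall x, `|x - t| < d -> v x = v t].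
  by move=> n; apply: step_dense => //; rewrite exprn_gt0.
have /choice[C hC] : forall n, exists C : set R, countable C /\ forall t, ~ C t ->
      exists2 d, 0 < d & forall x, `|x - t| < d -> v n x = v n t.
  by move=> n; have [_ _ [C ? ?]] := hv n; exists C.
have vi n : IL1 (v n) by have [] := hv n.
have uvi n : IL1 (fun x => u x - v n x) by exact: IL1_B.
have /choice[U hU] : forall nj : nat * nat, exists U : set R,
  [/\ open U, forall t e, 0 < e -> nj.2.+1%:R^-1 < `|htr (fun x => u x - v nj.1 x) e t| -> U t &
     (leb R U <= (96 * normI (fun x => u x - v nj.1 x) / nj.2.+1%:R^-1)%:E)%E].
  by move=> [n j]; apply: htr_weak11 => //; rewrite invr_gt0.
have aeC : aeI (fun t => forall n, ~ C n t).
  by apply: aeI_forall => n; apply: aeI_not_countable; have [] := hC n.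
(* For fixed [j] a point is lost only if it is exceptional for every [n], and the measures of the
   exceptional sets tend to 0. *)
have aeU : aeI (fun t => forall j, ~ (\bigcap_n U (n, j)) t).
  apply: aeI_forall => j.
  have : (leb R).-negligible (\bigcap_n U (n, j) : set (LT R)).
    apply: negligible_leb_small => e e0.
    have [n hn] : exists n, 96 * 2^-1 ^+ n * j.+1%:R < e.
      have : (96 * j.+1%:R) * 2^-1 ^+ n @[n --> \oo] --> (96 * j.+1%:R) * (0 : R).
        by apply: cvgMr; apply: cvg_expr; rewrite ger0_norm ?invf_lt1 ?ltr1n.
      rewrite mulr0 => /(cvgr_lt _)/(_ _ e0)/filter_ex[n hn].
      by exists n; rewrite mulrAC.
    exists (U (n, j)); have [oU _ mU] := hU (n, j); split.
    - by apply: borel_leb; exact: open_measurable.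
    - exact: bigcap_inf.
    - apply: (le_trans mU); rewrite lee_fin invrK (le_trans _ (ltW hn))//.
      by rewrite ler_pM2r// ler_pM2l//; have [_ /ltW] := hv n.
  by apply: negligibleS => x /= /not_implyP[_ /contrapT].
apply: aeI_S (aeI_and aeC aeU) => t It [Ct Ut].
apply/cauchy_cvgP; apply: cauchy_exP => eps eps0.
have [j je] : exists j : nat, (j.+1%:R^-1 : R) < eps.
  by have /filter_ex[j] := near_infty_natSinv_lt (PosNum eps0); exists j.
have [n nU] : exists n, ~ U (n, j) t.
  by apply/existsNP => h; apply: (Ut j) => n _; exact: h.
have [_ /(_ t (Ct n))[d d0 vd]] := hC n.
(* Below [r] the function [v n] is constant around [t] and the annuli stay inside (-1,1). *)
pose r := Num.min d (1 - `|t|).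
have r0 : 0 < r.
  rewrite lt_min d0/= subr_gt0 ltr_norml.
  by move: It; rewrite /Iab/= in_itv.
have rd x : `|x - t| < r -> v n x = v n t.
  by rewrite lt_min => /andP[/vd].
have r1 : r <= 1 - `|t| by rewrite ge_min lexx orbT.
exists (htr (v n) (r / 2) t).
have r20 : 0 < r / 2 by rewrite divr_gt0.
have r2r : r / 2 < r by rewrite ltr_pdivrMr// ltr_pMr// ltr1n.
suff : \forall e \near 0^'+, ball (htr (v n) (r / 2) t) eps (htr u e t) by [].
near=> e.
have e0 : 0 < e by near: e; exact: nbhs_right_gt.
have er : e < r by near: e; exact: nbhs_right_lt.
rewrite /ball/= (htr_locally_constant (vi n) rd r1 r20 r2r e0 er).
rewrite distrC -htrB// (le_lt_trans _ je)// leNgt; apply/negP => h.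
by apply: nU; have [_ + _] := hU (n, j); apply; [exact: e0|exact: h].
Unshelve. all: by end_near. Qed.

End PrincipalValue.

(** * Bounded functions and Parseval's formula *)

Section Duality.
Variable R : realType.
Implicit Types (u v w g phi : R -> R) (e t lam : R) (n : nat).

Lemma IL1_eq u v : (forall x, Iab x -> u x = v x) -> IL1 u -> IL1 v.
Proof.
move=> uv; apply: eq_integrable; first exact: measurable_Iab.
by move=> x /set_mem Ix; rewrite /= uv.
Qed.

(** The integrand for Fubini's theorem: [z.1] is the point [t] of the transform and [z.2] the
    variable of integration. Both functions are extended by 0 to the whole line. *)
Definition htr_kernel u v e (z : LT R * LT R) : \bar R :=
  ((v \_ Iab) z.1 * (u \_ Iab) z.2 * hker e (z.2 - z.1))%:E.

Lemma mfI_restrict u : mfI u -> measurable_fun [set: LT R] (u \_ Iab).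
Proof. by move=> mu_; apply/(measurable_restrictT _ (@measurable_Iab R)). Qed.

Lemma measurable_htr_kernel u v e : mfI u -> mfI v ->
  measurable_fun [set: LT R * LT R] (htr_kernel u v e).
Proof.
move=> mu_ mv; apply/measurable_EFinP; apply: measurable_funM; first apply: measurable_funM.
- exact: (measurableT_comp (mfI_restrict mv) measurable_fst).
- exact: (measurableT_comp (mfI_restrict mu_) measurable_snd).
- have mid : measurable_fun [set: LT R] (idfun : LT R -> R) by exact: measurable_id_leb.
  apply: (measurableT_comp (@measurable_hker R e)).
  apply: (@measurable_funB _ _ _ setT (fun z : LT R * LT R => idfun z.2 : R) (fun z => idfun z.1 : R)).
    exact: (measurableT_comp mid measurable_snd).
  exact: (measurableT_comp mid measurable_fst).
Qed.

Lemma htr_kernel_restrict u v e t : 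
  (fun x => htr_kernel u v e (t, x)) =
  EFin \o ((fun x => (v \_ Iab) t * (u x * hker e (x - t))) \_ Iab).
Proof.
apply/funext => x; rewrite /htr_kernel/= !(patchE _ _ x); case: ifPn => _ //.
  by rewrite mulrA.
by rewrite mulr0 mul0r.
Qed.

Lemma integral_EFin_Iab u : IL1 u ->
  (\int[leb R]_x (EFin \o (u \_ Iab)) x = (\int[leb R]_(x in Iab) u x)%:E)%E.
Proof.
move=> ui; rewrite /Rintegral fineK; last first.
  by apply: integrable_fin_num => //; exact: measurable_Iab.
by rewrite [RHS]integral_mkcond restrict_EFin.
Qed.

Lemma htr_kernel_int1 u v e t : IL1 u -> 0 < e ->
  (\int[leb R]_x htr_kernel u v e (t, x) = ((v \_ Iab) t * htr u e t)%:E)%E.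
Proof.
move=> ui e0; rewrite (htr_kernel_restrict u v e t) integral_EFin_Iab; last first.
  by apply: IL1_Zl; exact: htr_integrable.
by rewrite RintegralZl//; [exact: measurable_Iab|exact: htr_integrable].
Qed.

(** Oddness of the kernel, the origin of the minus sign in Parseval's formula. *)
Lemma htr_kernel_swap u v e t x : htr_kernel u v e (t, x) = (- htr_kernel v u e (x, t))%E.
Proof.
rewrite /htr_kernel/=; congr EFin; rewrite -[X in hker e X]opprB hkerN mulrN.
by rewrite (mulrC ((v \_ _) t)).
Qed.

Lemma htr_kernel_int2 u v e x : IL1 v -> 0 < e ->
  (\int[leb R]_t htr_kernel u v e (t, x) = ((u \_ Iab) x * - htr v e x)%:E)%E.
Proof.
move=> vi e0; under eq_integral do rewrite htr_kernel_swap.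
have -> : (\int[leb R]_t - htr_kernel v u e (x, t) = \int[leb R]_t htr_kernel (fun x => - v x)%R u e (x, t))%E.
  apply: eq_integral => t _; rewrite /htr_kernel /= !patchE; congr EFin.
  by do 2 (case: ifPn => _ //=); rewrite ?(mulr0, mul0r, mulrN, mulNr, oppr0).
by rewrite htr_kernel_int1 ?htrN//; exact: IL1_N.
Qed.

Lemma htr_le u e t : IL1 u -> 0 < e -> `|htr u e t| <= e^-1 * normI u.
Proof.
move=> ui e0; rewrite /normI -RintegralZl//; last 2 first.
- exact: measurable_Iab.
- exact: IL1_abs.
apply: Rintegral_norm_le.
- exact: measurable_Iab.
- by apply: IL1_mfI; exact: htr_integrable.
- by apply: IL1_Zl; exact: IL1_abs.
- by move=> x _; rewrite normrM mulrC ler_wpM2r// hker_le.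
Qed.

Lemma integrable_htr_kernel u v e : IL1 u -> IL1 v -> 0 < e ->
  (leb R \x leb R)%E.-integrable setT (htr_kernel u v e).
Proof.
move=> ui vi e0; have mk := measurable_htr_kernel e (IL1_mfI ui) (IL1_mfI vi).
apply: (@integrable12ltyP _ _ _ _ R (leb R) (leb R) _ mk).2.
have mk2 : measurable_fun [set: LT R * LT R] (abse \o htr_kernel u v e).
  exact: measurableT_comp mk.
have K0 : 0 <= e^-1 * normI u by rewrite mulr_ge0 ?normI_ge0// invr_ge0 ltW.
have vi' : IL1 (fun t => (e^-1 * normI u) * `|v t|) by apply: IL1_Zl; exact: IL1_abs.
have J : (\int[leb R]_x (EFin \o ((fun t => (e^-1 * normI u) * `|v t|)%R \_ Iab)) x < +oo)%E.
  by rewrite integral_EFin_Iab; [rewrite ltry|exact: vi'].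
apply: le_lt_trans J.
  apply: ge0_le_integral.
  - exact: measurableT.
  - by move=> t _; exact: integral_ge0.
  - exact: (measurable_fun_fubini_tonelli_F _ mk2 (fun=> abse_ge0 _)).
  - by apply/measurable_EFinP; apply: mfI_restrict; exact: IL1_mfI.
  - move=> t _.
    have -> : (\int[leb R]_y `|htr_kernel u v e (t, y)| = \int[leb R]_x (EFin \o
        ((fun x => `|(v \_ Iab) t| * `|u x * hker e (x - t)|)%R \_ Iab)) x)%E.
      apply: eq_integral => x _; rewrite /= /patch; case: (x \in Iab) => /=.
        by rewrite !normrM mulrA.
      by rewrite mulr0 mul0r normr0.
    rewrite integral_EFin_Iab; last by apply: IL1_Zl; apply: IL1_abs; exact: htr_integrable.
    rewrite RintegralZl//; last 2 first.
    - exact: measurable_Iab.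
    - by apply: IL1_abs; exact: htr_integrable.
    rewrite lee_fin /= /patch; case: ifPn => tI; last by rewrite normr0 mul0r.
    rewrite mulrC ler_wpM2r// /normI -RintegralZl//; last 2 first.
    - exact: measurable_Iab.
    - exact: IL1_abs.
    apply: le_Rintegral.
    - exact: measurable_Iab.
    - by apply: IL1_abs; exact: htr_integrable.
    - by apply: IL1_Zl; exact: IL1_abs.
    - by move=> x _; rewrite normrM mulrC ler_wpM2r// hker_le.
Qed.

(** The transform is a partial integral of the kernel for [v = 1], so Fubini's theorem provides its
    measurability. *)
Lemma mfI_htr u e : IL1 u -> 0 < e -> mfI (htr u e).
Proof.
move=> ui e0.
have mF := measurable_fubini_F (integrable_htr_kernel ui (IL1_cst 1) e0).
suff : mfI (fun t => ((fun=> 1 : R) \_ Iab) t * htr u e t).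
  apply: eq_measurable_fun => t tI; rewrite patchE ifT ?mul1r//.
apply: measurable_funTS; apply/measurable_EFinP; move: mF.
by apply: eq_measurable_fun => t _; rewrite /= -htr_kernel_int1.
Qed.

Lemma IL1_htr u e : IL1 u -> 0 < e -> IL1 (htr u e).
Proof.
move=> ui e0; apply: (@IL1_bounded _ _ (e^-1 * normI u)); first exact: mfI_htr.
by move=> t _; exact: htr_le.
Qed.

Lemma htr_antisym u v e : IL1 u -> IL1 v -> 0 < e ->
  \int[leb R]_(t in Iab) (v t * htr u e t) = - \int[leb R]_(x in Iab) (u x * htr v e x).
Proof.
move=> ui vi e0.
have vh w w' : IL1 w -> IL1 w' -> IL1 (fun t => w' t * htr w e t).
  move=> wi wi'; apply: (@IL1_mul_bounded _ _ _ (e^-1 * normI w)) => //; first exact: mfI_htr.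
  by move=> t _; exact: htr_le.
have := Fubini (integrable_htr_kernel ui vi e0).
under [X in (X = _)%E -> _]eq_integral do rewrite htr_kernel_int1//.
under [X in (_ = X)%E -> _]eq_integral do rewrite htr_kernel_int2//.
have E w w' : (fun x => ((w \_ Iab) x * w' x)%:E) = EFin \o ((fun x => w x * w' x) \_ Iab).
  by apply/funext => x; rewrite /= !patchE; case: ifPn => // _; rewrite mul0r.
rewrite !E !integral_EFin_Iab//; last exact: vh.
  rewrite -RintegralN; last exact: vh.
  by move=> [->]; apply: eq_Rintegral => x _; rewrite mulrN.
  exact: measurable_Iab.
have := IL1_N (vh _ _ vi ui).
by apply: IL1_eq => x _; rewrite mulrN.
Qed.

End Duality.

Section MeasurableToolkit.
Context d (X : measurableType d) (R : realType) (D : set X).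

Lemma measurable_limn_einf (f : nat -> X -> \bar R) :
  (forall n, measurable_fun D (f n)) ->
  measurable_fun D (fun x => limn_einf (fun n => f n x)).
Proof.
move=> mf; rewrite (_ : (fun x => _) = (fun x => - limn_esup (fun n => - f n x))%E).
  apply: measurableT_comp => //; apply: measurable_fun_limn_esup => n.
  exact: measurableT_comp.
by apply/funext => x; rewrite limn_esupN oppeK.
Qed.

Lemma measurable_tail (f : X -> R) (M : R) : measurable D -> measurable_fun D f ->
  measurable_fun D (fun x => if M < `|f x| then `|f x| else 0).
Proof.
move=> mD mf; have mnf : measurable_fun D (fun x => `|f x|) by exact: measurableT_comp.
apply: measurable_fun_if => //; first by apply: measurable_fun_ltr.
by apply: (measurable_funS mD) mnf; exact: subIsetl.
Qed.

End MeasurableToolkit.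

(** * Fatou's lemma and Vitali's convergence theorem *)

Section Fatou.
Variable R : realType.
Implicit Types (u v w g phi : R -> R) (e t lam : R) (n : nat).

(** Completeness of the measure: the exceptional set and all its subsets are measurable. *)
Lemma mfI_ae u v : mfI u -> aeI (fun x => u x = v x) -> mfI v.
Proof.
move=> mu_ uv mI B mB; have mA := mu_ mI B mB.
have cmpl (N : set R) : (leb R).-negligible (N : set (LT R)) -> measurable (N : set (LT R)).
  exact: completed_lebesgue_measure_is_complete.
pose N : set R := ~` [set x | Iab x -> u x = v x].
have negN : (leb R).-negligible (N : set (LT R)) by [].
have mN := cmpl N negN.
have -> : Iab `&` v @^-1` B = (Iab `&` u @^-1` B `\` N) `|` (Iab `&` v @^-1` B `&` N).
  apply/seteqP; split => x /=.
    move=> [Ix vB]; have [Nx|Nx] := pselect (N x); [by right|left].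
    by split=> //; split => //=; rewrite (contrapT Nx).
  move=> [[[Ix uB] Nx]|[[Ix vB] _]]; last by [].
  by split => //; have := contrapT Nx => /= <-.
apply: measurableU; first exact: measurableD.
by apply: cmpl; apply: negligibleS negN; exact: subIsetr.
Qed.

Lemma fatou_aeI (F : nat -> R -> R) g (K : \bar R) :
  (forall n, mfI (F n)) -> mfI g -> (forall n x, Iab x -> 0 <= F n x) ->
  aeI (fun x => F ^~ x @ \oo --> g x) ->
  (forall n, (\int[leb R]_(x in Iab) (F n x)%:E <= K)%E) ->
  (\int[leb R]_(x in Iab) (g x)%:E <= K)%E.
Proof.
move=> mF mg F0 Fg FK; have mI := @measurable_Iab R.
have mEF n : measurable_fun (Iab : set (LT R)) (EFin \o F n).
  by apply/measurable_EFinP; exact: mF.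
have mlim : measurable_fun (Iab : set (LT R)) (fun x => limn_einf (fun n => (F n x)%:E)).
  exact: measurable_limn_einf mEF.
have E : (\int[leb R]_(x in Iab) (g x)%:E =
    \int[leb R]_(x in Iab) limn_einf (fun n => (F n x)%:E))%E.
  apply: ae_eq_integral; [exact: mI| |exact: mlim|].
    by apply/measurable_EFinP; exact: mg.
  apply: aeI_S Fg => x Ix Fgx.
  have h : (F n x)%:E @[n --> \oo] --> (g x)%:E by apply: cvg_EFin Fgx; exact: nearW.
  by apply/esym; exact: (cvg_limn_einf_sup h).1.
rewrite E; apply: (le_trans (fatou (leb R) mI mEF _)).
  by move=> n x Ix; rewrite lee_fin F0.
rewrite limn_einf_lim; apply: lime_le; first exact: is_cvg_einfs.
apply: nearW => n; apply: le_trans (FK n).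
by apply: ereal_inf_lbound; exists n => /=.
Qed.

Lemma le_int_Iab u v : IL1 u -> IL1 v -> (forall x, Iab x -> u x <= v x) ->
  \int[leb R]_(x in Iab) u x <= \int[leb R]_(x in Iab) v x.
Proof. by apply: le_Rintegral; exact: measurable_Iab. Qed.

Lemma IL1P u : mfI u -> (\int[leb R]_(x in Iab) (`|u x|)%:E < +oo)%E -> IL1 u.
Proof.
by move=> mu_ uy; apply/integrableP; split => //; apply/measurable_EFinP.
Qed.

Lemma normI_EFin u : IL1 u -> (normI u)%:E = (\int[leb R]_(x in Iab) (`|u x|)%:E)%E.
Proof.
move=> ui; rewrite /normI /Rintegral fineK//; apply: integrable_fin_num.
  exact: measurable_Iab.
exact: IL1_abs.
Qed.

Lemma IL1_lty u : IL1 u -> (\int[leb R]_(x in Iab) (`|u x|)%:E < +oo)%E.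
Proof. by move=> ui; rewrite -normI_EFin// ltry. Qed.

Definition clamp (M x : R) : R := Num.max (- M) (Num.min M x).

Lemma clamp_id (M x : R) : `|x| <= M -> clamp M x = x.
Proof. by rewrite ler_norml => /andP[h1 h2]; rewrite /clamp min_r// max_r. Qed.

Lemma clamp_le (M x : R) : 0 <= M -> `|clamp M x| <= M.
Proof.
by move=> M0; rewrite ler_norml /clamp le_max lexx/= ge_max ge_min lexx andbT; lra.
Qed.

Lemma clamp_dist (M x : R) : 0 <= M -> `|x - clamp M x| <= (if M < `|x| then `|x| else 0).
Proof.
move=> M0; case: ifPn => [xM|]; last first.
  by rewrite -leNgt => xM; rewrite clamp_id// subrr normr0.
have [x0|x0] := leP 0 x.
  rewrite (ger0_norm x0) in xM *.
  have -> : clamp M x = M by rewrite /clamp min_l ?max_r; lra.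
  by rewrite ger0_norm; lra.
rewrite (ltr0_norm x0) in xM *.
have -> : clamp M x = - M by rewrite /clamp min_r ?max_l; lra.
by rewrite ler0_norm; lra.
Qed.

Lemma mfI_clamp (M : R) u : mfI u -> mfI (fun x => clamp M (u x)).
Proof.
move=> mu_; apply: measurable_maxr; first exact: measurable_cst.
by apply: measurable_minr; first exact: measurable_cst.
Qed.

Lemma cvg_clamp (M : R) (h : nat -> R) (l : R) : h @ \oo --> l ->
  (fun n => clamp M (h n)) @ \oo --> clamp M l.
Proof.
move=> hl; apply: (cvg_comp _ _ hl).
apply: (@continuous_max _ _ (fun=> - M) ((fun=> M) \min id)); first exact: cst_continuous.
by apply: continuous_min; [exact: cst_continuous|exact: cvg_id].
Qed.

(** Vitali's convergence theorem. Clamping at height [M] changes every [h n], and by Fatou's lemma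
    also [g], by at most [eta] in L^1; the clamped functions converge by dominated convergence with
    a constant majorant. *)
Lemma uniform_integrable_cvg (h : nat -> R -> R) g :
  (forall n, IL1 (h n)) -> mfI g -> aeI (fun x => h ^~ x @ \oo --> g x) ->
  (forall eta : R, 0 < eta -> exists2 M : R, 0 <= M &
    forall n, \int[leb R]_(x in Iab) (if M < `|h n x| then `|h n x| else 0) <= eta) ->
  IL1 g /\ normI (fun x => h n x - g x) @[n --> \oo] --> (0 : R).
Proof.
move=> hi mg hg ui; have mI := @measurable_Iab R.
have mh n : mfI (h n) by exact: IL1_mfI.
have mt M n : mfI (fun x => if M < `|h n x| then `|h n x| else 0).
  exact: (measurable_tail M mI (mh n)).
have ti M n : IL1 (fun x => if M < `|h n x| then `|h n x| else 0).
  apply: le_IL1 (IL1_abs (hi n)) _; first exact: mt.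
  by move=> x _; case: ifPn; rewrite ?normr_id ?normr0.
have tail eta M n : 0 <= M ->
    \int[leb R]_(x in Iab) (if M < `|h n x| then `|h n x| else 0) <= eta ->
    normI (fun x => h n x - clamp M (h n x)) <= eta.
  move=> M0; apply: le_trans; apply: (le_int_Iab _ (ti M n)).
    apply: IL1_abs; apply: IL1_B => //.
    apply: (@IL1_bounded _ _ M); first exact: mfI_clamp.
    by move=> x _; exact: clamp_le.
  by move=> x _; exact: clamp_dist.
have clI M : 0 <= M -> forall w, mfI w -> IL1 (fun x => clamp M (w x)).
  move=> M0 w mw; apply: (@IL1_bounded _ _ M); first exact: mfI_clamp.
  by move=> x _; exact: clamp_le.
have tailg eta M : 0 <= M -> (forall n,
    \int[leb R]_(x in Iab) (if M < `|h n x| then `|h n x| else 0) <= eta) ->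
    IL1 (fun x => g x - clamp M (g x)) /\ normI (fun x => g x - clamp M (g x)) <= eta.
  move=> M0 hM.
  have le : (\int[leb R]_(x in Iab) (`|g x - clamp M (g x)|)%:E <= eta%:E)%E.
    apply: (@fatou_aeI (fun n x => `|h n x - clamp M (h n x)|)).
    - by move=> n; apply: mfI_norm; apply: mfI_B => //; exact: mfI_clamp.
    - by apply: mfI_norm; apply: mfI_B => //; exact: mfI_clamp.
    - by [].
    - apply: aeI_S hg => x _ hgx; apply: cvg_norm; apply: cvgB => //.
      exact: cvg_clamp.
    - move=> n; rewrite -normI_EFin; last by apply: IL1_B => //; exact: clI.
      by rewrite lee_fin; exact: tail.
  have i1 : IL1 (fun x => g x - clamp M (g x)).
    apply: IL1P; first by apply: mfI_B => //; exact: mfI_clamp.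
    by apply: le_lt_trans le _; rewrite ltry.
  by split => //; rewrite -lee_fin normI_EFin.
have gi : IL1 g.
  have [M M0 hM] := ui 1 ltr01; have [i1 _] := tailg _ _ M0 hM.
  by have := IL1_D i1 (clI M M0 g mg); apply: IL1_eq => x _; rewrite subrK.
split=> //; apply/cvgrPdist_lt => eps eps0.
have e3 : 0 < eps / 3 by rewrite divr_gt0.
have [M M0 hM] := ui _ e3; have [i1 tg] := tailg _ _ M0 hM.
have [_ cv] : IL1 (fun=> 0 : R) /\ \int[leb R]_(x in Iab) `|clamp M (h n x) - clamp M (g x)|
     @[n --> \oo] --> \int[leb R]_(x in Iab) (0 : R).
  apply: (@IL1_dominated _ _ _ (fun=> M + M)).
  - by move=> n; apply: mfI_norm; apply: mfI_B; exact: mfI_clamp.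
  - exact: measurable_cst.
  - apply: aeI_S hg => x _ hgx; rewrite -[X in _ --> X](normr0 R) -(subrr (clamp M (g x))).
    by apply: cvg_norm; apply: cvgB; [exact: cvg_clamp|exact: cvg_cst].
  - exact: IL1_cst.
  - apply: aeI_W => x Ix n; rewrite normr_id (le_trans (ler_normB _ _))//.
    by apply: lerD; exact: clamp_le.
rewrite Rintegral_cst// mul0r in cv.
near=> n; rewrite sub0r normrN ger0_norm ?normI_ge0//.
have c1 : IL1 (fun x => clamp M (h n x)) by exact: clI.
have c2 : IL1 (fun x => clamp M (g x)) by exact: clI.
apply: (le_lt_trans (normI_triangle (hi n) c1 gi)).
have t1 := tail _ _ n M0 (hM n).
have t2 := normI_triangle c1 c2 gi.
have t3 : normI (fun x => clamp M (g x) - g x) = normI (fun x => g x - clamp M (g x)).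
  by apply: eq_Rintegral => x _; rewrite distrC.
have t4 : normI (fun x => clamp M (h n x) - clamp M (g x)) < eps / 3.
  by near: n; exact: (cvgr_lt _ cv).
by move: t1 t2 t3 t4 tg; clear; lra.
Unshelve. all: by end_near. Qed.
End Fatou.

(** * Uniform integrability of the truncated transforms *)

Section BoundedFunctions.
Variable R : realType.
Implicit Types (u v w g phi : R -> R) (e t lam a b : R) (n : nat).

Definition Tr u t : R := lim (htr u e t @[e --> 0^'+]).

Definition step_e n : R := n.+1%:R^-1.

Lemma step_e_gt0 n : 0 < step_e n. Proof. by rewrite invr_gt0. Qed.

Lemma Tr_cvg u : IL1 u -> aeI (fun t => htr u e t @[e --> 0^'+] --> Tr u t).
Proof. by move=> ui; apply: aeI_S (htr_cvg ui) => t _. Qed.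

Lemma norm_int_Iab u v : mfI u -> IL1 v -> (forall x, Iab x -> `|u x| <= v x) ->
  `|\int[leb R]_(x in Iab) u x| <= \int[leb R]_(x in Iab) v x.
Proof. by apply: Rintegral_norm_le; exact: measurable_Iab. Qed.

Lemma int_Iab_Zl u c : IL1 u ->
  \int[leb R]_(x in Iab) (c * u x) = c * \int[leb R]_(x in Iab) u x.
Proof. by move=> ui; apply: RintegralZl; [exact: measurable_Iab|exact: ui]. Qed.

Lemma int_Iab_D u v : IL1 u -> IL1 v ->
  \int[leb R]_(x in Iab) (u x + v x) =
  \int[leb R]_(x in Iab) u x + \int[leb R]_(x in Iab) v x.
Proof. by move=> ui vi; apply: RintegralD; [exact: measurable_Iab|exact: ui|exact: vi]. Qed.

Lemma Tr_seq u : IL1 u -> aeI (fun t => htr u (step_e n) t @[n --> \oo] --> Tr u t).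
Proof.
move=> ui; apply: aeI_S (Tr_cvg ui) => t _ h.
move/cvg_at_rightP : h; apply.
split; first exact: step_e_gt0.
exact: cvg_harmonic.
Qed.

(** Along the sequence [step_e] the limit is almost everywhere a lower limit of measurable
    functions. *)
Lemma mfI_Tr u : IL1 u -> mfI (Tr u).
Proof.
move=> ui; have mI := @measurable_Iab R.
have mh n : mfI (htr u (step_e n)) by apply: mfI_htr => //; exact: step_e_gt0.
pose G t := fine (limn_einf (fun n => (htr u (step_e n) t)%:E)).
apply: (@mfI_ae _ G).
  rewrite /G; apply: measurableT_comp; first exact: fine_measurable.
  by apply: measurable_limn_einf => n; apply/measurable_EFinP; exact: mh.
apply: aeI_S (Tr_seq ui) => t _ ht; rewrite /G.
have h : (htr u (step_e n) t)%:E @[n --> \oo] --> (Tr u t)%:E.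
  by apply: cvg_EFin; [exact: nearW|exact: ht].
by rewrite (cvg_limn_einf_sup h).1.
Qed.

Lemma TrD u v : IL1 u -> IL1 v -> aeI (fun t => Tr (fun x => u x + v x) t = Tr u t + Tr v t).
Proof.
move=> ui vi; apply: aeI_S (aeI_and (Tr_cvg ui) (Tr_cvg vi)) => t _ [hu hv].
apply: (@cvg_lim R); first exact: Rhausdorff.
apply: cvg_trans (cvgD hu hv); apply: near_eq_cvg; near=> e.
by rewrite /= htrD//; near: e; exact: nbhs_right_gt.
Unshelve. all: by end_near. Qed.

Lemma TrZ u c : IL1 u -> aeI (fun t => Tr (fun x => c * u x) t = c * Tr u t).
Proof.
move=> ui; apply: aeI_S (Tr_cvg ui) => t _ hu.
apply: (@cvg_lim R); first exact: Rhausdorff.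
have h : (c * htr u e t) @[e --> 0^'+] --> c * Tr u t by exact: cvgMr.
apply: cvg_trans h; apply: near_eq_cvg; near=> e.
by rewrite /= htrZ//; near: e; exact: nbhs_right_gt.
Unshelve. all: by end_near. Qed.

Lemma Tr_weak11 u lam : IL1 u -> 0 < lam -> exists U : set R,
  [/\ measurable (U : set (LT R)), aeI (fun t => ~ U t -> `|Tr u t| <= lam) &
     (leb R U <= (96 * normI u / lam)%:E)%E].
Proof.
move=> ui lam0; have [U [oU hU mU]] := htr_weak11 ui lam0.
exists U; split => //; first by apply: borel_leb; exact: open_measurable.
apply: aeI_S (Tr_seq ui) => t _ ht Ut.
rewrite leNgt; apply/negP => h; apply: Ut.
have /filter_ex[n hn] : \forall n \near \oo, lam < `|htr u (step_e n) t|.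
  by apply: (cvgr_gt _ (cvg_norm ht)).
by apply: hU hn; exact: step_e_gt0.
Qed.

(** A stand-in for the indicator of a set of measure at most [a] that is stable under multiplication
    by signs. *)
Definition unit_on a u := [/\ mfI u, forall x, Iab x -> `|u x| <= 1 &
  (leb R (Iab `&` [set x | u x != 0%R]) <= a%:E)%E].

Lemma unit_on_IL1 a u : unit_on a u -> IL1 u.
Proof. by move=> [mu_ u1 _]; exact: IL1_bounded u1. Qed.

Lemma measurable_support u : mfI u -> measurable (Iab `&` [set x | u x != 0%R] : set (LT R)).
Proof.
move=> mu_; have := mu_ (@measurable_Iab R) (~` [set 0%R]) (measurableC (measurable_set1 _)).
by congr measurable; congr (_ `&` _); apply/seteqP; split => x /= /eqP.
Qed.

Lemma mfI_indic (A : set R) : measurable (A : set (LT R)) -> mfI (\1_A : R -> R).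
Proof. exact: (@measurable_indic _ (LT R) R). Qed.

Lemma indic_le1 (A : set R) x : `|\1_A x : R| <= 1.
Proof. by rewrite indicE; case: (_ \in _); rewrite ?normr1 ?normr0. Qed.

Lemma IL1_indic (A : set R) : measurable (A : set (LT R)) -> IL1 (\1_A : R -> R).
Proof.
move=> mA; apply: (@IL1_bounded _ _ 1); first exact: mfI_indic.
by move=> x _; exact: indic_le1.
Qed.

Lemma Rintegral_indicI (A : set R) : measurable (A : set (LT R)) ->
  ((\int[leb R]_(x in Iab) (\1_A x : R))%:E = leb R (Iab `&` A))%E.
Proof.
move=> mA; rewrite /Rintegral fineK; last first.
  by apply: integrable_fin_num; [exact: measurable_Iab|exact: IL1_indic].
by rewrite integral_indic; [rewrite setIC|exact: measurable_Iab|exact: mA].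
Qed.

Lemma unit_on_normI a u : unit_on a u -> normI u <= a.
Proof.
move=> ua; have ui := unit_on_IL1 ua; have [mu_ u1 ma] := ua.
have mS := measurable_support mu_.
rewrite -lee_fin; apply: le_trans ma.
rewrite -[X in leb R X](_ : Iab `&` (Iab `&` [set x | u x != 0%R]) = _); last first.
  by rewrite setIA setIid.
rewrite -Rintegral_indicI// lee_fin; apply: le_int_Iab.
- exact: IL1_abs.
- exact: IL1_indic.
- move=> x Ix; rewrite indicE; case: (boolP (u x == 0)) => [/eqP ->|ux]; first by rewrite normr0.
  by rewrite (_ : x \in _ = true) ?u1//; apply: mem_set.
Qed.

(** The aim is a bound [M] that does not depend on the truncation [e]. *)
Definition pairing_le e a b (M : R) := forall u v,
  unit_on a u -> unit_on b v -> `|\int[leb R]_(t in Iab) (v t * htr u e t)| <= M.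

Lemma IL1_pairing e u v (M : R) : 0 < e -> IL1 u -> mfI v ->
  (forall x, Iab x -> `|v x| <= M) -> IL1 (fun t => v t * htr u e t).
Proof.
move=> e0 ui mv v1; have := IL1_mul_bounded (IL1_htr ui e0) mv v1.
by apply: IL1_eq => x _; rewrite mulrC.
Qed.

Lemma pairing_sym e a b M : 0 < e -> pairing_le e a b M -> pairing_le e b a M.
Proof.
move=> e0 h u v ub va; rewrite htr_antisym// ?normrN; first exact: h.
- exact: unit_on_IL1 ub.
- exact: unit_on_IL1 va.
Qed.

(* Remove from the support of [v] the exceptional set given by the weak type
   inequality at the level [192 a / b]. *)
Lemma pairing_half e a b M : 0 < e -> 0 < a -> 0 < b -> pairing_le e a (b / 2) M ->
  pairing_le e a b (192 * a + M).
Proof.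
move=> e0 a0 b0 h u v ua vb; have ui := unit_on_IL1 ua.
(* This level leaves an exceptional set of measure at most [96 a / lam = b / 2]; off it the integral
   is at most [lam b = 192 a]. *)
pose lam := 192 * a / b; have lam0 : 0 < lam by rewrite divr_gt0 ?mulr_gt0.
have [U [oU hU mU]] := htr_weak11 ui lam0.
have mU' : measurable (U : set (LT R)) by apply: borel_leb; exact: open_measurable.
have [mv v1 mvb] := vb; have vi := unit_on_IL1 vb.
pose v1' x := v x * \1_U x; pose v2 x := v x * \1_(~` U) x.
have mv1 : mfI v1' by apply: mfI_M => //; exact: mfI_indic.
have mv2 : mfI v2 by apply: mfI_M => //; apply: mfI_indic; exact: measurableC.
have vE x : v x = v1' x + v2 x.
  rewrite /v1' /v2 -mulrDr !indicE in_setC; case: (_ \in _); rewrite ?addr0 ?add0r mulr1//.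
have v1le x : Iab x -> `|v1' x| <= 1.
  by move=> Ix; rewrite normrM mulr_ile1// ?v1// indic_le1.
have v2le x : Iab x -> `|v2 x| <= 1.
  by move=> Ix; rewrite normrM mulr_ile1// ?v1// indic_le1.
have uv1 : unit_on (b / 2) v1'.
  split=> //; apply: (@le_trans _ _ (leb R U)).
    apply: le_outer_measure => x [_ /=]; rewrite /v1' indicE.
    by case: (boolP (x \in U)) => [/set_mem//|]; rewrite mulr0 eqxx.
  apply: (le_trans mU); rewrite lee_fin /lam.
  rewrite ler_pdivrMr//.
  have -> : b / 2 * (192 * a / b) = 96 * a by field; rewrite gt_eqF.
  by rewrite ler_pM2l//; exact: unit_on_normI ua.
have -> : \int[leb R]_(t in Iab) (v t * htr u e t) =
    \int[leb R]_(t in Iab) (v1' t * htr u e t) + \int[leb R]_(t in Iab) (v2 t * htr u e t).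
  rewrite -int_Iab_D; [|exact: IL1_pairing v1le|exact: IL1_pairing v2le].
  by apply: eq_Rintegral => x _; rewrite -mulrDl -vE.
apply: (le_trans (ler_normD _ _)); rewrite addrC; apply: lerD; last exact: h.
have lvi : IL1 (fun x => lam * `|v x|) by apply: IL1_Zl; exact: IL1_abs.
apply: (@le_trans _ _ (\int[leb R]_(x in Iab) (lam * `|v x|))).
  apply: (norm_int_Iab _ lvi).
  - by apply: IL1_mfI; exact: IL1_pairing v2le.
  - move=> x Ix; rewrite normrM /v2 normrM indicE in_setC.
    case: (boolP (x \in U)) => [_|/negP xU].
      by rewrite normr0 mulr0 mul0r mulr_ge0// ltW.
    rewrite normr1 mulr1 mulrC ler_wpM2r// leNgt; apply/negP => hl.
    by apply: xU; apply: mem_set; exact: hU hl.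
rewrite int_Iab_Zl; last exact: IL1_abs.
rewrite -/(normI v) (@le_trans _ _ (lam * b))// ?ler_pM2l//; first exact: unit_on_normI vb.
by rewrite /lam divfK// gt_eqF.
Qed.

Lemma pairing_half_left e a b M : 0 < e -> 0 < a -> 0 < b -> pairing_le e (a / 2) b M ->
  pairing_le e a b (192 * b + M).
Proof. by move=> e0 a0 b0 /(pairing_sym e0) h; apply: pairing_sym => //; exact: pairing_half. Qed.

Lemma pairing_trivial e a b : 0 < a -> 0 < b -> 0 < e ->
  pairing_le e a b (e^-1 * a * b).
Proof.
move=> a0 b0 e0 u v ua vb; have ui := unit_on_IL1 ua; have vi := unit_on_IL1 vb.
have [mv v1 _] := vb.
have lvi : IL1 (fun x => e^-1 * normI u * `|v x|) by apply: IL1_Zl; exact: IL1_abs.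
apply: (@le_trans _ _ (\int[leb R]_(x in Iab) (e^-1 * normI u * `|v x|))).
  apply: (norm_int_Iab _ lvi).
  - by apply: IL1_mfI; exact: IL1_pairing v1.
  - by move=> x Ix; rewrite normrM mulrC ler_wpM2r// htr_le.
rewrite int_Iab_Zl; last exact: IL1_abs.
apply: ler_pM; rewrite ?normI_ge0//.
- by rewrite mulr_ge0 ?normI_ge0// invr_ge0 ltW.
- by rewrite ler_pM2l ?invr_gt0//; exact: unit_on_normI ua.
- exact: unit_on_normI vb.
Qed.

(* Halving the two sizes in turn costs a geometric series; the remainder tends to 0
   because the truncated kernel is bounded. *)
Lemma pairing_diag e a : 0 < e -> 0 < a -> pairing_le e a a (576 * a).
Proof.
move=> e0 a0.
(* Halving the second size costs [192 c], then halving the first costs [192 (c / 2) = 96 c]; the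
   number 576 solves [K = 192 + 96 + K / 2]. *)
have step n : forall c, 0 < c -> pairing_le e c c (576 * c + e^-1 * (c / 2 ^+ n) ^+ 2).
  elim: n => [|n ih] c c0 u v uc vc.
    apply: (le_trans (pairing_trivial c0 c0 e0 uc vc)).
    have t0 : 0 <= e^-1 * c ^+ 2 by rewrite mulr_ge0 ?invr_ge0 ?sqr_ge0 ?(ltW e0).
    have m0 : 0 <= 576 * c by exact: mulr_ge0 (ler0n R 576) (ltW c0).
    by rewrite expr0 divr1 -mulrA -expr2 -[leLHS]add0r; apply: lerD.
  have c20 : 0 < c / 2 by rewrite divr_gt0.
  have := pairing_half e0 c0 c0 (pairing_half_left e0 c0 c20 (ih _ c20)) uc vc.
  have -> : c / 2 ^+ n.+1 = c / 2 / 2 ^+ n by rewrite [2 ^+ n.+1]exprS invfM mulrA.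
  by move=> h; apply: (le_trans h); rewrite !addrA lerD2r; lra.
move=> u v ua va; set I := `|_|.
apply/ler_addgt0Pr => eta eta0.
have [n hn] : exists n, e^-1 * (a / 2 ^+ n) ^+ 2 < eta.
  have : e^-1 * a ^+ 2 * 4^-1 ^+ n @[n --> \oo] --> e^-1 * a ^+ 2 * (0 : R).
    by apply: cvgMr; apply: cvg_expr; rewrite ger0_norm ?invf_lt1 ?ltr1n.
  rewrite mulr0 => /(cvgr_lt _)/(_ _ eta0)/filter_ex[n hn]; exists n.
  by rewrite expr_div_n -mulrA -exprM mulnC exprM -exprVn -natrX in hn *.
by apply: (le_trans (step n a a0 u v ua va)); rewrite lerD2l ltW.
Qed.

(** From the diagonal pair [(b, b)], doubling the first size costs [192 b] each time, and [n]
    doublings reach 2, the measure of (-1,1). The bound is of order [b log (1 / b)] and tends to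
    0. *)
Lemma pairing_off_diag e n : 0 < e ->
  pairing_le e 2 (2 / 2 ^+ n) ((576 + 192 * n%:R) * (2 / 2 ^+ n)).
Proof.
move=> e0; set b := 2 / 2 ^+ n; have b0 : 0 < b by rewrite divr_gt0// exprn_gt0.
have step k : pairing_le e (b * 2 ^+ k) b ((576 + 192 * k%:R) * b).
  elim: k => [|k ih]; first by rewrite expr0 mulr1 mulr0 addr0; exact: pairing_diag.
  have h : 0 < b * 2 ^+ k.+1 by rewrite mulr_gt0// exprn_gt0.
  rewrite (_ : (576 + _) * b = 192 * b + (576 + 192 * k%:R) * b); last first.
    by rewrite -natr1; ring.
  apply: pairing_half_left => //; congr pairing_le : ih.
  by rewrite exprS; field.
by have := step n; rewrite {1}/b divfK// gt_eqF// exprn_gt0.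
Qed.

(** Pair the truncated transform with its own sign on [A]; this test function is bounded by 1 and
    lives on a set of measure at most [d]. The choice of [d] depends neither on [e] nor on [u]. *)
Lemma htr_uniform_integrable (eta : R) : 0 < eta -> exists2 d, 0 < d &
  forall e u (A : set R), 0 < e -> mfI u -> (forall x, Iab x -> `|u x| <= 1) ->
  measurable (A : set (LT R)) -> A `<=` Iab -> (leb R A <= d%:E)%E ->
  \int[leb R]_(t in Iab) (\1_A t * `|htr u e t|) <= eta.
Proof.
move=> eta0.
have [n hn] : exists n, (576 + 192 * n%:R) * (2 / 2 ^+ n) < eta.
  (* For [n = 2 m], the inequality [m <= 2^m] bounds the quantity by
     [(1152 + 768 2^m) / 4^m <= 1920 / 2^m]. *)
  have : (1920 : R) * 2^-1 ^+ m @[m --> \oo] --> 1920 * (0 : R).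
    by apply: cvgMr; apply: cvg_expr; rewrite ger0_norm ?invf_lt1 ?ltr1n.
  rewrite mulr0 => /(cvgr_lt _)/(_ _ eta0)/filter_ex[m hm]; exists (m + m)%N.
  apply: le_lt_trans hm; rewrite exprD natrD exprVn; set p := 2 ^+ m.
  have p0 : 0 < p by rewrite exprn_gt0.
  have p1 : 1 <= p by rewrite exprn_ege1// ler1n.
  have mp : m%:R <= p by rewrite /p -natrX ler_nat ltnW// ltn_expl.
  rewrite invfM !mulrA ler_pM2r ?invr_gt0// ler_pdivrMr//; nra.
exists (2 / 2 ^+ n); first by rewrite divr_gt0// exprn_gt0.
move=> e u A e0 mu_ u1 mA AI Ad.
have u2 : unit_on 2 u.
  by split => //; rewrite -(leb_Iab R); apply: le_outer_measure => x [].
have ui := unit_on_IL1 u2.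
pose v t := \1_A t * Num.sg (htr u e t).
have msg : measurable_fun [set: measurableTypeR R] (Num.sg : R -> R).
  apply: nondecreasing_measurable => // x y xy.
  have [y0|y0|y0] := ltrgt0P y; last by subst y; rewrite sgr0 sgr_le0.
    by rewrite (gtr0_sg y0); case: sgrP => // _; exact: lerN10.
  by rewrite (ltr0_sg y0) ltr0_sg// (le_lt_trans xy).
have mv : mfI v.
  apply: mfI_M; first exact: mfI_indic.
  exact: (measurableT_comp msg (mfI_htr ui e0)).
have vd : unit_on (2 / 2 ^+ n) v.
  split => //.
    by move=> x Ix; rewrite normrM mulr_ile1 ?indic_le1// normr_sg; case: (_ == _).
  apply: le_trans Ad; apply: le_outer_measure => x [_ /=]; rewrite /v indicE.
  by case: (boolP (x \in A)) => [/set_mem//|]; rewrite mul0r eqxx.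
have := pairing_off_diag e0 u2 vd.
rewrite ger0_norm; last first.
  apply: Rintegral_ge0 => x _; rewrite /v -mulrA -normrEsg mulr_ge0// indicE; case: (_ \in _) => //.
move=> h; apply/ltW; apply: le_lt_trans hn; apply: le_trans h.
rewrite le_eqVlt; apply/orP; left; apply/eqP.
by apply: eq_Rintegral => x _; rewrite /v -mulrA -normrEsg.
Qed.

End BoundedFunctions.

(** * Passage to the limit in the real transform *)

Section TransformConvergence.
Variable R : realType.
Implicit Types (u v w g phi : R -> R) (e t lam a b : R) (n : nat).

Lemma htr_aeI_eq u v e t : IL1 u -> IL1 v -> aeI (fun x => u x = v x) -> 0 < e ->
  htr u e t = htr v e t.
Proof.
move=> ui vi uv e0; apply: Rintegral_aeI.
- by apply: IL1_mfI; exact: htr_integrable.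
- by apply: IL1_mfI; exact: htr_integrable.
- by apply: aeI_S uv => x _ ->.
Qed.

Lemma measurable_superlevel w lam : mfI w ->
  measurable (Iab `&` [set t | lam < w t] : set (LT R)).
Proof.
move=> mw; have := mw (@measurable_Iab R) `]lam, +oo[%classic (measurable_itv _).
by congr measurable; congr (_ `&` _); apply/seteqP; split => x /=; rewrite in_itv/= andbT.
Qed.

(** The truncated transforms converge almost everywhere and are uniformly integrable, so Vitali's
    theorem gives convergence in L^1. Dividing by a bound [M'] of [u], made at least 1, reduces to
    functions bounded by 1. *)
Lemma Tr_bounded u (M : R) : mfI u -> (forall x, Iab x -> `|u x| <= M) ->
  IL1 (Tr u) /\ normI (fun x => htr u (step_e R n) x - Tr u x) @[n --> \oo] --> (0 : R).
Proof.
move=> mu_ uM; have ui := IL1_bounded mu_ uM.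
pose M' := Num.max M 1; have M'0 : 0 < M' by rewrite lt_max ltr01 orbT.
have {}uM x : Iab x -> `|u x| <= M' by move=> /uM h; rewrite le_max h.
pose w x := M'^-1 * u x.
have mw : mfI w by apply: mfI_M => //; exact: measurable_cst.
have w1 x : Iab x -> `|w x| <= 1.
  move=> /uM h; rewrite /w normrM gtr0_norm ?invr_gt0//.
  by rewrite ler_pdivrMl// mulr1.
have he n := step_e_gt0 R n.
have hi n : IL1 (htr u (step_e R n)) by exact: IL1_htr.
have uE n t : htr u (step_e R n) t = M' * htr w (step_e R n) t.
  rewrite -htrZ//; last exact: IL1_bounded w1.
  by congr htr; apply/funext => x; rewrite /w mulVKf// gt_eqF.
apply: uniform_integrable_cvg => //.
- exact: mfI_Tr.
- exact: Tr_seq.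
- move=> eta eta0.
  have [d d0 hd] := htr_uniform_integrable (divr_gt0 eta0 M'0).
  (* At this height the weak type bound makes all level sets of measure at most [d]; adding 1 keeps
     the height positive. *)
  pose lam := 96 * normI u / d + 1.
  have lam0 : 0 < lam by rewrite ltr_wpDl// divr_ge0 ?mulr_ge0 ?normI_ge0 ?(ltW d0).
  have [U [oU hU mU]] := htr_weak11 ui lam0.
  exists lam; first exact: ltW.
  move=> n.
  pose A := Iab `&` [set t | lam < `|htr u (step_e R n) t|].
  have mA : measurable (A : set (LT R)).
    by apply: measurable_superlevel; apply: mfI_norm; exact: IL1_mfI.
  have Ad : (leb R A <= d%:E)%E.
    apply: (@le_trans _ _ (leb R U)).
      by apply: le_outer_measure => t [_ /=]; exact: hU.
    apply: (le_trans mU); rewrite lee_fin ler_pdivrMr// -ler_pdivrMl//.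
    by rewrite mulrC /lam lerDl.
  have AI : A `<=` Iab by move=> x [].
  have := hd _ _ _ (he n) mw w1 mA AI Ad; rewrite ler_pdivlMr//.
  apply: le_trans; rewrite mulrC -int_Iab_Zl; last first.
    have := IL1_mul_bounded (IL1_abs (IL1_htr (IL1_bounded mw w1) (he n)))
      (mfI_indic mA) (fun x _ => indic_le1 A x).
    by apply: IL1_eq => x _; rewrite mulrC.
  rewrite le_eqVlt; apply/orP; left; apply/eqP.
  apply: eq_Rintegral => x /set_mem Ix; rewrite indicE mulrCA.
  rewrite -[X in _ = _ * (X * _)](gtr0_norm M'0) -normrM -uE.
  case: ifPn => hx; first by rewrite (_ : x \in A) ?mul1r//; exact: mem_set.
  rewrite (_ : x \in A = false) ?mul0r//; apply/negP => /set_mem[_ /=].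
  by rewrite (negbTE hx).
Qed.

(** Antisymmetry of the truncated transforms survives the limit, since they converge in L^1 and the
    other factor is bounded. *)
Lemma Tr_parseval_bounded u v (M N : R) : mfI u -> (forall x, Iab x -> `|u x| <= M) ->
  mfI v -> (forall x, Iab x -> `|v x| <= N) ->
  \int[leb R]_(x in Iab) (v x * Tr u x) = - \int[leb R]_(x in Iab) (u x * Tr v x).
Proof.
move=> mu_ uM mv vN; have ui := IL1_bounded mu_ uM; have vi := IL1_bounded mv vN.
have he n := step_e_gt0 R n.
have cv w w' (K L : R) : mfI w -> (forall x, Iab x -> `|w x| <= K) ->
    mfI w' -> (forall x, Iab x -> `|w' x| <= L) ->
    \int[leb R]_(x in Iab) (w' x * htr w (step_e R n) x) @[n --> \oo]
      --> \int[leb R]_(x in Iab) (w' x * Tr w x).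
  move=> mw wK mw' w'L; have wi := IL1_bounded mw wK.
  have [ti tc] := Tr_bounded mw wK.
  have hi n : IL1 (htr w (step_e R n)) by exact: IL1_htr.
  have i1 z : IL1 z -> IL1 (fun x => w' x * z x).
    by move=> zi; have := IL1_mul_bounded zi mw' w'L; apply: IL1_eq => x _; rewrite mulrC.
  pose L' := Num.max L 1; have L'0 : 0 < L' by rewrite lt_max ltr01 orbT.
  have {}w'L x : Iab x -> `|w' x| <= L' by move=> /w'L h; rewrite le_max h.
  apply/cvgrPdist_lt => eps eps0.
  have e0 : 0 < eps / L' by rewrite divr_gt0.
  near=> n.
  have small : normI (fun x => htr w (step_e R n) x - Tr w x) < eps / L'.
    by near: n; exact: (cvgr_lt _ tc).
  rewrite ltr_pdivlMr// in small; apply: le_lt_trans small.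
  rewrite distrC.
  have -> : \int[leb R]_(x in Iab) (w' x * htr w (step_e R n) x)
     - \int[leb R]_(x in Iab) (w' x * Tr w x) =
     \int[leb R]_(x in Iab) (w' x * (htr w (step_e R n) x - Tr w x)).
    rewrite -RintegralB; [|exact: measurable_Iab|exact: (i1 _ (hi n))|exact: (i1 _ ti)].
    by apply: eq_Rintegral => x _; rewrite mulrBr.
  have di : IL1 (fun x => htr w (step_e R n) x - Tr w x) by exact: IL1_B.
  rewrite mulrC -int_Iab_Zl; last exact: IL1_abs.
  apply: norm_int_Iab.
  - exact: (IL1_mfI (i1 _ di)).
  - by apply: IL1_Zl; exact: IL1_abs.
  - by move=> x /w'L h; rewrite normrM ler_wpM2r.
have c1 := cv u v M N mu_ uM mv vN.
have c2 : (- \int[leb R]_(x in Iab) (u x * htr v (step_e R n) x)) @[n --> \oo]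
    --> - \int[leb R]_(x in Iab) (u x * Tr v x).
  by apply: cvgN; exact: cv vN mu_ uM.
have E : (fun n => \int[leb R]_(x in Iab) (v x * htr u (step_e R n) x)) =
    (fun n => - \int[leb R]_(x in Iab) (u x * htr v (step_e R n) x)).
  by apply/funext => n; rewrite htr_antisym.
rewrite E in c1.
exact: etrans (esym (cvg_lim (@Rhausdorff R) c1)) (cvg_lim (@Rhausdorff R) c2).
Unshelve. all: by end_near. Qed.

(** Borel-Cantelli: at level [2^-n] the exceptional set has measure at most [96 / 2^n], because
    [4^-n] beats the loss [2^n] of the weak type bound. Almost every point is thus exceptional only
    finitely often. *)
Lemma Tr_cvg_fast (F : nat -> R -> R) u : (forall n, IL1 (F n)) -> IL1 u ->
  (forall n, normI (fun x => F n x - u x) <= 4^-1 ^+ n) ->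
  aeI (fun t => Tr (F n) t @[n --> \oo] --> Tr u t).
Proof.
move=> Fi ui Fu; have di n : IL1 (fun x => F n x - u x) by exact: IL1_B.
have /choice[U hU] n : exists U : set R,
  [/\ measurable (U : set (LT R)),
    aeI (fun t => ~ U t -> `|Tr (fun x => F n x - u x) t| <= 2^-1 ^+ n) &
     (leb R U <= (96 * normI (fun x => F n x - u x)%R / 2^-1 ^+ n)%:E)%E].
  by apply: Tr_weak11 => //; rewrite exprn_gt0.
have mU n : measurable (U n : set (LT R)) by have [] := hU n.
have aeU : aeI (fun t => forall n, ~ U n t ->
    `|Tr (fun x => F n x - u x) t| <= 2^-1 ^+ n).
  by apply: aeI_forall => n; have [] := hU n.
have U0 : leb R (lim_sup_set U) = 0.
  apply: lim_sup_set_cvg0 => //.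
  (* 192 is the sum of the series of [96 / 2^n]. *)
  apply: (@le_lt_trans _ _ (192 : R)%:E); last by rewrite ltry.
  have := cvg_lim (@ereal_hausdorff R) (@cvg_geometric_eseries_half R 192 0).
  rewrite expr0 divr1 => <-; apply: lee_nneseries => //.
  move=> n _; have [_ _ h] := hU n; apply: (le_trans h); rewrite lee_fin.
  rewrite exprVn invrK addn1 natrX exprS; set p := 2 ^+ n.
  have p0 : 0 < p by rewrite exprn_gt0.
  have E4 : (4^-1 : R) ^+ n = (p * p)^-1.
    by rewrite exprVn /p -exprMn; congr (_ ^+ _)^-1; lra.
  rewrite ler_pdivlMr ?mulr_gt0//.
  have : normI (fun x => F n x - u x) * (p * p) <= 1.
    by rewrite -ler_pdivlMr ?mulr_gt0// mul1r -E4.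
  set c := normI _; clear; move=> h.
  have -> : 96 * c * p * (2 * p) = 192 * (c * (p * p)) by ring.
  by rewrite -[leRHS]mulr1 ler_pM2l.
have aeL : aeI (fun t => ~ lim_sup_set U t).
  exists (lim_sup_set U); split => //.
    apply: bigcapT_measurable => n; apply: bigcup_measurable => k _; exact: mU.
  by move=> t /= /not_implyP[_ /contrapT].
have aeD : aeI (fun t => forall n, Tr (fun x => F n x - u x) t = Tr (F n) t - Tr u t).
  apply: aeI_forall => n.
  have h1 := TrD (Fi n) (IL1_Zl (-1) ui); have h2 := TrZ (-1) ui.
  apply: aeI_S (aeI_and h1 h2) => t _ [].
  rewrite (_ : (fun x => F n x + -1 * u x) = fun x => F n x - u x); last first.
    by apply/funext => x; rewrite mulN1r.
  by move=> -> ->; rewrite mulN1r.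
apply: aeI_S (aeI_and aeL (aeI_and aeU aeD)) => t _ [Lt [Ut Dt]].
have [k hk] : exists k, forall n, (k <= n)%N -> ~ U n t.
  apply: contrapT => h; apply: Lt => k _ /=.
  apply: contrapT => h'; apply: h; exists k => n kn Unt; apply: h'.
  by exists n.
apply/cvgrPdist_lt => eps eps0; near=> n.
rewrite distrC -Dt; apply: (@le_lt_trans _ _ (2^-1 ^+ n)).
  by apply: Ut; apply: hk; near: n; exact: nbhs_infty_ge.
near: n.
have : 2^-1 ^+ n @[n --> \oo] --> (0 : R) by apply: cvg_expr; rewrite ger0_norm ?invf_lt1 ?ltr1n.
by move=> /(cvgr_lt _); apply.
Unshelve. all: by end_near. Qed.

End TransformConvergence.

(** * Complex-valued functions *)

Section ComplexBasics.
Variable R : realType.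
Implicit Types (x y z : R[i]).
Local Notation Re := complex.Re.
Local Notation Im := complex.Im.

Lemma ReD x y : Re (x + y) = Re x + Re y. Proof. by case: x; case: y. Qed.
Lemma ImD x y : Im (x + y) = Im x + Im y. Proof. by case: x; case: y. Qed.
Lemma ReN x : Re (- x) = - Re x. Proof. by case: x. Qed.
Lemma ImN x : Im (- x) = - Im x. Proof. by case: x. Qed.
Lemma ReM x y : Re (x * y) = Re x * Re y - Im x * Im y.
Proof. by case: x; case: y. Qed.
Lemma ImM x y : Im (x * y) = Re x * Im y + Im x * Re y.
Proof. by case: x; case: y. Qed.
Lemma ReC (r : R) : Re r%:C%C = r. Proof. by []. Qed.

Lemma complex_eq x y : Re x = Re y -> Im x = Im y -> x = y.
Proof. by case: x => a b; case: y => c d /= -> ->. Qed.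

Lemma cabsE z : cabs z = Num.sqrt (Re z ^+ 2 + Im z ^+ 2).
Proof. by case: z. Qed.

Lemma cabs_ge0 z : 0 <= cabs z.
Proof. by rewrite cabsE sqrtr_ge0. Qed.

Lemma cabsM x y : cabs (x * y) = cabs x * cabs y.
Proof. exact: ComplexField.Normc.normcM. Qed.

Lemma cabsD x y : cabs (x + y) <= cabs x + cabs y.
Proof. exact: le_normcD. Qed.

Lemma cabsN x : cabs (- x) = cabs x.
Proof. exact: normcN. Qed.

Lemma cabsB x y : cabs (x - y) <= cabs x + cabs y.
Proof. by rewrite -(cabsN y) cabsD. Qed.

Lemma cabs_distrC x y : cabs (x - y) = cabs (y - x).
Proof. by rewrite -cabsN opprB. Qed.

Lemma cabsC (r : R) : cabs r%:C%C = `|r|.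
Proof. by rewrite cabsE/= expr0n addr0 sqrtr_sqr. Qed.

Lemma cabs0 : cabs (0 : R[i]) = 0.
Proof. by rewrite cabsC normr0. Qed.

Lemma cabs1 : cabs (1 : R[i]) = 1.
Proof. by rewrite cabsC normr1. Qed.

Lemma Re_le_cabs z : `|Re z| <= cabs z.
Proof. by rewrite cabsE -sqrtr_sqr ler_sqrt ?addr_ge0 ?sqr_ge0// lerDl sqr_ge0. Qed.

Lemma Im_le_cabs z : `|Im z| <= cabs z.
Proof. by rewrite cabsE -sqrtr_sqr ler_sqrt ?addr_ge0 ?sqr_ge0// lerDr sqr_ge0. Qed.

Lemma cabs_le_ReIm z : cabs z <= `|Re z| + `|Im z|.
Proof.
have {1}-> : z = (Re z)%:C%C + (Im z)%:C%C * 'i%C.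
  by apply: complex_eq; rewrite ?ReD ?ImD ?ReM ?ImM/=; ring.
apply: (le_trans (cabsD _ _)); rewrite cabsM !cabsC lerD2l.
rewrite (_ : cabs 'i%C = 1) ?mulr1// cabsE/= expr0n expr1n add0r sqrtr1//.
Qed.

Lemma cabs_distD x y : `|cabs x - cabs y| <= cabs (x - y).
Proof.
rewrite ler_norml lerNl opprB !lerBlDr; apply/andP; split.
  by rewrite cabs_distrC -{1}(subrK x y) cabsD.
by rewrite -{1}(subrK y x) cabsD.
Qed.

Lemma cabs_eq0 z : cabs z = 0 -> z = 0.
Proof. exact: ComplexField.Normc.eq0_normc. Qed.

(** The conjugate of the phase of [z]. The value 1 at [z = 0] keeps the modulus equal to 1
    everywhere. *)
Definition csgn z : R[i] := if cabs z == 0 then 1 else (Re z / cabs z -i* (Im z / cabs z))%C.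

Lemma cabs_csgn z : cabs (csgn z) = 1.
Proof.
rewrite /csgn; case: ifPn => [_|z0]; first exact: cabs1.
rewrite cabsE/= sqrrN !expr_div_n -mulrDl cabsE sqr_sqrtr ?addr_ge0 ?sqr_ge0//.
rewrite divff ?sqrtr1//; apply: contraNneq z0 => h.
by rewrite cabsE h sqrtr0.
Qed.

Lemma csgnM z : csgn z * z = (cabs z)%:C%C.
Proof.
rewrite /csgn; case: ifPn => [/eqP z0|z0]; first by rewrite z0 (cabs_eq0 z0) mulr0.
have E : cabs z ^+ 2 = Re z ^+ 2 + Im z ^+ 2.
  by rewrite cabsE sqr_sqrtr// addr_ge0 ?sqr_ge0.
apply: complex_eq; rewrite ?ReM ?ImM/=.
  rewrite (_ : _ - _ = (Re z ^+ 2 + Im z ^+ 2) / cabs z); last by field.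
  by rewrite -E expr2 mulfK.
by field.
Qed.

End ComplexBasics.

Section ComplexFunctions.
Variable R : realType.
Implicit Types (f g h : R -> R[i]).
Local Notation Re := complex.Re.
Local Notation Im := complex.Im.

Lemma L0P f : L0 f <-> mfI (fun x => Re (f x)) /\ mfI (fun x => Im (f x)).
Proof. by split=> [[? ?]|[? ?]]. Qed.

Lemma L0D f g : L0 f -> L0 g -> L0 (fun x => f x + g x).
Proof.
move=> [rf jf] [rg jg]; split.
  rewrite (_ : (fun x => _) = fun x => Re (f x) + Re (g x)).
    exact: mfI_D.
  by apply/funext => x; rewrite ReD.
rewrite (_ : (fun x => _) = fun x => Im (f x) + Im (g x)).
  exact: mfI_D.
by apply/funext => x; rewrite ImD.
Qed.

Lemma mfI_cst (c : R) : mfI (fun=> c).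
Proof. exact: measurable_cst. Qed.

Lemma L0M f g : L0 f -> L0 g -> L0 (fun x => f x * g x).
Proof.
move=> [rf jf] [rg jg]; split.
  rewrite (_ : (fun x => _) = fun x => Re (f x) * Re (g x) - Im (f x) * Im (g x)).
    by apply: mfI_B; exact: mfI_M.
  by apply/funext => x; rewrite ReM.
rewrite (_ : (fun x => _) = fun x => Re (f x) * Im (g x) + Im (f x) * Re (g x)).
  by apply: mfI_D; exact: mfI_M.
by apply/funext => x; rewrite ImM.
Qed.

Lemma L0_cst (c : R[i]) : L0 (fun=> c).
Proof. by split; exact: mfI_cst. Qed.

Lemma L0C (u : R -> R) : mfI u -> L0 (fun x => (u x)%:C%C).
Proof. by move=> mu_; split => //; exact: mfI_cst. Qed.

Lemma L0B f g : L0 f -> L0 g -> L0 (fun x => f x - g x).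
Proof.
move=> mf mg; have := L0D mf (L0M (L0_cst (-1)) mg).
by congr L0; apply/funext => x; rewrite mulN1r.
Qed.

Lemma mfI_comp (p : R -> R) (u : R -> R) : measurable_fun [set: measurableTypeR R] p ->
  mfI u -> mfI (fun x => p (u x)).
Proof. by move=> mp mu_; exact: (measurableT_comp mp mu_). Qed.

Lemma mfI_cabs f : L0 f -> mfI (fun x => cabs (f x)).
Proof.
move=> [rf jf]; have sq u : mfI u -> mfI (fun x => u x ^+ 2).
  by move=> mu_; exact: mfI_M.
rewrite (_ : (fun x => _) = fun x => Num.sqrt (Re (f x) ^+ 2 + Im (f x) ^+ 2)).
  apply: (@mfI_comp Num.sqrt); last by apply: mfI_D; exact: sq.
  by apply: continuous_measurable_fun; exact: sqrt_continuous.
by apply/funext => x; rewrite cabsE.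
Qed.

Lemma L0_csgn f : L0 f -> L0 (fun x => csgn (f x)).
Proof.
move=> mf; have mc := mfI_cabs mf; have [rf jf] := mf.
have mi : mfI (fun x => (cabs (f x))^-1) by apply: mfI_comp mc; exact: measurable_invr.
have mE : mfI (fun x => if cabs (f x) == 0 then 1 else 0 : R).
  apply: (@mfI_comp (fun r => if r == 0 then 1 else 0)) mc.
  by apply: measurable_fun_ifT => //; exact: measurable_fun_eqr.
apply/L0P; split.
  rewrite (_ : (fun x => _) = fun x => (if cabs (f x) == 0 then 1 else 0) + Re (f x) * (cabs (f x))^-1).
    by apply: mfI_D => //; exact: mfI_M.
  apply/funext => x; rewrite /csgn; case: ifPn => [/eqP ->|_]; last by rewrite add0r.
  by rewrite invr0 mulr0 addr0.
rewrite (_ : (fun x => _) = fun x => 0 - Im (f x) * (cabs (f x))^-1).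
  by apply: mfI_B; [exact: mfI_cst|exact: mfI_M].
apply/funext => x; rewrite /csgn; case: ifPn => [/eqP ->|_]; last by rewrite sub0r.
by rewrite invr0 mulr0 subr0.
Qed.

Lemma L0_aeI f g : L0 f -> aeI (fun x => f x = g x) -> L0 g.
Proof.
move=> [rf jf] fg; split.
  by apply: (mfI_ae rf); apply: aeI_S fg => x _ ->.
by apply: (mfI_ae jf); apply: aeI_S fg => x _ ->.
Qed.

Lemma L1P f : L1 f <-> L0 f /\ IL1 (fun x => cabs (f x)).
Proof.
split=> [[mf fy]|[mf fi]]; split => //.
  apply: IL1P; first exact: mfI_cabs.
  by under eq_integral do rewrite ger0_norm ?cabs_ge0//.
have := IL1_lty fi; rewrite /normL1.
by under eq_integral do rewrite ger0_norm ?cabs_ge0//.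
Qed.

Lemma normL1_E f : L1 f -> normL1 f = (normI (fun x => cabs (f x)))%:E.
Proof.
move=> /L1P[_ fi]; rewrite normI_EFin// /normL1.
by apply: eq_integral => x _; rewrite ger0_norm ?cabs_ge0.
Qed.

Lemma le_L1 f (v : R -> R) : L0 f -> IL1 v -> (forall x, Iab x -> cabs (f x) <= v x) -> L1 f.
Proof.
move=> mf vi fv; apply/L1P; split => //; apply: le_IL1 vi _; first exact: mfI_cabs.
by move=> x /fv; rewrite ger0_norm ?cabs_ge0.
Qed.

Lemma L1_Re f : L1 f -> IL1 (fun x => Re (f x)).
Proof.
move=> /L1P[[rf _] fi]; apply: le_IL1 fi _ => // x _; exact: Re_le_cabs.
Qed.

Lemma L1_Im f : L1 f -> IL1 (fun x => Im (f x)).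
Proof.
move=> /L1P[[_ jf] fi]; apply: le_IL1 fi _ => // x _; exact: Im_le_cabs.
Qed.

Lemma L1_ReIm f : IL1 (fun x => Re (f x)) -> IL1 (fun x => Im (f x)) -> L1 f.
Proof.
move=> fr fj; apply: (le_L1 _ (IL1_D (IL1_abs fr) (IL1_abs fj))).
  by apply/L0P; split; exact: IL1_mfI.
by move=> x _; exact: cabs_le_ReIm.
Qed.

Lemma L1D f g : L1 f -> L1 g -> L1 (fun x => f x + g x).
Proof.
move=> /L1P[mf fi] /L1P[mg gi]; apply: (le_L1 _ (IL1_D fi gi)); first exact: L0D.
by move=> x _; exact: cabsD.
Qed.

Lemma L1B f g : L1 f -> L1 g -> L1 (fun x => f x - g x).
Proof.
move=> /L1P[mf fi] /L1P[mg gi]; apply: (le_L1 _ (IL1_D fi gi)); first exact: L0B.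
by move=> x _; exact: cabsB.
Qed.

Lemma L1_aeI f g : L1 f -> aeI (fun x => f x = g x) -> L1 g.
Proof.
move=> /L1P[mf fi] fg; have mg := L0_aeI mf fg.
apply/L1P; split => //; apply: IL1_ae_eq fi; first exact: mfI_cabs.
by apply: aeI_S fg => x _ ->.
Qed.

Lemma L1_mul_bounded f h (M : R) : L1 f -> L0 h ->
  (forall x, Iab x -> cabs (h x) <= M) -> L1 (fun x => h x * f x).
Proof.
move=> /L1P[mf fi] mh hM; apply: (le_L1 _ (IL1_Zl M fi)); first exact: L0M.
by move=> x /hM h1; rewrite cabsM ler_wpM2r// cabs_ge0.
Qed.

End ComplexFunctions.

(** * The complex transform through its real and imaginary parts *)

Section Transform.
Variable R : realType.
Implicit Types (f g h : R -> R[i]) (u v : R -> R) (e t : R).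
Local Notation Re := complex.Re.
Local Notation Im := complex.Im.

(** The link between the two one-sided integrals that define the transform and the single integral
    against the cut-off kernel. For large [e] the intervals are empty and both sides are
    consistent. *)
Lemma trunc_sum u t e : IL1 u -> Iab t -> 0 < e ->
  \int[leb R]_(x in `]-1, (t - e)[) (u x / (x - t)) +
  \int[leb R]_(x in `](t + e), 1[) (u x / (x - t)) = htr u e t.
Proof.
move=> ui It e0; have [t1 t2] : -1 < t /\ t < 1 by move: It; rewrite /Iab/= in_itv/= => /andP.
pose P : set R := `]-oo, (t - e)[%classic; pose Q : set R := `](t + e), +oo[%classic.
have -> : (`]-1, (t - e)[%classic : set R) = Iab `&` P.
  apply/seteqP; split => x; rewrite /P /Iab/= !in_itv/=.
    by move=> /andP[-> xt]; rewrite xt; split => //=; lra.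
  by move=> [/andP[-> _] ->].
have -> : (`](t + e), 1[%classic : set R) = Iab `&` Q.
  apply/seteqP; split => x; rewrite /Q /Iab/= !in_itv/= ?andbT.
    by move=> /andP[xt ->]; rewrite xt andbT; split => //; lra.
  by move=> [/andP[_ ->] ->].
rewrite !Rintegral_mkcondr.
have mP : measurable (P : set (LT R)) by apply: borel_leb; exact: measurable_itv.
have mQ : measurable (Q : set (LT R)) by apply: borel_leb; exact: measurable_itv.
have far x : P x -> e < `|x - t|.
  by rewrite /P/= in_itv/= => h; rewrite ltr0_norm; lra.
have farQ x : Q x -> e < `|x - t|.
  by rewrite /Q/= in_itv/= andbT => h; rewrite gtr0_norm; lra.
have hi := htr_integrable t ui e0.
have iA (A : set R) : measurable (A : set (LT R)) -> (forall x, A x -> e < `|x - t|) ->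
    IL1 ((fun x => u x / (x - t)) \_ A).
  move=> mA hA; have := IL1_mul_bounded hi (mfI_indic mA) (fun x _ => indic_le1 A x).
  apply: IL1_eq => x _; rewrite patchE indicE; case: ifPn => [xA|_]; last by rewrite mulr0.
  by rewrite mulr1 /hker hA//; exact: set_mem.
rewrite -int_Iab_D; [|exact: iA|exact: iA].
apply: eq_Rintegral => x _; rewrite !patchE /hker.
have [xP|xP] := boolP (x \in P).
  rewrite (far _ (set_mem xP)) ifF ?addr0//.
  apply/negP => /set_mem; move: (set_mem xP).
  by rewrite /P /Q/= !in_itv/= andbT; lra.
have [xQ|xQ] := boolP (x \in Q); first by rewrite (farQ _ (set_mem xQ)) add0r.
rewrite addr0; case: ifPn => [h|_]; last by rewrite mulr0.
exfalso; have [x0|x0] := leP 0 (x - t).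
  move/negP : xQ; apply; apply: mem_set; rewrite /Q/= in_itv/= andbT.
  by move: h; rewrite ger0_norm//; lra.
move/negP : xP; apply; apply: mem_set; rewrite /P/= in_itv/=.
by move: h; rewrite ltr0_norm//; lra.
Qed.

Lemma Re_divC (z : R[i]) (r : R) : Re (z / r%:C%C) = Re z / r.
Proof. by rewrite -(fmorphV (real_complex R)) ReM/= mulr0 subr0. Qed.

Lemma Im_divC (z : R[i]) (r : R) : Im (z / r%:C%C) = Im z / r.
Proof. by rewrite -(fmorphV (real_complex R)) ImM/= mulr0 add0r. Qed.

Lemma hilbert_truncE f t e : L1 f -> Iab t -> 0 < e ->
  hilbert_trunc f t e = ((pi^-1)%:C * (htr (fun x => Re (f x)) e t +i*
     htr (fun x => Im (f x)) e t))%C.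
Proof.
move=> fi It e0; rewrite /hilbert_trunc; congr (_ * _).
apply: complex_eq; rewrite ?ReD ?ImD /cint/=.
  rewrite -(trunc_sum (L1_Re fi) It e0).
  by congr (_ + _); apply: eq_Rintegral => x _; rewrite Re_divC.
rewrite -(trunc_sum (L1_Im fi) It e0).
by congr (_ + _); apply: eq_Rintegral => x _; rewrite Im_divC.
Qed.

Lemma normC_cabs (z : R[i]) : `|z| = (cabs z)%:C%C.
Proof. by rewrite normc_def cabsE. Qed.

Lemma cvg_complex (X : Type) (F : set_system X) (FF : ProperFilter F)
    (a : X -> R[i]) (l : R[i]) :
  Re (a x) @[x --> F] --> Re l -> Im (a x) @[x --> F] --> Im l ->
  ((a x : R[i]^o) @[x --> F]) --> (l : R[i]^o).
Proof.
move=> ar aj; apply/cvgrPdist_lt => eps eps0.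
(* A positive element of [R[i]] is real. *)
have epsE : eps = (Re eps)%:C%C.
  by apply: complex_eq => //; move: eps0; rewrite ltcE => /andP[/eqP -> _].
have eps'0 : 0 < Re eps by move: eps0; rewrite ltcE => /andP[_].
have e20 : 0 < Re eps / 2 by rewrite divr_gt0.
near=> x; rewrite normC_cabs epsE ltcR (le_lt_trans (cabs_le_ReIm _))//.
rewrite [ltRHS]splitr ReD ImD ReN ImN ltrD//.
  by near: x; move/cvgrPdist_lt : ar; apply.
by near: x; move/cvgrPdist_lt : aj; apply.
Unshelve. all: by end_near. Qed.

(** All properties of [T] are transferred from [Tr] through this formula, with which [T] agrees
    almost everywhere. *)
Definition TrC f t : R[i] := ((pi^-1)%:C * (Tr (fun x => Re (f x)) t +i*
     Tr (fun x => Im (f x)) t))%C.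

Lemma cvg_mull (X : Type) (F : set_system X) (FF : ProperFilter F) (p : R) (a : X -> R) (l : R) :
  a x @[x --> F] --> l -> p * a x @[x --> F] --> p * l.
Proof. by move=> al; apply: cvgM => //; exact: cvg_cst. Qed.

Lemma T_TrC f : L1 f -> aeI (fun t => T f t = TrC f t).
Proof.
move=> fi; apply: aeI_S (aeI_and (Tr_cvg (L1_Re fi)) (Tr_cvg (L1_Im fi))) => t It [hr hj].
apply: (@cvg_lim R[i]^o); first exact: norm_hausdorff.
have h : ((pi^-1)%:C * (htr (fun x => Re (f x)) e t +i*
     htr (fun x => Im (f x)) e t) : R[i]^o)%C @[e --> 0^'+] --> (TrC f t : R[i]^o).
  apply: cvg_complex; rewrite /TrC.
    under eq_cvg do rewrite ReM/= mul0r subr0.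
    by rewrite ReM/= mul0r subr0; exact: cvg_mull hr.
  under eq_cvg do rewrite ImM/= mul0r addr0.
  by rewrite ImM/= mul0r addr0; exact: cvg_mull hj.
apply: cvg_trans h; apply: near_eq_cvg; near=> e.
by rewrite hilbert_truncE//; near: e; exact: nbhs_right_gt.
Unshelve. all: by end_near. Qed.

Lemma Re_TrC f t : Re (TrC f t) = pi^-1 * Tr (fun x => Re (f x)) t.
Proof. by rewrite /TrC ReM/= mul0r subr0. Qed.

Lemma Im_TrC f t : Im (TrC f t) = pi^-1 * Tr (fun x => Im (f x)) t.
Proof. by rewrite /TrC ImM/= mul0r addr0. Qed.

Lemma L0_T f : L1 f -> L0 (T f).
Proof.
move=> fi; apply: (@L0_aeI _ (TrC f)); last first.
  by apply: aeI_S (T_TrC fi) => t _ ->.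
apply/L0P; split.
  rewrite (_ : (fun x => _) = fun t => pi^-1 * Tr (fun x => Re (f x)) t).
    by apply: mfI_M; [exact: mfI_cst|apply: mfI_Tr; exact: L1_Re].
  by apply/funext => t; rewrite Re_TrC.
rewrite (_ : (fun x => _) = fun t => pi^-1 * Tr (fun x => Im (f x)) t).
  by apply: mfI_M; [exact: mfI_cst|apply: mfI_Tr; exact: L1_Im].
by apply/funext => t; rewrite Im_TrC.
Qed.

End Transform.

(** * Linearity, fast convergence and Parseval's formula for [T] *)

Section TransformProperties.
Variable R : realType.
Implicit Types (f g h : R -> R[i]) (u v : R -> R) (e t : R).
Local Notation Re := complex.Re.
Local Notation Im := complex.Im.

Lemma Tr_aeI u v : IL1 u -> IL1 v -> aeI (fun x => u x = v x) ->
  aeI (fun t => Tr u t = Tr v t).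
Proof.
move=> ui vi uv; apply: aeI_S (Tr_cvg vi) => t _ h.
apply: (@cvg_lim R); first exact: Rhausdorff.
apply: cvg_trans h; apply: near_eq_cvg; near=> e.
have e0 : 0 < e by near: e; exact: nbhs_right_gt.
by apply: (htr_aeI_eq _ vi ui) => //; apply: aeI_S uv => x _ ->.
Unshelve. all: by end_near. Qed.

Lemma T_aeI f g : L1 f -> L1 g -> aeI (fun x => f x = g x) -> aeI (fun t => T f t = T g t).
Proof.
move=> fi gi fg.
have h1 : aeI (fun t => Tr (fun x => Re (f x)) t = Tr (fun x => Re (g x)) t).
  by apply: Tr_aeI; [exact: L1_Re|exact: L1_Re|apply: aeI_S fg => x _ ->].
have h2 : aeI (fun t => Tr (fun x => Im (f x)) t = Tr (fun x => Im (g x)) t).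
  by apply: Tr_aeI; [exact: L1_Im|exact: L1_Im|apply: aeI_S fg => x _ ->].
apply: aeI_S (aeI_and (aeI_and (T_TrC fi) (T_TrC gi)) (aeI_and h1 h2)).
by move=> t _ [[-> ->] [e1 e2]]; rewrite /TrC e1 e2.
Qed.

Lemma TrCE f t a b : Tr (fun x => Re (f x)) t = a -> Tr (fun x => Im (f x)) t = b ->
  TrC f t = ((pi^-1)%:C * (a +i* b))%C.
Proof. by move=> <- <-. Qed.

Lemma T_D f g : L1 f -> L1 g ->
  aeI (fun t => T (fun x => f x + g x) t = T f t + T g t).
Proof.
move=> fi gi; have sr := TrD (L1_Re fi) (L1_Re gi); have sj := TrD (L1_Im fi) (L1_Im gi).
have er : (fun x => Re (f x + g x)) = fun x => Re (f x) + Re (g x).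
  by apply/funext => x; exact: ReD.
have ej : (fun x => Im (f x + g x)) = fun x => Im (f x) + Im (g x).
  by apply/funext => x; exact: ImD.
apply: aeI_S (aeI_and (aeI_and (T_TrC fi) (T_TrC gi))
  (aeI_and (T_TrC (L1D fi gi)) (aeI_and sr sj))).
move=> t _ [[e3 e4] [e5 [e1 e2]]].
rewrite e3 e4 e5.
have E := TrCE (etrans (congr1 (fun u => Tr u t) er) e1) (etrans (congr1 (fun u => Tr u t) ej) e2).
rewrite E /TrC; move: (Tr _ t) (Tr _ t) (Tr _ t) (Tr _ t) (_%:C%C) => a b c d p.
by rewrite -mulrDr.
Qed.

Lemma L1_Z (c : R[i]) f : L1 f -> L1 (fun x => c * f x).
Proof.
by move=> fi; apply: (@L1_mul_bounded _ _ _ (cabs c) fi (L0_cst c)).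
Qed.

Lemma T_Z (c : R[i]) f : L1 f -> aeI (fun t => T (fun x => c * f x) t = c * T f t).
Proof.
move=> fi; have ri := L1_Re fi; have ji := L1_Im fi.
have s1 := TrZ (Re c) ri; have s2 := TrZ (- Im c) ji.
have s3 := TrZ (Re c) ji; have s4 := TrZ (Im c) ri.
have s5 := TrD (IL1_Zl (Re c) ri) (IL1_Zl (- Im c) ji).
have s6 := TrD (IL1_Zl (Re c) ji) (IL1_Zl (Im c) ri).
have er : (fun x => Re (c * f x)) = fun x => Re c * Re (f x) + - Im c * Im (f x).
  by apply/funext => x; rewrite ReM mulNr.
have ej : (fun x => Im (c * f x)) = fun x => Re c * Im (f x) + Im c * Re (f x).
  by apply/funext => x; exact: ImM.
apply: aeI_S (aeI_and (aeI_and (T_TrC fi) (T_TrC (L1_Z c fi)))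
  (aeI_and (aeI_and (aeI_and s1 s2) s5) (aeI_and (aeI_and s3 s4) s6))).
move=> t _ [[e7 e8] [[[e1 e2] e5] [[e3 e4] e6]]]; rewrite e7 e8.
have hr := etrans (congr1 (fun u => Tr u t) er) (etrans e5 (congr2 +%R e1 e2)).
have hj := etrans (congr1 (fun u => Tr u t) ej) (etrans e6 (congr2 +%R e3 e4)).
rewrite (TrCE hr hj) /TrC.
move: (Tr _ t) (Tr _ t) (pi^-1) => a b p {e1 e2 e3 e4 e5 e6 e7 e8 hr hj}.
by apply: complex_eq; rewrite ?(ReM, ImM)/=; ring.
Qed.

Lemma T_B f g : L1 f -> L1 g ->
  aeI (fun t => T (fun x => f x - g x) t = T f t - T g t).
Proof.
move=> fi gi; apply: aeI_S (aeI_and (T_D fi (L1_Z (-1) gi)) (T_Z (-1) gi)).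
move=> t _ [e1 e2]; rewrite -(mulN1r (T g t)) -e2 -e1; congr (T _ t).
by apply/funext => x; rewrite mulN1r.
Qed.

Lemma le_normI_Re f : L1 f -> normI (fun x => Re (f x)) <= normI (fun x => cabs (f x)).
Proof.
move=> fi; have /L1P[_ ci] := fi; apply: le_normI => //; first exact: L1_Re.
by move=> x _; rewrite (ger0_norm (cabs_ge0 _)) Re_le_cabs.
Qed.

Lemma le_normI_Im f : L1 f -> normI (fun x => Im (f x)) <= normI (fun x => cabs (f x)).
Proof.
move=> fi; have /L1P[_ ci] := fi; apply: le_normI => //; first exact: L1_Im.
by move=> x _; rewrite (ger0_norm (cabs_ge0 _)) Im_le_cabs.
Qed.

Lemma T_cvg_fast (F : nat -> R -> R[i]) f : (forall n, L1 (F n)) -> L1 f ->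
  (forall n, normI (fun x => cabs (F n x - f x)) <= 4^-1 ^+ n) ->
  aeI (fun t => (Re (T (F n) t) @[n --> \oo] --> Re (T f t)) /\
                (Im (T (F n) t) @[n --> \oo] --> Im (T f t))).
Proof.
move=> Fi fi hF.
have di n : L1 (fun x => F n x - f x) by exact: L1B.
have sr : aeI (fun t => Tr (fun x => Re (F n x)) t @[n --> \oo] --> Tr (fun x => Re (f x)) t).
  apply: Tr_cvg_fast => [n||n]; [exact: L1_Re|exact: L1_Re|].
  apply: le_trans (hF n); apply: le_trans (le_normI_Re (di n)).
  by rewrite le_eqVlt; apply/orP; left; apply/eqP; apply: eq_Rintegral => x _; rewrite ReD ReN.
have sj : aeI (fun t => Tr (fun x => Im (F n x)) t @[n --> \oo] --> Tr (fun x => Im (f x)) t).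
  apply: Tr_cvg_fast => [n||n]; [exact: L1_Im|exact: L1_Im|].
  apply: le_trans (hF n); apply: le_trans (le_normI_Im (di n)).
  by rewrite le_eqVlt; apply/orP; left; apply/eqP; apply: eq_Rintegral => x _; rewrite ImD ImN.
have aeF : aeI (fun t => forall n, T (F n) t = TrC (F n) t).
  by apply: aeI_forall => n; exact: T_TrC.
apply: aeI_S (aeI_and (aeI_and aeF (T_TrC fi)) (aeI_and sr sj)) => t _ [[eF ->] [hr hj]].
have eR n : Re (T (F n) t) = pi^-1 * Tr (fun x => Re (F n x)) t by rewrite eF Re_TrC.
have eI n : Im (T (F n) t) = pi^-1 * Tr (fun x => Im (F n x)) t by rewrite eF Im_TrC.
split.
  rewrite (funext eR) (Re_TrC f t).
  exact: (@cvg_mull _ _ _ _ pi^-1 (fun n => Tr (fun x => Re (F n x)) t) _ hr).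
rewrite (funext eI) (Im_TrC f t).
exact: (@cvg_mull _ _ _ _ pi^-1 (fun n => Tr (fun x => Im (F n x)) t) _ hj).
Qed.

Lemma cvg_cabs (a : nat -> R[i]) (l : R[i]) : Re (a n) @[n --> \oo] --> Re l ->
  Im (a n) @[n --> \oo] --> Im l -> cabs (a n) @[n --> \oo] --> cabs l.
Proof.
move=> ar aj; apply/cvgrPdist_lt => eps eps0.
have e20 : 0 < eps / 2 by rewrite divr_gt0.
near=> n; rewrite (le_lt_trans (cabs_distD _ _))// (le_lt_trans (cabs_le_ReIm _))//.
rewrite [ltRHS]splitr ReD ImD ReN ImN ltrD//.
  by near: n; move/cvgrPdist_lt : ar; apply.
by near: n; move/cvgrPdist_lt : aj; apply.
Unshelve. all: by end_near. Qed.

Definition bounded_by (M : R) g := L0 g /\ forall x, Iab x -> cabs (g x) <= M.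

Lemma bounded_by_L1 M g : bounded_by M g -> L1 g.
Proof. by move=> [mg gM]; exact: (le_L1 mg (IL1_cst M) gM). Qed.

Lemma bounded_by_Re M g x : bounded_by M g -> Iab x -> `|Re (g x)| <= M.
Proof. by move=> [_ gM] /gM; apply: le_trans; exact: Re_le_cabs. Qed.

Lemma bounded_by_Im M g x : bounded_by M g -> Iab x -> `|Im (g x)| <= M.
Proof. by move=> [_ gM] /gM; apply: le_trans; exact: Im_le_cabs. Qed.

Lemma L1_T_bounded M g : bounded_by M g -> L1 (T g).
Proof.
move=> gM; have gi := bounded_by_L1 gM; have [[mr mj] _] := gM.
have [ri _] := Tr_bounded mr (fun x => bounded_by_Re gM).
have [ji _] := Tr_bounded mj (fun x => bounded_by_Im gM).
apply: (@L1_aeI _ (TrC g)); last by apply: aeI_S (T_TrC gi) => t _ ->.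
apply: L1_ReIm.
  by apply: IL1_eq (IL1_Zl pi^-1 ri) => x _; rewrite Re_TrC.
by apply: IL1_eq (IL1_Zl pi^-1 ji) => x _; rewrite Im_TrC.
Qed.

Lemma eq_cint_aeI f g : L0 f -> L0 g -> aeI (fun x => f x = g x) -> cint Iab f = cint Iab g.
Proof.
move=> [rf jf] [rg jg] fg; rewrite /cint; congr (_ +i* _)%C.
  by apply: Rintegral_aeI => //; apply: aeI_S fg => x _ ->.
by apply: Rintegral_aeI => //; apply: aeI_S fg => x _ ->.
Qed.

Lemma Re_int_TrC f g : Re (cint Iab (f \* TrC g)) =
  \int[leb R]_(x in Iab) (pi^-1 * (Re (f x) * Tr (fun x => Re (g x)) x
      - Im (f x) * Tr (fun x => Im (g x)) x)).
Proof.
apply: eq_Rintegral => x _; rewrite [(f \* TrC g) x]/=.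
rewrite ReM (Re_TrC g x) (Im_TrC g x).
by move: (Tr _ x) (Tr _ x) (pi^-1) => a b p; ring.
Qed.

Lemma Im_int_TrC f g : Im (cint Iab (f \* TrC g)) =
  \int[leb R]_(x in Iab) (pi^-1 * (Re (f x) * Tr (fun x => Im (g x)) x
      + Im (f x) * Tr (fun x => Re (g x)) x)).
Proof.
apply: eq_Rintegral => x _; rewrite [(f \* TrC g) x]/=.
rewrite ImM (Re_TrC g x) (Im_TrC g x).
by move: (Tr _ x) (Tr _ x) (pi^-1) => a b p; ring.
Qed.

(** The formula is bilinear over the complex numbers without conjugation, so it splits into four
    instances of the real formula. *)
Lemma parseval_bounded M N f g : bounded_by M f -> bounded_by N g ->
  cint Iab (f \* T g) = - cint Iab (g \* T f).
Proof.
move=> fM gN; have fi := bounded_by_L1 fM; have gi := bounded_by_L1 gN.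
have [mf _] := fM; have [mg _] := gN.
have [[ar aj] [cr cj]] := (mf, mg).
have E K h h' : bounded_by K h -> L1 h' -> cint Iab (h \* T h') = cint Iab (h \* TrC h').
  move=> [mh _] h'i; have mT := L0_T h'i.
  have mTC : L0 (TrC h') by apply: (L0_aeI mT); exact: T_TrC.
  apply: eq_cint_aeI; [exact: L0M|exact: L0M|].
  by apply: aeI_S (T_TrC h'i) => x _ /= ->.
apply: (etrans (E _ _ _ fM gi)); apply: (etrans _ (congr1 -%R (esym (E _ _ _ gN fi)))).
have P u v := @Tr_parseval_bounded R u v N M.
have Fr x := @bounded_by_Re M f x fM; have Fj x := @bounded_by_Im M f x fM.
have Gr x := @bounded_by_Re N g x gN; have Gj x := @bounded_by_Im N g x gN.
have iT K L u v : mfI u -> (forall x, Iab x -> `|u x| <= K) ->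
    mfI v -> (forall x, Iab x -> `|v x| <= L) -> IL1 (fun x => u x * Tr v x).
  move=> mu_ uK mv vL; have [ti _] := Tr_bounded mv vL.
  by have := IL1_mul_bounded ti mu_ uK; apply: IL1_eq => x _; rewrite mulrC.
have linB p q : IL1 p -> IL1 q -> \int[leb R]_(x in Iab) (pi^-1 * (p x - q x)) =
    pi^-1 * (\int[leb R]_(x in Iab) p x - \int[leb R]_(x in Iab) q x).
  move=> pI qI; rewrite int_Iab_Zl; last exact: IL1_B.
  by rewrite RintegralB; [by []|exact: measurable_Iab|exact: pI|exact: qI].
have linD p q : IL1 p -> IL1 q -> \int[leb R]_(x in Iab) (pi^-1 * (p x + q x)) =
    pi^-1 * (\int[leb R]_(x in Iab) p x + \int[leb R]_(x in Iab) q x).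
  by move=> pI qI; rewrite int_Iab_Zl ?int_Iab_D//; exact: IL1_D.
have iac := iT _ _ _ _ ar Fr cr Gr; have ibd := iT _ _ _ _ aj Fj cj Gj.
have ica := iT _ _ _ _ cr Gr ar Fr; have idb := iT _ _ _ _ cj Gj aj Fj.
have iad := iT _ _ _ _ ar Fr cj Gj; have ibc := iT _ _ _ _ aj Fj cr Gr.
have icb := iT _ _ _ _ cr Gr aj Fj; have ida := iT _ _ _ _ cj Gj ar Fr.
have pac := P _ _ cr Gr ar Fr; have pbd := P _ _ cj Gj aj Fj.
have pad := P _ _ cj Gj ar Fr; have pbc := P _ _ cr Gr aj Fj.
have e1 := linB _ _ iac ibd; have e2 := linB _ _ ica idb.
have e3 := linD _ _ iad ibc; have e4 := linD _ _ icb ida.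
have algB (p A B A' B' : R) : A = - A' -> B = - B' -> p * (A - B) = - (p * (A' - B')).
  by move=> -> ->; ring.
have algD (p A B A' B' : R) : A = - A' -> B = - B' -> p * (A + B) = - (p * (B' + A')).
  by move=> -> ->; ring.
apply: complex_eq; rewrite ?ReN ?ImN.
  apply: (etrans (Re_int_TrC f g)); apply: (etrans _ (congr1 -%R (esym (Re_int_TrC g f)))).
  apply: (etrans e1); apply: (etrans _ (congr1 -%R (esym e2))).
  exact: (algB _ _ _ _ _ pac pbd).
apply: (etrans (Im_int_TrC f g)); apply: (etrans _ (congr1 -%R (esym (Im_int_TrC g f)))).
apply: (etrans e3); apply: (etrans _ (congr1 -%R (esym e4))).
exact: (algD _ _ _ _ _ pad pbc).
Qed.

End TransformProperties.

(** * Lower semicontinuous seminorms *)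

Section LowerSemicontinuity.
Variable R : realType.
Implicit Types (f g h : R -> R[i]) (u v w : R -> R) (c : R[i]) (S : \bar R).
Local Notation Re := complex.Re.
Local Notation Im := complex.Im.

Definition lint u : \bar R := (\int[leb R]_(x in Iab) (u x)%:E)%E.

Lemma le_lint u v : mfI u -> mfI v -> (forall x, Iab x -> 0 <= u x) ->
  aeI (fun x => u x <= v x) -> (lint u <= lint v)%E.
Proof.
move=> mu_ mv u0 uv; have mI := @measurable_Iab R.
(* Passing to the maximum turns the almost everywhere inequality into a pointwise one. *)
have -> : lint v = lint (fun x => Num.max (u x) (v x)).
  apply: ae_eq_integral; [exact: mI|exact/measurable_EFinP|..].
    by apply/measurable_EFinP; exact: measurable_maxr.
  by apply: aeI_S uv => x _ uv /=; rewrite (max_idPr uv).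
apply: ge0_le_integral; first exact: mI.
- by move=> x Ix; rewrite lee_fin u0.
- exact/measurable_EFinP.
- by apply/measurable_EFinP; exact: measurable_maxr.
- by move=> x _; rewrite lee_fin le_max lexx.
Qed.

Lemma lint_ge0 u : (forall x, Iab x -> 0 <= u x) -> (0 <= lint u)%E.
Proof. by move=> u0; apply: integral_ge0 => x Ix; rewrite lee_fin u0. Qed.

Lemma lintD u v : mfI u -> mfI v -> (forall x, Iab x -> 0 <= u x) ->
  (forall x, Iab x -> 0 <= v x) -> lint (fun x => u x + v x) = (lint u + lint v)%E.
Proof.
move=> mu_ mv u0 v0; rewrite /lint -ge0_integralD; first by [].
- exact: (@measurable_Iab R).
- by move=> x Ix; rewrite lee_fin u0.
- exact/measurable_EFinP.
- by move=> x Ix; rewrite lee_fin v0.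
- exact/measurable_EFinP.
Qed.

Lemma lintZ (a : R) u : 0 <= a -> mfI u -> (forall x, Iab x -> 0 <= u x) ->
  lint (fun x => a * u x) = (a%:E * lint u)%E.
Proof.
move=> a0 mu_ u0; rewrite /lint -ge0_integralZl_EFin; first by [].
- exact: (@measurable_Iab R).
- by move=> x Ix; rewrite lee_fin u0.
- exact/measurable_EFinP.
- by [].
Qed.

(** Values may be +oo. The last condition says that sublevel sets are sequentially closed in L^1. *)
Definition lsc_seminorm (N : (R -> R[i]) -> \bar R) := [/\ forall h, (0 <= N h)%E,
  forall f g, L1 f -> L1 g -> (N (fun x => f x + g x)%R <= N f + N g)%E,
  forall c f, L1 f -> (N (fun x => c * f x)%R <= (cabs c)%:E * N f)%E &
  forall (F : nat -> R -> R[i]) f S, (forall n, L1 (F n)) -> L1 f ->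
    normI (fun x => cabs (F n x - f x)) @[n --> \oo] --> 0 ->
    (forall n, (N (F n) <= S)%E) -> (N f <= S)%E].

Definition wnorm w h : \bar R := lint (fun x => w x * cabs (T h x)).

Lemma mfI_wT w h : mfI w -> L1 h -> mfI (fun x => w x * cabs (T h x)).
Proof. by move=> mw hi; apply: (mfI_M mw); apply: mfI_cabs; exact: L0_T. Qed.

(** For lower semicontinuity pass to a subsequence converging at rate [4^-n]: the transforms then
    converge almost everywhere and Fatou's lemma applies. *)
Lemma wnorm_lsc_seminorm w : mfI w -> (forall x, 0 <= w x) -> lsc_seminorm (wnorm w).
Proof.
move=> mw w0; have p0 h x : 0 <= w x * cabs (T h x) by rewrite mulr_ge0 ?cabs_ge0.
split=> [h|f g fi gi|c f fi|F f S Fi fi Ff FS].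
- by apply: lint_ge0 => x _; exact: p0.
- rewrite /wnorm -lintD; [|exact: (mfI_wT mw fi)|exact: (mfI_wT mw gi)|by move=> x _; exact: p0..].
  apply: le_lint; [exact: (mfI_wT mw (L1D fi gi))|..|by move=> x _; exact: p0|].
    exact: mfI_D (mfI_wT mw fi) (mfI_wT mw gi).
  by apply: aeI_S (T_D fi gi) => x _ ->; rewrite -mulrDr ler_wpM2l// cabsD.
- rewrite /wnorm -lintZ; [|exact: cabs_ge0|exact: (mfI_wT mw fi)|by move=> x _; exact: p0].
  apply: le_lint; [exact: (mfI_wT mw (L1_Z c fi))|..|by move=> x _; exact: p0|].
    exact: mfI_M (mfI_cst _) (mfI_wT mw fi).
  by apply: aeI_S (T_Z c fi) => x _ ->; rewrite cabsM mulrCA.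
have sub n : exists m, normI (fun x => cabs (F m x - f x)) <= 4^-1 ^+ n.
  have e0 : 0 < (4^-1 ^+ n : R) by rewrite exprn_gt0// invr_gt0.
  move/cvgr_le : Ff => /(_ _ e0)/filter_ex[m hm]; exists m.
  exact: hm.
have [s hs] := choice sub.
apply: (@fatou_aeI _ (fun n x => w x * cabs (T (F (s n)) x))).
- by move=> n; exact: (mfI_wT mw (Fi (s n))).
- exact: (mfI_wT mw fi).
- by move=> n x _; exact: p0.
- apply: aeI_S (T_cvg_fast (fun n => Fi (s n)) fi hs) => x _ [hr hj].
  exact: (@cvg_mull _ _ _ _ (w x) (fun n => cabs (T (F (s n)) x)) _ (cvg_cabs hr hj)).
- by move=> n; exact: FS.
Qed.

(** A constant sequence converges in L^1 to every function equal to it almost everywhere, so lower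
    semicontinuity gives both inequalities. *)
Lemma lsc_seminorm_aeI N f g : lsc_seminorm N -> L1 f -> aeI (fun x => f x = g x) -> N g = N f.
Proof.
move=> [_ _ _ lsc] fi fg; have gi := L1_aeI fi fg.
have z f' g' : L1 f' -> L1 g' -> aeI (fun x => f' x = g' x) -> (N g' <= N f')%E.
  move=> fi' gi' fg'; apply: (lsc (fun=> f')) => //.
  rewrite (_ : (fun n : nat => _) = fun=> 0); first exact: cvg_cst.
  apply/funext => _; rewrite -[RHS](_ : normI (fun=> 0 : R) = 0); last first.
    by rewrite /normI /Rintegral normr0 integral0.
  apply: Rintegral_aeI.
  - by apply: mfI_norm; apply: mfI_cabs; apply: L0B; [case: fi'|case: gi'].
  - by rewrite normr0; exact: mfI_cst.
  - by apply: aeI_S fg' => x _ ->; rewrite subrr cabs0.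
by apply/eqP; rewrite eq_le !z//; apply: aeI_S fg => x _ ->.
Qed.

End LowerSemicontinuity.

(** * Boundedness over Borel sets by a gliding hump *)

Section GlidingHump.
Variables (R : realType) (N : (R -> R[i]) -> \bar R) (k : R -> R[i]).
Hypotheses (Nlsc : lsc_seminorm N) (ki : L1 k).
Implicit Types (A B C J : set R) (c e : R) (n m : nat).

Local Notation NK A := (N (k \* chi A)).

Lemma chiE A x : chi A x = (if x \in A then 1 else 0 : R)%:C%C.
Proof. by rewrite /chi indicE; case: (x \in A). Qed.

Lemma cabs_chi_le1 A x : cabs (chi A x) <= 1.
Proof. by rewrite /chi cabsC indic_le1. Qed.

Lemma L0_chi A : measurable (A : set (LT R)) -> L0 (chi A).
Proof. by move=> mA; apply: L0C; exact: mfI_indic. Qed.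

Lemma L1_mul_chi A : measurable (A : set (LT R)) -> L1 (k \* chi A).
Proof.
move=> mA; have := L1_mul_bounded ki (L0_chi mA) (fun x _ => cabs_chi_le1 A x).
by congr L1; apply/funext => x /=; rewrite mulrC.
Qed.

Lemma L1_borelI A : borelI A -> L1 (k \* chi A).
Proof. by move=> [mA _]; apply: L1_mul_chi; exact: borel_leb. Qed.

Lemma borelI_U A B : borelI A -> borelI B -> borelI (A `|` B).
Proof.
by move=> [mA sA] [mB sB]; split; [exact: measurableU|move=> x [/sA|/sB]].
Qed.

Lemma borelI_I A B : borelI A -> measurable (B : set (measurableTypeR R)) -> borelI (A `&` B).
Proof. by move=> [mA sA] mB; split; [exact: measurableI|move=> x [/sA]]. Qed.

Lemma borelI_D A B : borelI A -> measurable (B : set (measurableTypeR R)) -> borelI (A `\` B).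
Proof. by move=> [mA sA] mB; split; [exact: measurableD|move=> x [/sA]]. Qed.

Lemma mul_chi_setU A B : A `&` B = set0 ->
  k \* chi (A `|` B) = (fun x => (k \* chi A) x + (k \* chi B) x).
Proof.
move=> AB; apply/funext => x /=; rewrite -mulrDr !chiE; congr (_ * _).
have [xA|xA] := boolP (x \in A); have [xB|xB] := boolP (x \in B).
- by move: AB => /seteqP[/(_ x) + _]; case; split; exact/set_mem.
- by rewrite (_ : x \in A `|` B) ?addr0// in_setU xA.
- by rewrite (_ : x \in A `|` B) ?add0r// in_setU xB orbT.
- by rewrite in_setU (negbTE xA) (negbTE xB)/= addr0.
Qed.

Lemma seminorm_setU A B : borelI A -> borelI B -> A `&` B = set0 ->
  (NK (A `|` B) <= NK A + NK B)%E.
Proof.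
by case: Nlsc => _ + _ _ => sub bA bB /mul_chi_setU ->; apply: sub; exact: L1_borelI.
Qed.

Lemma seminorm_setD A B : borelI A -> borelI B -> A `&` B = set0 ->
  (NK A <= NK (A `|` B) + NK B)%E.
Proof.
case: Nlsc => _ sub hom _ bA bB AB; have kU := mul_chi_setU AB.
have -> : k \* chi A = (fun x => (k \* chi (A `|` B)) x + -1 * (k \* chi B) x).
  by apply/funext => x; rewrite kU mulN1r addrK.
have iB := L1_borelI bB; apply: (le_trans (sub _ _ (L1_borelI (borelI_U bA bB)) (L1_Z (-1) iB))).
by rewrite leeD2l// (le_trans (hom _ _ iB))// cabsN cabs1 mul1e.
Qed.

Definition good J := exists S : R, forall A, borelI A -> A `<=` J -> (NK A <= S%:E)%E.

Lemma good_S J J' : J `<=` J' -> good J' -> good J.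
Proof. by move=> JJ [S hS]; exists S => A bA AJ; apply: hS => // x /AJ/JJ. Qed.

Lemma good_U J J' : measurable (J' : set (measurableTypeR R)) ->
  good J -> good J' -> good (J `|` J').
Proof.
move=> mJ [S hS] [S' hS']; exists (S' + S) => A bA AJ.
rewrite -(setUIDK A J') EFinD.
have b1 := borelI_I bA mJ; have b2 := borelI_D bA mJ.
apply: (le_trans (seminorm_setU b1 b2 _)).
  by apply/seteqP; split => x // [[_ h] [_]].
apply: leeD; first by apply: hS' => // x [].
by apply: hS => // x [/AJ[]].
Qed.

(** Take for [c] the supremum of the [t] for which the part of (-1,1) left of [t] is good. A good
    neighbourhood of [c] could be glued to such a part and would push the supremum further. *)
Lemma bad_point : ~ good Iab -> good set0 ->
  exists c, forall e, 0 < e -> ~ good (Iab `&` `[c - e, c + e[%classic).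
Proof.
move=> bad g0; pose E : set R := [set t | good (Iab `&` `]-oo, t[%classic)].
have E1 : ubound E 1.
  move=> t Et; rewrite leNgt; apply/negP => t1; apply: bad; apply: good_S Et => x Ix.
  split => //=; rewrite in_itv/=; move: Ix; rewrite /Iab/= in_itv/= => /andP[_ h].
  exact: lt_trans t1.
have supE : has_sup E.
  split; last by exists 1.
  exists (-1); apply: good_S g0 => x []; rewrite /Iab/= !in_itv/= => /andP[h _] h'.
  by move: (lt_trans h h'); rewrite ltxx.
exists (sup E) => e e0 gc; have [t Et ct] := sup_adherent e0 supE.
have : E (sup E + e).
  rewrite /E/=; apply: (@good_S _ ((Iab `&` `]-oo, t[%classic) `|`
      (Iab `&` `[sup E - e, sup E + e[%classic))); last first.
    apply: good_U => //; apply: measurableI; exact: measurable_itv.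
  move=> x [Ix]; rewrite /= !in_itv/= => xe.
  have [xt|xt] := ltP x t; [left|right].
    by split.
  by split => //; rewrite (le_trans (ltW ct) xt).
by move/(ub_le_sup supE.2); rewrite leNgt ltrDl e0.
Qed.

Definition shrink c n : set R := Iab `&` `[c - n.+1%:R^-1, c + n.+1%:R^-1[%classic.

Lemma shrink_borel c n : borelI (shrink c n).
Proof.
split; last by move=> x [].
by apply: measurableI; exact: measurable_itv.
Qed.

Lemma shrink_S c n m : (n <= m)%N -> shrink c m `<=` shrink c n.
Proof.
move=> nm x [Ix]; rewrite /= !in_itv/= => /andP[x1 x2].
have h : m.+1%:R^-1 <= n.+1%:R^-1 :> R by rewrite lef_pV2 ?posrE// ler_nat.
split => //=; rewrite in_itv/= (le_trans _ x1) ?lerB//=.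
by rewrite (lt_le_trans x2)// lerD2l.
Qed.

Lemma normI_shrink_cvg c :
  normI (fun x => cabs (k x) * \1_(shrink c n) x) @[n --> \oo] --> (0 : R).
Proof.
have /L1P[mk ci] := ki; have mck := mfI_cabs mk.
have mS n : mfI (\1_(shrink c n) : R -> R).
  by apply: mfI_indic; apply: borel_leb; case: (shrink_borel c n).
have := @IL1_dominated R (fun n x => `|cabs (k x) * \1_(shrink c n) x|) (fun=> 0)
  (fun x => cabs (k x)).
rewrite (_ : \int[leb R]_(x in Iab) (0 : R) = 0); last by rewrite /Rintegral integral0.
case=> //.
- by move=> n; apply: mfI_norm; exact: mfI_M.
- exact: mfI_cst.
- apply: aeI_S (aeI_not_countable (countable1 c)) => x _ xc.
  have d0 : 0 < `|x - c| by rewrite normr_gt0 subr_eq0; apply/eqP.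
  apply: cvg_near_cst; near=> n.
  rewrite indicE (_ : x \in shrink c n = false) ?mulr0 ?normr0//.
  apply/negP => /set_mem[_]; rewrite /= in_itv/= => /andP[h1 h2].
  have : `|x - c| <= n.+1%:R^-1.
    by rewrite ler_norml lerBrDr addrC h1/= lerBlDl ltW.
  apply/negP; rewrite -ltNge; near: n.
  exact: (@near_infty_natSinv_lt R (PosNum d0)).
- apply: aeI_W => x _ n; rewrite normr_id normrM (ger0_norm (cabs_ge0 _)).
  by rewrite -[leRHS]mulr1 ler_wpM2l ?cabs_ge0 ?indic_le1.
Unshelve. all: by end_near. Qed.

(** A strict lower bound is an open condition: changing [A] near [c] moves [k chi_A] little in L^1,
    and [N] is lower semicontinuous. *)
Lemma open_hump c A (s : R) n : borelI A -> (s%:E < NK A)%E ->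
  exists2 m, (n <= m)%N & forall C, borelI C ->
    (forall x, ~ shrink c m x -> A x <-> C x) -> (s%:E < NK C)%E.
Proof.
move=> bA sA; apply: contrapT => /forall2NP H.
(* Otherwise every neighbourhood has a violating set; these sets converge to [A] and force
   [N (k chi_A) <= s]. *)
have ex m : exists C, [/\ borelI C, forall x, ~ shrink c (m + n) x -> A x <-> C x &
    (NK C <= s%:E)%E].
  case: (H (m + n)%N) => [/negP|]; first by rewrite leq_addl.
  move=> /existsNP[C] /not_implyP[bC] /not_implyP[AC] /negP; rewrite -leNgt => NC.
  by exists C.
have [C hC] := choice ex; move: sA; apply/negP; rewrite -leNgt.
case: Nlsc => _ _ _ lsc; apply: (lsc (fun m => k \* chi (C m))).
- by move=> m; apply: L1_borelI; case: (hC m).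
- exact: L1_borelI.
- apply: (@squeeze_cvgr _ _ _ _ (fun=> 0)
    (fun m => normI (fun x => cabs (k x) * \1_(shrink c (m + n)) x))).
  + apply: nearW => m; rewrite normI_ge0/=; have [bC AC _] := hC m.
    have /L1P[_ ci] := L1B (L1_borelI bC) (L1_borelI bA).
    apply: le_normI => //.
      have /L1P[_ cki] := ki; apply: (IL1_mul_bounded cki _ (fun x _ => indic_le1 _ x)).
      by apply: mfI_indic; apply: borel_leb; case: (shrink_borel c (m + n)).
    move=> x _; rewrite (ger0_norm (cabs_ge0 _)) ger0_norm; last first.
      by rewrite mulr_ge0 ?cabs_ge0.
    rewrite /= -mulrBr cabsM ler_wpM2l ?cabs_ge0// indicE.
    have [xS|xS] := boolP (x \in shrink c (m + n)).
      rewrite !chiE -rmorphB cabsC; case: (x \in A); case: (x \in C m);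
      by rewrite ?subrr ?sub0r ?subr0 ?normrN ?normr0 ?normr1 ?ler01.
    have [h1 h2] := AC x (fun h => negP xS (mem_set h)).
    rewrite !chiE (_ : x \in A = (x \in C m)) ?subrr ?cabs0//.
    by apply/idP/idP => /set_mem ?; apply/mem_set; [exact: h1|exact: h2].
  + exact: cvg_cst.
  + have := normI_shrink_cvg c.
    by rewrite -(cvg_shiftn n).
- by move=> m; case: (hC m).
Qed.

(** Each hump is followed by changes only in a neighbourhood of [c] so small that the hump persists.
    All lower bounds thus pass to the limit set, on which [N] would be infinite. *)
Lemma seminorm_borel_bounded : (forall A, borelI A -> (NK A < +oo)%E) ->
  exists2 S : R, 0 <= S & forall A, borelI A -> (NK A <= S%:E)%E.
Proof.
move=> Nfin; have N0 := let: And4 h _ _ _ := Nlsc in h.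
have finE A : borelI A -> exists s : R, NK A = s%:E.
  move=> /Nfin; have := N0 (k \* chi A); case: (NK A) => [s _ _|//|//].
  by exists s.
have b0 : borelI (set0 : set R) by split => //; exact: measurable0.
have [[S hS]|bad] := pselect (good Iab).
  exists `|S| => // A bA; apply: le_trans (hS _ bA (let: conj _ h := bA in h)) _.
  by rewrite lee_fin ler_norm.
exfalso; have [c hc] : exists c, forall e, 0 < e -> ~ good (Iab `&` `[c - e, c + e[%classic).
  apply: bad_point => //; have [s hs] := finE _ b0; exists s => A bA A0.
  by rewrite (_ : A = set0) ?hs//; apply/seteqP; split.
(* state [(j, A, n)]: every [C] that agrees with [A] off [shrink c n] has [N (k chi_C) > j] *)
pose P (p : nat * set R * nat) := borelI p.1.2 /\ forall C, borelI C ->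
  (forall x, ~ shrink c p.2 x -> p.1.2 x <-> C x) -> (p.1.1%:R%:E < NK C)%E.
pose ext (p q : nat * set R * nat) := [/\ q.1.1 = p.1.1.+1, (p.2 <= q.2)%N &
  forall x, ~ shrink c p.2 x -> p.1.2 x <-> q.1.2 x].
have step p : exists q, P p -> P q /\ ext p q.
  move: p => [[j A] n]; have [[bA _]|nP] := pselect (P (j, A, n)); last first.
    by exists (j, A, n).
  have bS := shrink_borel c n; have bAS := borelI_D bA (let: conj h _ := bS in h).
  have [s hs] := finE _ bAS.
  (* The hump must exceed [j + 1] by [s], the amount that the part of [A] kept off the neighbourhood
     can cancel. *)
  have : exists2 B, borelI B & B `<=` shrink c n /\ ((s + j.+1%:R)%:E < NK B)%E.
    apply: contrapT => H; apply: (hc n.+1%:R^-1) => //; exists (s + j.+1%:R) => B bB BS.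
    by rewrite leNgt; apply/negP => hB; apply: H; exists B.
  move=> [B bB [BS hB]].
  have dis : B `&` (A `\` shrink c n) = set0.
    by apply/seteqP; split => // x [/BS ? []].
  have bU := borelI_U bB bAS.
  have NU : (j.+1%:R%:E < NK (B `|` (A `\` shrink c n)))%E.
    have := lt_le_trans hB (seminorm_setD bB bAS dis).
    have [t ->] := finE _ bU; rewrite hs -EFinD !lte_fin; lra.
  have [m nm hm] := open_hump c n bU NU.
  exists (j.+1, B `|` (A `\` shrink c n), m) => _; split; first by split.
  split => [//|//|x xS]; split=> [Ax|]; first by right; split.
  by case=> [/BS/xS|[]].
have [g hg] := choice step.
have [p0 Pp0] : exists p, P p.
  have [B bB] : exists2 B, borelI B & (0 < NK B)%E.
    apply: contrapT => H; apply: bad; exists 0 => B bB _.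
    by rewrite leNgt; apply/negP => hB; apply: H; exists B.
  by move=> /(open_hump c 0 bB)[m _ hm]; exists (0%N, B, m); split.
pose s i := iter i g p0.
have Ps i : P (s i) by elim: i => [//|i IH]; case: (hg _ IH).
have es i : ext (s i) (s i.+1) by case: (hg _ (Ps i)).
pose A_ i := (s i).1.2; pose n_ i := (s i).2.
have nS i l : (n_ i <= n_ (i + l)%N)%N.
  by elim: l => [|l IH]; rewrite ?addn0// addnS (leq_trans IH)//; case: (es (i + l)%N).
have agree i l x : ~ shrink c (n_ i) x -> A_ i x <-> A_ (i + l)%N x.
  move=> xS; elim: l => [|l IH]; first by rewrite addn0.
  rewrite IH addnS; case: (es (i + l)%N) => _ _; apply => h; apply: xS.
  by apply: shrink_S h; exact: nS.
(* Off [shrink c (n_ i)] this set agrees with [A_ i], since later stages change nothing there; so it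
   inherits the lower bound of every stage. *)
pose A := \bigcup_i (A_ i `\` shrink c (n_ i)).
have bA : borelI A.
  split; last by move=> x [i _ [+ _]]; case: (Ps i) => -[_ h] _; exact: h.
  apply: bigcup_measurable => i _; apply: measurableD; first by case: (Ps i) => -[].
  by case: (shrink_borel c (n_ i)).
have AA i x : ~ shrink c (n_ i) x -> A_ i x <-> A x.
  move=> xS; split=> [Ax|[l _ [Al xl]]]; first by exists i.
  have [il|li] := leqP i l; first by apply/(agree i (l - i)%N) => //; rewrite subnKC.
  by have := agree l (i - l)%N x xl; rewrite subnKC ?(ltnW li)// => -[h _]; exact: h.
have sj i : (s i).1.1 = ((s 0%N).1.1 + i)%N.
  by elim: i => [|i IH]; rewrite ?addn0//; case: (es i) => -> _ _; rewrite IH addnS.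
have [t ht] := finE _ bA.
have big i : i%:R < t.
  rewrite -lte_fin -ht; case: (Ps i) => _ /(_ A bA (AA i)); apply: le_lt_trans.
  by rewrite lee_fin ler_nat sj leq_addl.
have := big (Num.truncn `|t|).+1.
by apply/negP; rewrite -leNgt (le_trans (ler_norm t))// ltW// truncnS_gt.
Qed.

End GlidingHump.

(** * From indicator functions to functions bounded by 1 *)

Section Layers.
Variables (R : realType) (N : (R -> R[i]) -> \bar R) (k : R -> R[i]) (S : R).
Hypotheses (Nlsc : lsc_seminorm N) (ki : L1 k).
Hypothesis NS : forall A : set R, borelI A -> (N (k \* chi A)%R <= S%:E)%E.
Implicit Types (A : set R) (u : R -> R) (n m : nat).
Local Notation Re := complex.Re.
Local Notation Im := complex.Im.

(** Needed because level sets of Lebesgue measurable functions are not Borel; a Borel subset of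
    equal measure replaces them. *)
Lemma seminorm_caratheodory A : measurable (A : set (LT R)) -> A `<=` Iab ->
  (N (k \* chi A)%R <= S%:E)%E.
Proof.
move=> mA AI; have [[B M] /= [mB mM M0 BA ABM]] := caratheodory_borel mA.
have bB : borelI B by split => // x /BA/AI.
suff h : aeI (fun x => (k \* chi B) x = (k \* chi A) x).
  by rewrite (lsc_seminorm_aeI Nlsc (L1_borelI ki bB) h) NS.
exists M; split; [exact: borel_leb|exact: M0|].
move=> x /= /not_implyP[Ix h]; apply: ABM; split.
  by apply: contrapT => xA; apply: h; rewrite !chiE !memNset// => /BA.
by move=> xB; apply: h; rewrite !chiE !mem_set//; exact: BA.
Qed.

(** For [y >= 0] this is the integer part of [y] capped at [m], written as a sum of indicators of
    superlevel sets. *)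
Definition count_le (y : R) m : R := \sum_(j < m) (if j.+1%:R <= y then 1 else 0).

Lemma count_le_approx (y : R) m : 0 <= y <= m%:R -> `|count_le y m - y| <= 1.
Proof.
move=> /andP[y0 ym]; have cS l : count_le y l.+1 = count_le y l + (if l.+1%:R <= y then 1 else 0).
  by rewrite /count_le big_ord_recr.
have full l : l%:R <= y -> count_le y l = l%:R.
  elim: l => [_|l IH ly]; first by rewrite /count_le big_ord0.
  by rewrite cS ly IH ?natr1// (le_trans _ ly)// ler_nat.
have upper l : count_le y l <= y.
  elim: l => [|l IH]; first by rewrite /count_le big_ord0.
  have [h|h] := leP l.+1%:R y; first by rewrite full.
  by rewrite cS (lt_geF h) addr0.
have lower : y - 1 <= count_le y m.
  elim: m ym {cS} (cS) => [ym _|l IH ym cS].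
    by rewrite /count_le big_ord0; move: ym y0; rewrite mulr0n; lra.
  have [h|h] := leP y l%:R.
    rewrite (le_trans (IH h cS))// cS lerDl; case: ifP => //.
  rewrite cS (full _ (ltW h)); move: ym h; rewrite -natr1; case: ifP => _; lra.
by have := upper m; rewrite ler_norml; lra.
Qed.

Lemma seminorm_sum (A_ : nat -> set R) m :
  (forall j, measurable (A_ j : set (LT R))) -> (forall j, A_ j `<=` Iab) ->
  L1 (fun x => \sum_(j < m) (k \* chi (A_ j)) x) /\
  (N (fun x => \sum_(j < m) (k \* chi (A_ j)) x)%R <= (m%:R * S)%:E)%E.
Proof.
move=> mA AI; case: Nlsc => _ sub hom _; elim: m => [|m [IH1 IH2]].
  have -> : (fun x => \sum_(j < 0) (k \* chi (A_ j)) x) = (fun x => 0 * k x).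
    by apply/funext => x; rewrite big_ord0 mul0r.
  split; first exact: L1_Z.
  by rewrite (le_trans (hom _ _ ki))// cabs0 mul0e mul0r.
have -> : (fun x => \sum_(j < m.+1) (k \* chi (A_ j)) x) =
    (fun x => \sum_(j < m) (k \* chi (A_ j)) x + (k \* chi (A_ m)) x).
  by apply/funext => x; rewrite big_ord_recr.
have Ai := L1_mul_chi ki (mA m).
split; first exact: L1D.
rewrite (le_trans (sub _ _ IH1 Ai))// -natr1 mulrDl mul1r EFinD leeD//.
exact: seminorm_caratheodory.
Qed.

(** [u] is within [1 / (n + 1)] of the average of the indicators of its [n + 1] superlevel sets. An
    average of functions of seminorm at most [S] costs no constant, and lower semicontinuity reaches
    the limit. *)
Lemma seminorm_unit_interval u : mfI u -> (forall x, Iab x -> 0 <= u x <= 1) ->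
  (N (fun x => k x * (u x)%:C%C)%R <= S%:E)%E.
Proof.
move=> mu_ u01; case: (Nlsc) => _ sub hom lsc.
pose A_ n j : set R := Iab `&` [set x | j.+1%:R <= n.+1%:R * u x].
have mA n j : measurable (A_ n j : set (LT R)).
  rewrite (_ : A_ n j = Iab `&` (fun x => n.+1%:R * u x) @^-1` `[j.+1%:R, +oo[%classic).
    by apply: (mfI_M (mfI_cst _) mu_); [exact: (@measurable_Iab R)|exact: measurable_itv].
  by apply/seteqP; split => x [Ix /=]; rewrite in_itv/= andbT.
have AI n j : A_ n j `<=` Iab by move=> x [].
pose F n x := (n.+1%:R^-1)%:C%C * \sum_(j < n.+1) (k \* chi (A_ n j)) x.
have FE n x : Iab x -> F n x = (n.+1%:R^-1 * count_le (n.+1%:R * u x) n.+1)%:C%C * k x.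
  move=> Ix; rewrite /F rmorphM -mulrA; congr (_ * _).
  rewrite /count_le rmorph_sum big_distrl; apply: eq_bigr => j _ /=.
  rewrite mulrC chiE; congr (_%:C%C * _).
  by case: ifPn => [/set_mem[_ ->]//|]; case: ifPn => // h; rewrite mem_set.
have uk : (fun x => k x * (u x)%:C%C) = (fun x => (u x)%:C%C * k x).
  by apply/funext => x; rewrite mulrC.
have uki : L1 (fun x => (u x)%:C%C * k x).
  apply: (@L1_mul_bounded _ _ _ 1 ki); first exact: L0C.
  by move=> x /u01 /andP[h1 h2]; rewrite cabsC ger0_norm.
have Fi n : L1 (F n) by apply: L1_Z; case: (seminorm_sum n.+1 (mA n) (AI n)).
rewrite uk; apply: (lsc F) => //.
  have /L1P[_ cki] := ki.
  have b n : normI (fun x => cabs (F n x - (u x)%:C%C * k x)) <=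
      normI (fun x => cabs (k x)) * n.+1%:R^-1.
    have /L1P[_ di] := L1B (Fi n) uki.
    rewrite mulrC /normI -int_Iab_Zl; last exact: IL1_abs.
    apply: le_int_Iab; [exact: IL1_abs|by apply: IL1_Zl; exact: IL1_abs|].
    move=> x Ix; rewrite !(ger0_norm (cabs_ge0 _)) FE// -mulrBl cabsM ler_wpM2r ?cabs_ge0//.
    rewrite -rmorphB cabsC.
    have -> : n.+1%:R^-1 * count_le (n.+1%:R * u x) n.+1 - u x =
       n.+1%:R^-1 * (count_le (n.+1%:R * u x) n.+1 - n.+1%:R * u x).
      by rewrite mulrBr mulKf// pnatr_eq0.
    rewrite normrM ger0_norm// -[leRHS]mulr1 ler_wpM2l// count_le_approx//.
    have /andP[h1 h2] := u01 x Ix; rewrite mulr_ge0//= -[leRHS]mulr1 ler_wpM2l//.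
  apply: (@squeeze_cvgr _ _ _ _ (fun=> 0) (fun n => normI (fun x => cabs (k x)) * n.+1%:R^-1)).
  - by apply: nearW => n; rewrite normI_ge0 b.
  - exact: cvg_cst.
  - rewrite -[X in _ --> X](mulr0 (normI (fun x => cabs (k x)))).
    by apply: cvg_mull; exact: cvg_harmonic.
move=> n; have [si sS] := seminorm_sum n.+1 (mA n) (AI n).
apply: (le_trans (hom _ _ si)); rewrite cabsC ger0_norm//.
have h : (0%R <= (n.+1%:R^-1 : R)%:E)%E by rewrite lee_fin.
apply: (le_trans (lee_wpmul2l h sS)).
by rewrite -EFinM mulKf// pnatr_eq0.
Qed.

(** The constant 4 comes from the positive and negative parts of the real and imaginary parts of
    [phi], each with values in [0,1]. *)
Lemma seminorm_unit_ball (phi : R -> R[i]) : L0 phi -> (forall x, Iab x -> cabs (phi x) <= 1) ->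
  (N (fun x => phi x * k x)%R <= (4 * S)%:E)%E.
Proof.
move=> [mr mj] p1; case: (Nlsc) => _ sub hom lsc.
have P u : mfI u -> (forall x, Iab x -> `|u x| <= 1) ->
    L1 (fun x => k x * (Num.max (u x) 0)%:C%C) /\
    (N (fun x => k x * (Num.max (u x) 0)%:C%C)%R <= S%:E)%E.
  move=> mu_ u1; have mm : mfI (fun x => Num.max (u x) 0).
    by apply: measurable_maxr; [exact: mu_|exact: mfI_cst].
  have b x : Iab x -> 0 <= Num.max (u x) 0 <= 1.
    move=> /u1 h; rewrite le_max lexx orbT ge_max ler01 andbT.
    exact: le_trans (ler_norm _) h.
  split; last exact: seminorm_unit_interval.
  rewrite (_ : (fun x => _) = fun x => (Num.max (u x) 0)%:C%C * k x); last first.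
    by apply/funext => x; rewrite mulrC.
  apply: (@L1_mul_bounded _ _ _ 1 ki); first exact: L0C.
  by move=> x /b /andP[h1 h2]; rewrite cabsC ger0_norm.
have Q u (c : R[i]) : cabs c = 1 -> mfI u -> (forall x, Iab x -> `|u x| <= 1) ->
    L1 (fun x => c * (k x * (Num.max (u x) 0)%:C%C)) /\
    (N (fun x => c * (k x * (Num.max (u x) 0)%:C%C))%R <= S%:E)%E.
  move=> c1 mu_ u1; have [h1 h2] := P u mu_ u1; split; first exact: L1_Z.
  by apply: (le_trans (hom _ _ h1)); rewrite c1 mul1e.
have bN u : (forall x, Iab x -> `|u x| <= 1) -> (forall x, Iab x -> `|- u x| <= 1).
  by move=> h x /h; rewrite normrN.
have mN u : mfI u -> mfI (fun x => - u x).
  move=> mu_; have := mfI_M (mfI_cst (-1)) mu_.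
  by congr (measurable_fun _ _); apply/funext => x; rewrite mulN1r.
have r1 x : Iab x -> `|Re (phi x)| <= 1 by move=> /p1; exact: le_trans (Re_le_cabs _).
have j1 x : Iab x -> `|Im (phi x)| <= 1 by move=> /p1; exact: le_trans (Im_le_cabs _).
have ci : cabs ('i%C : R[i]) = 1.
  by rewrite cabsE/= expr0n expr1n add0r sqrtr1.
have [a1 a2] := Q _ 1 (cabs1 _) mr r1.
have [b1 b2] := Q _ (-1) (etrans (cabsN _) (cabs1 _)) (mN _ mr) (bN _ r1).
have [c1 c2] := Q _ 'i%C ci mj j1.
have [d1 d2] := Q _ (- 'i%C) (etrans (cabsN _) ci) (mN _ mj) (bN _ j1).
rewrite (_ : (fun x => phi x * k x) = fun x =>
  ((1 * (k x * (Num.max (Re (phi x)) 0)%:C%C) + (-1) * (k x * (Num.max (- Re (phi x)) 0)%:C%C)) +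
   'i%C * (k x * (Num.max (Im (phi x)) 0)%:C%C)) + (- 'i%C) * (k x * (Num.max (- Im (phi x)) 0)%:C%C)).
  apply: (le_trans (sub _ _ (L1D (L1D a1 b1) c1) d1)).
  rewrite (_ : 4 * S = S + S + S + S); last by ring.
  rewrite !EFinD; apply: leeD d2; apply: (le_trans (sub _ _ (L1D a1 b1) c1)); apply: leeD c2.
  by apply: (le_trans (sub _ _ a1 b1)); apply: leeD.
apply/funext => x.
have pn (r : R) : r = Num.max r 0 - Num.max (- r) 0.
  have [h|h] := leP 0 r; first by rewrite (max_idPr _) ?subr0// oppr_le0.
  by rewrite (max_idPl _) ?sub0r ?opprK// oppr_ge0 ltW.
have {1}-> : phi x = (Re (phi x))%:C%C + 'i%C * (Im (phi x))%:C%C.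
  by apply: complex_eq; rewrite ?ReD ?ImD ?ReM ?ImM/=; ring.
rewrite {1}(pn (Re (phi x))) {1}(pn (Im (phi x))).
have rB (a b : R) : (a - b)%:C%C = a%:C%C - b%:C%C by exact: rmorphB.
rewrite !rB; move: (_%:C%C) (_%:C%C) (_%:C%C) (_%:C%C) => a b c d.
ring.
Qed.

End Layers.

(** * The equivalences *)

Section Duality.
Variable R : realType.
Implicit Types (f g h p : R -> R[i]) (u v w : R -> R) (n : nat) (K M : R).
Local Notation Re := complex.Re.
Local Notation Im := complex.Im.

(** Large values are replaced by 0 rather than shrunk, so that cutoffs are restrictions of [f] and
    their successive differences live on disjoint sets. *)
Definition cutoff n f x : R[i] := if cabs (f x) <= n%:R then f x else 0.

Lemma cutoffE n f x : cutoff n f x = (if cabs (f x) <= n%:R then 1 else 0 : R)%:C%C * f x.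
Proof. by rewrite /cutoff; case: ifP => _; rewrite ?mul1r ?mul0r. Qed.

Lemma cabs_cutoff_le n f x : cabs (cutoff n f x) <= cabs (f x).
Proof. by rewrite /cutoff; case: ifP => // _; rewrite cabs0 cabs_ge0. Qed.

Lemma cabs_cutoff_le_nat n f x : cabs (cutoff n f x) <= n%:R.
Proof. by rewrite /cutoff; case: ifP => // _; rewrite cabs0. Qed.

Lemma L0_cutoff n f : L0 f -> L0 (cutoff n f).
Proof.
move=> mf; rewrite (_ : cutoff n f = fun x => (if cabs (f x) <= n%:R then 1 else 0 : R)%:C%C * f x).
  apply: (L0M _ mf); apply: L0C.
  apply: (@mfI_comp _ (fun r => if r <= n%:R then 1 else 0)); last exact: mfI_cabs.
  by apply: measurable_fun_ifT => //; exact: measurable_fun_ler.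
by apply/funext => x; exact: cutoffE.
Qed.

Lemma bounded_by_cutoff n f : L0 f -> bounded_by n%:R (cutoff n f).
Proof. by move=> mf; split=> [|x _]; [exact: L0_cutoff|exact: cabs_cutoff_le_nat]. Qed.

Lemma cutoff_eventually f x : \forall n \near \oo, cutoff n f x = f x.
Proof.
near=> n; rewrite /cutoff ifT//; near: n; exact: nbhs_infty_ger.
Unshelve. all: by end_near. Qed.

Lemma cutoff_cvg f : L1 f -> normI (fun x => cabs (cutoff n f x - f x)) @[n --> \oo] --> (0 : R).
Proof.
move=> fi; have [mf ci] := (L1P f).1 fi.
have md n : mfI (fun x => cabs (cutoff n f x - f x)).
  by apply: mfI_cabs; exact: (L0B (L0_cutoff n mf) mf).
have := @IL1_dominated R (fun n x => `|cabs (cutoff n f x - f x)|) (fun=> 0)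
  (fun x => cabs (f x) + cabs (f x)).
rewrite (_ : \int[leb R]_(x in Iab) (0 : R) = 0); last by rewrite /Rintegral integral0.
case.
- by move=> n; exact: mfI_norm (md n).
- exact: mfI_cst.
- apply: aeI_W => x _; apply: cvg_near_cst.
  by apply: filterS (cutoff_eventually f x) => n ->; rewrite subrr cabs0 normr0.
- exact: (IL1_D ci ci).
- apply: aeI_W => x _ n; rewrite normr_id (ger0_norm (cabs_ge0 _)) (le_trans (cabsB _ _))//.
  by rewrite lerD2r cabs_cutoff_le.
by [].
Qed.

Lemma lint_EFin v : IL1 v -> (forall x, Iab x -> 0 <= v x) ->
  lint v = (\int[leb R]_(x in Iab) v x)%:E.
Proof.
move=> vi v0; transitivity ((normI v)%:E).
  by rewrite normI_EFin//; apply: eq_integral => x /set_mem Ix; rewrite ger0_norm// v0.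
by congr EFin; apply: eq_Rintegral => x /set_mem Ix; rewrite ger0_norm// v0.
Qed.

(* Parseval's formula with the phase of [p * T g] moved onto [p]. *)
Lemma duality K M p g : bounded_by K p -> bounded_by M g ->
  exists theta : R -> R[i], [/\ L0 theta, forall x, cabs (theta x) = 1 &
    (lint (fun x => cabs (p x * T g x))%R <=
     lint (fun x => cabs (g x) * cabs (T (fun y => theta y * p y) x))%R)%E].
Proof.
move=> pK gM; have ti := L1_T_bounded gM; have [mp pK'] := pK; have [mg gM'] := gM.
have ui := L1_mul_bounded ti mp pK'; have [mu_ uci] := (L1P _).1 ui.
pose theta x := csgn (p x * T g x); have mth : L0 theta by exact: L0_csgn mu_.
exists theta; split => // [x|]; first exact: cabs_csgn.
have qK : bounded_by K (fun x => theta x * p x).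
  split; first exact: L0M.
  by move=> x /pK'; rewrite cabsM cabs_csgn mul1r.
have vi := L1_mul_bounded (L1_T_bounded qK) mg gM'; have [_ vci] := (L1P _).1 vi.
have P := congr1 (@Re R) (parseval_bounded qK gM).
have E1 : Re (cint Iab ((fun x => theta x * p x) \* T g)) =
    \int[leb R]_(x in Iab) cabs (p x * T g x).
  apply: eq_Rintegral => x _; rewrite [(_ \* _) x]/= -mulrA csgnM; exact: ReC.
rewrite (lint_EFin uci (fun x _ => cabs_ge0 _)) -E1 P ReN.
have cE : (fun x => cabs (g x) * cabs (T (fun y => theta y * p y) x)) =
    fun x => cabs (g x * T (fun y => theta y * p y) x).
  by apply/funext => x; rewrite cabsM.
rewrite cE (lint_EFin vci (fun x _ => cabs_ge0 _)) lee_fin.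
have ri := L1_Re vi.
apply: (le_trans (ler_norm _)); rewrite normrN.
by apply: (norm_int_Iab (IL1_mfI ri) vci) => x _; exact: Re_le_cabs.
Qed.

Definition cconj (z : R[i]) : R[i] := (Re z -i* Im z)%C.

Lemma cabs_conj z : cabs (cconj z) = cabs z.
Proof. by rewrite !cabsE/= sqrrN. Qed.

Lemma L0_conj f : L0 f -> L0 (fun x => cconj (f x)).
Proof.
move=> [mr mj]; split; first exact: mr.
have := mfI_M (mfI_cst (-1)) mj.
by congr (measurable_fun _ _); apply/funext => x; rewrite mulN1r.
Qed.

Lemma conj_csgnM z : cconj (csgn z) * (cabs z)%:C%C = z.
Proof.
rewrite -csgnM mulrA -[RHS]mul1r; congr (_ * _).
have := cabs_csgn z; rewrite cabsE => /(congr1 (fun r : R => r ^+ 2)).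
rewrite sqr_sqrtr ?addr_ge0 ?sqr_ge0// expr1n => h.
by apply: complex_eq; rewrite ?ReM ?ImM/= -?h; ring.
Qed.

(** [phi] is the quotient [h / f] with modulus and phase treated apart. Taking the minimum with 1
    keeps [|phi| <= 1] also at the points where [|h| <= |f|] fails, and where [f] is 0 the inverse
    has its default value 0. *)
Lemma dominated_factor f h : L0 f -> dominated f h -> exists phi : R -> R[i],
  [/\ L0 phi, forall x, Iab x -> cabs (phi x) <= 1 & aeI (fun x => phi x * f x = h x)].
Proof.
move=> mf [mh hf].
pose r x : R := Num.min (cabs (h x) / cabs (f x)) 1.
have r0 x : 0 <= r x by rewrite le_min ler01 divr_ge0 ?cabs_ge0.
have mr : mfI r.
  apply: measurable_minr; last exact: mfI_cst.
  apply: mfI_M; first exact: mfI_cabs.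
  by apply: mfI_comp; [exact: measurable_invr|exact: mfI_cabs].
exists (fun x => (r x)%:C%C * (cconj (csgn (h x)) * csgn (f x))); split.
- apply: L0M; first exact: L0C.
  by apply: L0M; [apply: L0_conj; exact: L0_csgn|exact: L0_csgn].
- move=> x _; rewrite !cabsM cabsC cabs_conj !cabs_csgn !mulr1 ger0_norm//.
  by rewrite ge_min lexx orbT.
- apply: aeI_S hf => x _ hfx; rewrite -!mulrA csgnM mulrCA.
  have -> : (r x)%:C%C * (cabs (f x))%:C%C = (cabs (h x))%:C%C; last exact: conj_csgnM.
  rewrite -rmorphM; congr (_%:C%C); rewrite /r.
  have [f0|f0] := eqVneq (cabs (f x)) 0.
    by rewrite f0 mulr0; apply/esym/eqP; rewrite eq_le cabs_ge0 -f0 hfx.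
  have fp : 0 < cabs (f x) by rewrite lt_neqAle eq_sym f0 cabs_ge0.
  by rewrite (min_idPl _) ?divfK// ler_pdivrMr// mul1r.
Qed.

(** Cutting off above an essential bound changes [g] on a null set only and makes the bound hold
    everywhere. *)
Lemma Linfty_bounded g : Linfty g -> exists (M : R) (g' : R -> R[i]),
  [/\ 0 <= M, bounded_by M g' & aeI (fun x => g' x = g x)].
Proof.
move=> [mg [M gM]]; exists (Num.truncn `|M|).+1%:R, (cutoff (Num.truncn `|M|).+1 g); split.
- exact: ler0n.
- exact: bounded_by_cutoff.
- apply: aeI_S gM => x _ h; rewrite /cutoff ifT//; apply: (le_trans h).
  by rewrite (le_trans (ler_norm _))// ltW// truncnS_gt.
Qed.

End Duality.

(** * Comparison of the suprema, and the bridge to products with [T g] *)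

Section Equivalences.
Variables (R : realType) (f : R -> R[i]).
Hypothesis fi : L1 f.
Implicit Types (g h theta : R -> R[i]) (A : set R) (n : nat) (S M : R).

Let mf : L0 f. Proof. by case: fi. Qed.

Lemma normL1_T_lsc : lsc_seminorm (fun h => normL1 (T h)).
Proof.
have := @wnorm_lsc_seminorm R (fun=> 1) (mfI_cst 1) (fun _ => ler01).
congr lsc_seminorm; apply/funext => h; rewrite /wnorm /lint /normL1.
by apply: eq_integral => x _; rewrite mul1r.
Qed.

Lemma normL1_ge0 h : (0 <= normL1 h)%E.
Proof. by apply: integral_ge0 => x _; rewrite lee_fin cabs_ge0. Qed.

Lemma normL1_T_aeI g h : L1 g -> aeI (fun x => g x = h x) -> normL1 (T h) = normL1 (T g).
Proof. exact: (lsc_seminorm_aeI normL1_T_lsc). Qed.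

Lemma L1_T h : L1 h -> (normL1 (T h) < +oo)%E -> L1 (T h).
Proof. by move=> hi hy; split; [exact: L0_T|exact: hy]. Qed.

Lemma dominated_L1 h : dominated f h -> L1 h.
Proof.
move=> /(dominated_factor mf)[phi [mphi p1 ph]].
by apply: L1_aeI ph; exact: (L1_mul_bounded fi mphi p1).
Qed.

Lemma dominated_refl : dominated f f.
Proof. by split => //; exact: aeI_W. Qed.

Lemma dominated_mul theta : L0 theta -> aeI (fun x => cabs (theta x) <= 1) ->
  dominated f (theta \* f).
Proof.
move=> mth th1; split; first exact: L0M.
by apply: aeI_S th1 => x _ h; rewrite cabsM -[leRHS]mul1r ler_wpM2r ?cabs_ge0.
Qed.

Lemma dominated_chi A : borelI A -> dominated f (f \* chi A).
Proof.
move=> [mA _]; rewrite (_ : f \* chi A = chi A \* f); last first.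
  by apply/funext => x; exact: mulrC.
apply: dominated_mul; first by apply: L0_chi; exact: borel_leb.
by apply: aeI_W => x _; exact: cabs_chi_le1.
Qed.

Lemma dominated_unimodular theta : unimodular theta -> dominated f (theta \* f).
Proof.
by move=> [[mth _] th1]; apply: dominated_mul => //; apply: aeI_S th1 => x _ ->.
Qed.

Lemma sup_dominated_ub h : dominated f h -> (normL1 (T h) <= sup_dominated f)%E.
Proof. by move=> fh; apply: ereal_sup_ubound; exists h. Qed.

Lemma sup_borel_ub A : borelI A -> (normL1 (T (f \* chi A)%R) <= sup_borel f)%E.
Proof. by move=> bA; apply: ereal_sup_ubound; exists A. Qed.

Lemma sup_unimodular_ub theta : unimodular theta ->
  (normL1 (T (theta \* f)%R) <= sup_unimodular f)%E.
Proof. by move=> ut; apply: ereal_sup_ubound; exists theta. Qed.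

Lemma borelI_set0 : borelI (set0 : set R).
Proof. by split => //; exact: measurable0. Qed.

Lemma sup_borel_ge0 : (0 <= sup_borel f)%E.
Proof. by apply: le_trans (sup_borel_ub borelI_set0); exact: normL1_ge0. Qed.

Lemma sup_dominated_le S :
  (forall A, borelI A -> (normL1 (T (f \* chi A)%R) <= S%:E)%E) ->
  (sup_dominated f <= (4 * S)%:E)%E.
Proof.
move=> hS; apply: ge_ereal_sup => _ [h fh <-].
have [phi [mphi p1 ph]] := dominated_factor mf fh.
have pi := L1_mul_bounded fi mphi p1; rewrite (normL1_T_aeI pi ph).
exact: (seminorm_unit_ball normL1_T_lsc fi hS mphi p1).
Qed.

Lemma sup_dominated_le_sup_borel : (sup_dominated f <= 4%:E * sup_borel f)%E.
Proof.
have := sup_borel_ge0; case E : (sup_borel f) => [S| |] // S0.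
  by apply: sup_dominated_le => // A /sup_borel_ub; rewrite E.
by rewrite gt0_muley ?leey// lte_fin.
Qed.

Lemma sup_borel_lty : (forall A, borelI A -> L1 (T (f \* chi A))) -> (sup_borel f < +oo)%E.
Proof.
move=> hA; have [A bA|S S0 hS] := seminorm_borel_bounded normL1_T_lsc fi.
  by case: (hA A bA).
apply: (@le_lt_trans _ _ S%:E); last exact: ltry.
by apply: ge_ereal_sup => _ [A bA <-]; exact: hS.
Qed.

Lemma unimodular_real (s : R -> R) : mfI s -> (forall x, `|s x| = 1) ->
  unimodular (fun x => (s x)%:C%C).
Proof.
move=> ms s1; split; last by apply: aeI_W => x _; rewrite cabsC.
by split; [exact: L0C|exists 1; apply: aeI_W => x _; rewrite cabsC s1].
Qed.

(* [chi_A = (1 + theta) / 2] with [theta] equal to 1 on [A] and to -1 off [A]. *)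
Lemma normL1_T_chi_le A : borelI A -> exists theta1 theta2 : R -> R[i],
  [/\ unimodular theta1, unimodular theta2 &
    (normL1 (T (f \* chi A)%R) <=
      (2^-1)%:E * (normL1 (T (theta1 \* f)%R) + normL1 (T (theta2 \* f)%R)))%E].
Proof.
move=> [mA _]; have mi : mfI (\1_A : R -> R) by apply: mfI_indic; exact: borel_leb.
pose s x : R := 2 * \1_A x - 1.
have ms : mfI s by apply: mfI_B; [apply: mfI_M => //|]; exact: mfI_cst.
have u1 : unimodular (fun=> 1%:C%C : R[i]).
  by apply: (@unimodular_real (fun=> 1)) => [|x]; [exact: mfI_cst|exact: normr1].
have u2 : unimodular (fun x => (s x)%:C%C).
  apply: (unimodular_real ms) => x; rewrite /s indicE; case: (x \in A) => /=.
    by rewrite (_ : 2 * 1 - 1 = 1 :> R) ?normr1//; ring.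
  by rewrite mulr0 sub0r normrN normr1.
exists (fun=> 1%:C%C), (fun x => (s x)%:C%C); split => //.
have i1 := dominated_L1 (dominated_unimodular u1).
have i2 := dominated_L1 (dominated_unimodular u2).
have [_ sub hom _] := normL1_T_lsc.
have -> : f \* chi A = fun x => (2^-1)%:C%C * ((1%:C%C * f x) + ((s x)%:C%C * f x)).
  apply/funext => x /=; rewrite /chi -mulrDl mulrA mulrC; congr (_ * _).
  by rewrite -rmorphD -rmorphM; congr (_%:C%C); rewrite /s; field.
apply: (le_trans (hom _ _ (L1D i1 i2))); rewrite cabsC ger0_norm ?invr_ge0//.
apply: lee_wpmul2l; first by rewrite lee_fin invr_ge0.
exact: sub i1 i2.
Qed.

Lemma sup_borel_le_sup_unimodular : (sup_borel f <= sup_unimodular f)%E.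
Proof.
apply: ge_ereal_sup => _ [A bA <-]; have [t1 [t2 [u1 u2 h]]] := normL1_T_chi_le bA.
have h1 := sup_unimodular_ub u1; have h2 := sup_unimodular_ub u2.
apply: (le_trans h); apply: (@le_trans _ _ ((2^-1)%:E * (sup_unimodular f + sup_unimodular f))%E).
  by apply: lee_wpmul2l; [rewrite lee_fin invr_ge0|exact: (leeD h1 h2)].
have : (0 <= sup_unimodular f)%E by apply: le_trans h1; exact: normL1_ge0.
case: (sup_unimodular f) => [S| |] // _; last by rewrite leey.
by rewrite -EFinD -EFinM lee_fin; lra.
Qed.

Lemma sup_unimodular_le_sup_dominated : (sup_unimodular f <= sup_dominated f)%E.
Proof.
apply: ge_ereal_sup => _ [theta ut <-].
by apply: sup_dominated_ub; exact: dominated_unimodular.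
Qed.

Lemma L1_T_chi_of_unimodular :
  (forall theta, unimodular theta -> L1 (T (theta \* f))) ->
  forall A, borelI A -> L1 (T (f \* chi A)).
Proof.
move=> ht A bA; apply: L1_T; first exact: L1_borelI.
have [t1 [t2 [u1 u2 h]]] := normL1_T_chi_le bA.
have [_ h1] := ht _ u1; have [_ h2] := ht _ u2.
have half0 : (0 <= (2^-1 : R)%:E)%E by rewrite lee_fin invr_ge0.
exact: le_lt_trans h (lte_mul_pinfty half0 isT (lte_add_pinfty h1 h2)).
Qed.

(** Parseval's formula moves the transform onto [theta] times the cutoff, which is dominated by [f]
    whatever the phase [theta] is. The bound is the same for all [n]. *)
Lemma mul_T_bound S M g n : (sup_dominated f <= S%:E)%E -> 0 <= M -> bounded_by M g ->
  (lint (fun x => cabs (cutoff n f x * T g x))%R <= (M * S)%:E)%E.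
Proof.
move=> fS M0 gM; have [mg gM'] := gM; have pb := bounded_by_cutoff n mf.
have [theta [mth th1 h]] := duality pb gM.
have dq : dominated f (fun x => theta x * cutoff n f x).
  split; first exact: (L0M mth (L0_cutoff n mf)).
  by apply: aeI_W => x _; rewrite cabsM th1 mul1r cabs_cutoff_le.
have qi := dominated_L1 dq; have mT := mfI_cabs (L0_T qi).
apply: (le_trans h); rewrite EFinM.
apply: (@le_trans _ _ (lint (fun x => M * cabs (T (fun y => theta y * cutoff n f y) x))%R)).
  apply: le_lint.
  - exact: mfI_M (mfI_cabs mg) mT.
  - exact: mfI_M (mfI_cst M) mT.
  - by move=> x _; rewrite mulr_ge0 ?cabs_ge0.
  - by apply: aeI_W => x Ix; rewrite ler_wpM2r ?cabs_ge0 ?gM'.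
rewrite lintZ//; last by move=> x _; exact: cabs_ge0.
apply: lee_wpmul2l; first by rewrite lee_fin.
by apply: le_trans fS; exact: (sup_dominated_ub dq).
Qed.

(** Fatou's lemma, applied to the uniform bound for the cutoffs of [f]. *)
Lemma L1_mul_T : (sup_dominated f < +oo)%E -> forall g, Linfty g -> L1 (f \* T g).
Proof.
move=> sy g /Linfty_bounded[M [g' [M0 gM gg]]].
have s0 : (0 <= sup_dominated f)%E.
  exact: le_trans (normL1_ge0 _) (sup_dominated_ub dominated_refl).
have [S E] : exists S : R, sup_dominated f = S%:E.
  by case: (sup_dominated f) sy s0 => [S _ _|//|//]; exists S.
have gi' := bounded_by_L1 gM; have gi := L1_aeI gi' gg.
have mT := L0_T gi'; have mfT := L0M mf mT.
apply: (@L1_aeI _ (f \* T g')); last first.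
  by apply: aeI_S (T_aeI gi' gi gg) => x _ e; rewrite /= e.
apply/L1P; split; first exact: mfT.
apply: IL1P; first exact: mfI_cabs mfT.
apply: (@le_lt_trans _ _ (M * S)%:E); last exact: ltry.
have fS : (sup_dominated f <= S%:E)%E by rewrite E.
apply: (@fatou_aeI _ (fun n x => cabs (cutoff n f x * T g' x))).
- by move=> n; apply: mfI_cabs; exact: (L0M (L0_cutoff n mf) mT).
- exact: (mfI_norm (mfI_cabs mfT)).
- by move=> n x _; exact: cabs_ge0.
- apply: aeI_W => x _; rewrite (ger0_norm (cabs_ge0 _)); apply: cvg_near_cst.
  by apply: filterS (cutoff_eventually f x) => n ->.
- by move=> n; exact: mul_T_bound n fS M0 gM.
Qed.

(** With weight [|f|], the hypothesis for indicators makes [N (chi_A)] finite, hence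
    [N theta <= 4 S] for all unimodular [theta]. For [h] dominated by [f], duality with [p = 1]
    bounds the norm of [T] of a cutoff of [h] by the integral of [|h| |T theta|], which is at most
    [N theta]; lower semicontinuity removes the cutoff. *)
Lemma TL1_of_mul_T : (forall g, Linfty g -> L1 (f \* T g)) -> TL1 f.
Proof.
move=> hg; have mcf := mfI_cabs mf.
have Nlsc := wnorm_lsc_seminorm mcf (fun x => cabs_ge0 (f x)).
have i1 : L1 (fun=> 1 : R[i]).
  by apply: (@bounded_by_L1 _ 1); split; [exact: L0_cst|move=> x _; rewrite cabs1].
have [A bA|S S0 hS] := seminorm_borel_bounded Nlsc i1.
  have LA : Linfty ((fun=> 1 : R[i]) \* chi A).
    split; first by case: (L1_borelI i1 bA).
    by exists 1; apply: aeI_W => x _; rewrite cabsM cabs1 mul1r cabs_chi_le1.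
  have [_] := hg _ LA; rewrite /wnorm /lint /normL1.
  by under eq_integral do rewrite cabsM.
have bound := seminorm_unit_ball Nlsc i1 hS.
split; first exact: fi.
move=> h dh; have hi := dominated_L1 dh; have [mh hf] := dh; apply: (L1_T hi).
have [_ _ _ lsc] := normL1_T_lsc.
apply: (@le_lt_trans _ _ (4 * S)%:E); last exact: ltry.
apply: (lsc (fun n => cutoff n h)) (hi) (cutoff_cvg hi) _ => n.
  exact: bounded_by_L1 (bounded_by_cutoff n mh).
have ob : bounded_by 1 (fun=> 1 : R[i]).
  by split; [exact: L0_cst|move=> x _; rewrite cabs1].
have [theta [mth th1 H]] := duality ob (bounded_by_cutoff n mh).
have E1 : normL1 (T (cutoff n h)) = lint (fun x => cabs (1 * T (cutoff n h) x)).
  by apply: eq_integral => x _; rewrite mul1r.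
rewrite E1; apply: (le_trans H).
apply: le_trans (bound theta mth _); last by move=> x _; rewrite th1.
have qi : L1 (fun y => theta y * 1).
  by apply: (@L1_mul_bounded _ _ _ 1 i1 mth) => x _; rewrite th1.
apply: le_lint.
- exact: mfI_wT (mfI_cabs (L0_cutoff n mh)) qi.
- exact: mfI_wT mcf qi.
- by move=> x _; rewrite mulr_ge0 ?cabs_ge0.
- apply: aeI_S hf => x _ hx; rewrite ler_wpM2r ?cabs_ge0//.
  exact: le_trans (cabs_cutoff_le _ _ _) hx.
Qed.

End Equivalences.

(** * Convergence of the truncations of f *)

Section SignAverages.
Variable R : realType.
Implicit Types (us : seq R[i]) (c u : R[i]).

(** The average of the moduli of [c] plus or minus each entry of [us], over all choices of signs. *)
Fixpoint savg us c : R :=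
  if us is u :: vs then 2^-1 * (savg vs (c + u) + savg vs (c - u)) else cabs c.

Lemma cabs_mid c u : cabs c <= 2^-1 * (cabs (c + u) + cabs (c - u)).
Proof.
have := cabsD (c + u) (c - u); rewrite (_ : c + u + (c - u) = 2%:C%C * c).
  by rewrite cabsM cabsC ger0_norm//; lra.
by rewrite (_ : 2%:C%C = 1 + 1 :> R[i]); [ring|rewrite -[in RHS](rmorph1 (real_complex R)) -rmorphD].
Qed.

Lemma savg_ge us c : cabs c <= savg us c.
Proof.
elim: us c => [c|u us IH c] //=; apply: (le_trans (cabs_mid c u)).
by apply: ler_wpM2l; [rewrite invr_ge0|apply: lerD; exact: IH].
Qed.

Lemma savg_rcons us u c : savg us c <= savg (rcons us u) c.
Proof.
elim: us c => [c|v us IH c] /=; first exact: cabs_mid.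
by apply: ler_wpM2l; [rewrite invr_ge0|apply: lerD; exact: IH].
Qed.

(** Together with [savg_rcons]: the averages increase with the list and dominate the modulus of
    every entry. *)
Lemma savg_last us u c : cabs u <= savg (rcons us u) c.
Proof.
elim: us c => [c|v us IH c] /=.
  by have := cabs_mid u c; rewrite (cabs_distrC u c) (addrC u c).
have := IH (c + v); have := IH (c - v); lra.
Qed.

Lemma savg_ge0 us c : 0 <= savg us c.
Proof. exact: le_trans (cabs_ge0 c) (savg_ge us c). Qed.

Lemma mfI_savg (I : Type) (s : seq I) (U : I -> R -> R[i]) (C : R -> R[i]) :
  (forall i, L0 (U i)) -> L0 C -> mfI (fun x => savg [seq U i x | i <- s] (C x)).
Proof.
move=> mU; elim: s C => [C mC|i s IH C mC] /=; first exact: mfI_cabs.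
apply: mfI_M; first exact: mfI_cst.
by apply: mfI_D; apply: IH; [exact: L0D|exact: L0B].
Qed.

End SignAverages.

Section MaximalDomination.
Variable R : realType.

(** Dominated convergence with majorant the supremum of the [V j], integrable by Fatou's lemma; the
    majorant is kept extended-valued, as it may be infinite at some points. The shift to [V j.+1] is
    there because [U j] is the last of [j + 1] entries. *)
Lemma lint_cvg0_monotone_dominated (U V : nat -> R -> R) (S : R) :
  (forall j, mfI (U j)) -> (forall j, mfI (V j)) ->
  (forall j x, 0 <= V j x) -> (forall j x, V j x <= V j.+1 x) ->
  (forall j, (lint (V j) <= S%:E)%E) ->
  (forall j x, 0 <= U j x <= V j.+1 x) ->
  aeI (fun x => U j x @[j --> \oo] --> (0 : R)) -> lint (U j) @[j --> \oo] --> 0%E.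
Proof.
move=> mU mV V0 VS VI UV U0; have mI := @measurable_Iab R.
pose G x := limn_einf (fun j => (V j x)%:E).
have mEV j : measurable_fun (Iab : set (LT R)) (EFin \o V j) by apply/measurable_EFinP; exact: mV.
have mEU j : measurable_fun (Iab : set (LT R)) (EFin \o U j) by apply/measurable_EFinP; exact: mU.
have mG : measurable_fun (Iab : set (LT R)) G by exact: measurable_limn_einf mEV.
have GE x : G x = ereal_sup (range (fun j => (V j x)%:E)).
  have nd : nondecreasing_seq (fun j => (V j x)%:E).
    by apply/nondecreasing_seqP => j; rewrite lee_fin.
  exact: (cvg_limn_einf_sup (ereal_nondecreasing_cvgn nd)).1.
have VG j x : ((V j x)%:E <= G x)%E by rewrite GE; apply: ereal_sup_ubound; exists j.
have G0 x : (0 <= G x)%E by apply: le_trans (VG 0%N x); rewrite lee_fin.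
have iG : (leb R).-integrable Iab G.
  apply/integrableP; split; first exact: mG.
  under eq_integral do rewrite gee0_abs//.
  apply: (@le_lt_trans _ _ S%:E); last exact: ltry.
  apply: (le_trans (fatou (leb R) mI mEV _)); first by move=> n x Ix; rewrite lee_fin.
  rewrite limn_einf_lim; apply: lime_le; first exact: is_cvg_einfs.
  apply: nearW => n; apply: le_trans (VI n).
  by apply: ereal_inf_lbound; exists n => /=.
have c0 : measurable_fun (Iab : set (LT R)) (fun=> 0%E : \bar R) by exact: measurable_cst.
have UE : {ae leb R, forall x, Iab x -> (fun j => (U j x)%:E) @ \oo --> (0%E : \bar R)}.
  apply: aeI_S U0 => x Ix h; apply: cvg_EFin h; exact: nearW.
have UG : {ae leb R, forall x n, Iab x -> (`|(U n x)%:E| <= G x)%E}.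
  apply: aeW => x n _; have /andP[u0 uv] := UV n x.
  by rewrite gee0_abs ?lee_fin// (le_trans _ (VG n.+1 x))// lee_fin.
have [_ _] := dominated_convergence mI mEU c0 UE iG UG.
by rewrite integral0.
Qed.

End MaximalDomination.

(** * L^1 convergence of the transforms of the cutoffs *)

Section CutoffConvergence.
Variables (R : realType) (f : R -> R[i]) (S : R).
Hypotheses (fi : L1 f) (fS : forall h, dominated f h -> (normL1 (T h) <= S%:E)%E).
Implicit Types (C : R -> R[i]) (i j n m J : nat).

Let mf : L0 f. Proof. by case: fi. Qed.

Lemma dominated_pointwise C : L0 C -> (forall x, cabs (C x) <= cabs (f x)) -> dominated f C.
Proof. by move=> mC Cf; split; [exact: mC|apply: aeI_W => x _; exact: Cf]. Qed.

(** Adding or subtracting a block that lives where [C] vanishes leaves a function dominated by [f].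
    So every signed sum has a transform of norm at most [S], and so has the average. *)
Lemma lint_savg_le (b : nat -> R -> R[i]) :
  (forall i, L0 (b i)) -> (forall i x, cabs (b i x) <= cabs (f x)) ->
  (forall i j x, (i < j)%N -> b i x = 0 \/ b j x = 0) ->
  forall J j C, L0 C -> (forall x, cabs (C x) <= cabs (f x)) ->
  (forall i x, (j <= i)%N -> C x = 0 \/ b i x = 0) ->
  (lint (fun x => savg [seq T (b i) x | i <- iota j J] (T C x)) <= S%:E)%E.
Proof.
move=> mb bf dis; have bi i := dominated_L1 fi (dominated_pointwise (mb i) (bf i)).
have mTb i := L0_T (bi i).
elim=> [|J IH] j C mC Cf Cb; first exact: fS (dominated_pointwise mC Cf).
have Ci := dominated_L1 fi (dominated_pointwise mC Cf).
have bN x : - 1 * b j x = - b j x by rewrite mulN1r.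
have mP : L0 (fun x => C x + b j x) by exact: L0D.
have mM : L0 (fun x => C x - b j x) by exact: L0B.
have Pf x : cabs (C x + b j x) <= cabs (f x).
  by case: (Cb j x (leqnn j)) => ->; rewrite ?add0r ?addr0.
have Mf x : cabs (C x - b j x) <= cabs (f x).
  by case: (Cb j x (leqnn j)) => ->; rewrite ?sub0r ?subr0 ?cabsN.
have Pb i x : (j < i)%N -> C x + b j x = 0 \/ b i x = 0.
  move=> ji; have [C0|] := Cb i x (ltnW ji); last by right.
  by have [b0|] := dis j i x ji; [left; rewrite C0 b0 addr0|right].
have Mb i x : (j < i)%N -> C x - b j x = 0 \/ b i x = 0.
  move=> ji; have [C0|] := Cb i x (ltnW ji); last by right.
  by have [b0|] := dis j i x ji; [left; rewrite C0 b0 subr0|right].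
have IP := IH j.+1 _ mP Pf Pb; have IM := IH j.+1 _ mM Mf Mb.
have Pi := dominated_L1 fi (dominated_pointwise mP Pf).
have Mi := dominated_L1 fi (dominated_pointwise mM Mf).
have mSP := mfI_savg (iota j.+1 J) mTb (L0_T Pi).
have mSM := mfI_savg (iota j.+1 J) mTb (L0_T Mi).
set us := fun x => [seq T (b i) x | i <- iota j.+1 J].
apply: (@le_trans _ _ (lint (fun x => 2^-1 * (savg (us x) (T (fun y => C y + b j y) x) +
    savg (us x) (T (fun y => C y - b j y) x))%R)%R)).
  apply: le_lint.
  - exact: (mfI_savg (iota j J.+1) mTb (L0_T Ci)).
  - exact: mfI_M (mfI_cst _) (mfI_D mSP mSM).
  - by move=> x _; exact: savg_ge0.
  - apply: aeI_S (aeI_and (T_D Ci (bi j)) (T_B Ci (bi j))) => x _ [e1 e2].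
    by rewrite e1 e2.
have half0 : 0 <= 2^-1 :> R by rewrite invr_ge0.
rewrite (lintZ half0 (mfI_D mSP mSM)); last by move=> x _; rewrite addr_ge0 ?savg_ge0.
rewrite (lintD mSP mSM); [|by move=> x _; exact: savg_ge0..].
have h : (0 <= (2^-1 : R)%:E)%E by rewrite lee_fin.
apply: (le_trans (lee_wpmul2l h (leeD IP IM))).
by rewrite -EFinD -EFinM lee_fin; lra.
Qed.

Definition block (p : nat * nat) x : R[i] :=
  if (p.1%:R < cabs (f x)) && (cabs (f x) <= p.2%:R) then f x else 0.

Lemma block_cutoff n m : (n <= m)%N ->
  block (n, m) = fun x => cutoff m f x - cutoff n f x.
Proof.
move=> nm; apply/funext => x; rewrite /block /cutoff/=.
have [fn|fn] := leP (cabs (f x)) n%:R; last by rewrite subr0.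
by rewrite (le_trans fn) ?ler_nat//= subrr.
Qed.

Lemma cabs_block p x : cabs (block p x) <= cabs (f x).
Proof. by rewrite /block; case: ifP => // _; rewrite cabs0 cabs_ge0. Qed.

Lemma cabs_block_tail p x : cabs (block p x) <= cabs (cutoff p.1 f x - f x).
Proof.
rewrite /block /cutoff; have [fn|fn] := leP (cabs (f x)) p.1%:R; rewrite ?cabs0 ?cabs_ge0//=.
by rewrite sub0r cabsN; case: ifP => // _; rewrite cabs0 cabs_ge0.
Qed.

Lemma block_disjoint p q x : (p.2 <= q.1)%N -> block p x = 0 \/ block q x = 0.
Proof.
move=> pq; rewrite /block; have [h|h] := leP (cabs (f x)) p.2%:R; last by left; rewrite andbF.
by right; rewrite ltNge (le_trans h) ?ler_nat.
Qed.

Lemma T_zero : aeI (fun x => T (fun=> 0 : R[i]) x = 0).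
Proof.
have e : (fun x => 0 * f x) = fun=> 0 by apply/funext => x; exact: mul0r.
apply: aeI_S (T_Z 0 fi) => x _ h.
exact: (etrans (congr1 (fun F => T F x) (esym e)) (etrans h (mul0r _))).
Qed.

(* Otherwise there are disjoint blocks [b_j] of [f] with [|T b_j|] bounded below in norm and
   [T b_j -> 0] a.e.; averaging over signs, [max_j |T b_j|] is integrable, which contradicts
   dominated convergence. *)
Lemma T_cutoff_cvg (eps : R) : 0 < eps ->
  exists n0, forall n, (n0 <= n)%N -> (normL1 (T (fun x => f x - cutoff n f x)%R) <= eps%:E)%E.
Proof.
move=> eps0; apply: contrapT => /forallNP H.
have [_ _ _ lsc] := @normL1_T_lsc R.
have ci n : L1 (cutoff n f) by exact: bounded_by_L1 (bounded_by_cutoff n mf).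
have di n m := L1B (ci m) (ci n).
(* [q] holds the index of the new block and the end of the previous one; [p] holds the two cutoff
   heights of the new block. *)
have ex (q : nat * nat) : exists p : nat * nat, [/\ (q.2 <= p.1)%N, (p.1 <= p.2)%N,
    normI (fun x => cabs (cutoff p.1 f x - f x)) <= 4^-1 ^+ q.1 &
    (eps%:E < normL1 (T (block p)))%E].
  have e0 : 0 < (4^-1 ^+ q.1 : R) by rewrite exprn_gt0// invr_gt0.
  move/cvgr_le : (cutoff_cvg fi) => /(_ _ e0)[N _ hN].
  have /existsNP[n /not_implyP[Nn /negP]] := H (maxn N q.2); rewrite -ltNge => big.
  have [Nn1 Nn2] : (N <= n)%N /\ (q.2 <= n)%N by move: Nn; rewrite geq_max => /andP.
  (* By lower semicontinuity a tail of large norm already has a large finite piece. *)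
  have : exists m, (eps%:E < normL1 (T (fun x => cutoff (n + m) f x - cutoff n f x)%R))%E.
    apply: contrapT => /forallNP K; move: big; apply/negP; rewrite -leNgt.
    apply: (lsc (fun m => fun x => cutoff (n + m) f x - cutoff n f x)).
    - by move=> m; exact: di.
    - exact: L1B fi (ci n).
    - have -> : (fun m => normI (fun x => cabs (cutoff (n + m) f x - cutoff n f x -
          (f x - cutoff n f x)))) = fun m => normI (fun x => cabs (cutoff (m + n) f x - f x)).
        apply/funext => m; rewrite addnC; congr normI; apply/funext => x; congr cabs.
        by rewrite opprB addrA subrK.
      by have := cutoff_cvg fi; rewrite -(cvg_shiftn n).
    - by move=> m; rewrite leNgt; apply/negP; exact: K.
  move=> [m hm]; exists (n, (n + m)%N); split; [exact: Nn2|exact: leq_addr|exact: hN|].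
  by rewrite block_cutoff ?leq_addr.
have [g hg] := choice ex.
pose fix s j := if j is i.+1 then g (j, (s i).2) else g (0%N, 0%N).
have s1 j : ((s j).1 <= (s j).2)%N by case: j => [|j]; [case: (hg (0%N, 0%N))|case: (hg (j.+1, (s j).2))].
have s2 j : ((s j).2 <= (s j.+1).1)%N by case: (hg (j.+1, (s j).2)).
have s3 j : normI (fun x => cabs (cutoff (s j).1 f x - f x)) <= 4^-1 ^+ j.
  by case: j => [|j]; [case: (hg (0%N, 0%N))|case: (hg (j.+1, (s j).2))].
have s4 j : (eps%:E < normL1 (T (block (s j))))%E.
  by case: j => [|j]; [case: (hg (0%N, 0%N))|case: (hg (j.+1, (s j).2))].
have s5 i j : (i < j)%N -> ((s i).2 <= (s j).1)%N.
  elim: j => // j IH; rewrite ltnS leq_eqVlt => /orP[/eqP -> //|/IH h].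
  exact: leq_trans h (leq_trans (s1 j) (s2 j)).
pose b j := block (s j).
have bE j : b j = fun x => cutoff (s j).2 f x - cutoff (s j).1 f x by exact: block_cutoff.
have bi j : L1 (b j) by rewrite bE; exact: di.
have mb j : L0 (b j) by case: (bi j).
have mTb j := L0_T (bi j).
have dis i j x : (i < j)%N -> b i x = 0 \/ b j x = 0 by move=> /s5; exact: block_disjoint.
have zi : L1 (fun=> 0 : R[i]).
  have := L1_Z 0 fi; congr L1; apply/funext => x; exact: mul0r.
pose V J x := savg [seq T (b i) x | i <- iota 0 J] (T (fun=> 0) x).
have avg J : (lint (V J) <= S%:E)%E.
  apply: (@lint_savg_le b mb (fun i => cabs_block (s i)) dis J 0%N (fun=> 0)).
  - by case: zi.
  - by move=> x; rewrite cabs0 cabs_ge0.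
  - by left.
have iotaS J : iota 0 J.+1 = rcons (iota 0 J) J by rewrite -addn1 iotaD cats1 add0n.
have lim0 : lint (fun x => cabs (T (b j) x)) @[j --> \oo] --> 0%E.
  apply: (@lint_cvg0_monotone_dominated _ _ V S).
  - by move=> j; exact: mfI_cabs (mTb j).
  - by move=> j; exact: mfI_savg mTb (L0_T zi).
  - by move=> j x; exact: savg_ge0.
  - by move=> j x; rewrite /V iotaS map_rcons; exact: savg_rcons.
  - exact: avg.
  - by move=> j x; rewrite cabs_ge0 /V iotaS map_rcons savg_last.
  (* Block [j] starts so high that it has norm at most [4^-j]; hence the transforms tend to that of
     0 almost everywhere. *)
  - have fast j : normI (fun x => cabs (b j x - 0)) <= 4^-1 ^+ j.
      apply: le_trans (s3 j); have /L1P[_ t1] := L1B (bi j) zi.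
      have /L1P[_ t2] := L1B (ci (s j).1) fi.
      apply: (le_normI t1 t2) => x _; rewrite !(ger0_norm (cabs_ge0 _)) subr0.
      exact: cabs_block_tail.
    apply: aeI_S (aeI_and T_zero (T_cvg_fast bi zi fast)) => x _ [e [hr hj]].
    by have := cvg_cabs hr hj; rewrite e cabs0.
have [fin /cvgr_lt/(_ _ eps0) lt0] := (fine_cvgP _ _).1 lim0.
have [j [fj ltj]] := filter_ex (filterI fin lt0).
have := s4 j; apply/negP; rewrite -leNgt ltW// -[ltLHS](fineK fj) lte_fin.
exact: ltj.
Qed.

End CutoffConvergence.

(** * Parseval's formula for unbounded [f] *)

Section ParsevalLimit.
Variables (R : realType) (f g : R -> R[i]) (S M : R).
Hypotheses (fi : L1 f) (fS : forall h, dominated f h -> (normL1 (T h) <= S%:E)%E).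
Hypotheses (M0 : 0 <= M) (gM : bounded_by M g) (fTg : L1 (f \* T g)).
Local Notation Re := complex.Re.
Local Notation Im := complex.Im.

Let mf : L0 f. Proof. by case: fi. Qed.
Let gi : L1 g. Proof. exact: bounded_by_L1 gM. Qed.
Let gMT h : L1 (T h) -> L1 (fun x => g x * T h x).
Proof. by move=> Thi; exact: (L1_mul_bounded Thi (proj1 gM) (proj2 gM)). Qed.

Lemma L1_T_cutoff n : L1 (T (cutoff n f)).
Proof. exact: L1_T_bounded (bounded_by_cutoff n mf). Qed.

Lemma L1_T_self : L1 (T f).
Proof.
by apply: (L1_T fi); apply: (@le_lt_trans _ _ S%:E); [apply: fS; exact: (dominated_refl fi)|exact: ltry].
Qed.

(** [phi] stands for the real or the imaginary part. On the left the cutoffs converge by domination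
    with [|f T g|]; on the right [g] is bounded and the transforms of the cutoffs converge in
    L^1. *)
Lemma parseval_part (phi : R[i] -> R) : (forall x y, phi (x - y) = phi x - phi y) ->
  (forall z, `|phi z| <= cabs z) -> (forall h, L1 h -> IL1 (fun x => phi (h x))) ->
  (forall n, \int[leb R]_(x in Iab) phi ((cutoff n f \* T g) x) =
     - \int[leb R]_(x in Iab) phi ((g \* T (cutoff n f)) x)) ->
  \int[leb R]_(x in Iab) phi ((f \* T g) x) = - \int[leb R]_(x in Iab) phi ((g \* T f) x).
Proof.
move=> phiB phile phi1 hn; have [mg gM'] := gM; have mT := L0_T gi.
have [_ ci] := (L1P _).1 fTg.
have cL : \int[leb R]_(x in Iab) phi ((cutoff n f \* T g) x) @[n --> \oo] -->
    \int[leb R]_(x in Iab) phi ((f \* T g) x).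
  have Fi n : L1 (cutoff n f \* T g).
    by apply: (@le_L1 _ _ _ (L0M (L0_cutoff n mf) mT) ci) => x _ /=; rewrite !cabsM ler_wpM2r ?cabs_ge0 ?cabs_cutoff_le.
  have lim : aeI (fun x => (fun n => phi ((cutoff n f \* T g) x)) @ \oo --> phi ((f \* T g) x)).
    apply: aeI_W => x _; apply: cvg_near_cst.
    by apply: filterS (cutoff_eventually f x) => n /= ->.
  have dom : aeI (fun x => forall n, `|phi ((cutoff n f \* T g) x)| <= cabs ((f \* T g) x)).
    apply: aeI_W => x _ n; apply: (le_trans (phile _)).
    by rewrite /= !cabsM ler_wpM2r ?cabs_ge0 ?cabs_cutoff_le.
  have [] := @IL1_dominated R (fun n x => phi ((cutoff n f \* T g) x))
    (fun x => phi ((f \* T g) x)) _ (fun n => IL1_mfI (phi1 _ (Fi n)))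
    (IL1_mfI (phi1 _ fTg)) lim ci dom.
  by [].
have cR : \int[leb R]_(x in Iab) phi ((g \* T (cutoff n f)) x) @[n --> \oo] -->
    \int[leb R]_(x in Iab) phi ((g \* T f) x).
  apply/cvgrPdist_le => eps eps0.
  have d0 : 0 < eps / (M + 1) by rewrite divr_gt0// ltr_wpDl.
  have [n0 hn0] := T_cutoff_cvg fi fS d0.
  exists n0 => // n /= n0n; have := hn0 n n0n.
  have Ti := L1_T_self; have Tni := L1_T_cutoff n.
  have ni : L1 (cutoff n f) by exact: bounded_by_L1 (bounded_by_cutoff n mf).
  have Di := L1B Ti Tni; have [_ cDi] := (L1P _).1 Di.
  have TB := T_B fi ni.
  have Tdi : L1 (T (fun x => f x - cutoff n f x)).
    by apply: L1_aeI Di _; apply: aeI_S TB => x _ ->.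
  have [_ cTdi] := (L1P _).1 Tdi.
  rewrite (normL1_E Tdi) lee_fin => small.
  have p1 := phi1 _ (gMT Ti); have p2 := phi1 _ (gMT Tni).
  have -> : \int[leb R]_(x in Iab) phi ((g \* T f) x) -
      \int[leb R]_(x in Iab) phi ((g \* T (cutoff n f)) x) =
      \int[leb R]_(x in Iab) (phi (g x * T f x) - phi (g x * T (cutoff n f) x)).
    by rewrite RintegralB; [by []|exact: measurable_Iab|exact: p1|exact: p2].
  apply: (@le_trans _ _ (\int[leb R]_(x in Iab) (M * cabs (T f x - T (cutoff n f) x)))).
    apply: (norm_int_Iab (IL1_mfI (IL1_B p1 p2)) (IL1_Zl M cDi)) => x Ix.
    rewrite -phiB -mulrBr (le_trans (phile _))// cabsM ler_wpM2r ?cabs_ge0//.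
    exact: gM'.
  rewrite (int_Iab_Zl M cDi).
  have -> : \int[leb R]_(x in Iab) cabs (T f x - T (cutoff n f) x) =
      normI (fun x => cabs (T (fun y => f y - cutoff n f y) x)).
    apply: Rintegral_aeI; [exact: IL1_mfI cDi|exact: mfI_norm (IL1_mfI cTdi)|].
    by apply: aeI_S TB => x _ ->; rewrite ger0_norm ?cabs_ge0.
  apply: (le_trans (ler_wpM2l M0 small)).
  rewrite mulrA ler_pdivrMr ?ltr_wpDl// mulrC ler_wpM2l ?(ltW eps0)//.
  by rewrite lerDl.
have cR' : \int[leb R]_(x in Iab) phi ((cutoff n f \* T g) x) @[n --> \oo] -->
    - \int[leb R]_(x in Iab) phi ((g \* T f) x).
  by rewrite (funext hn); exact: (cvgN cR).
exact: (cvg_unique (@Rhausdorff R) cL cR').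
Qed.

Lemma parseval_bounded_right : cint Iab (f \* T g) = - cint Iab (g \* T f).
Proof.
have P n := parseval_bounded (bounded_by_cutoff n mf) gM.
apply: complex_eq.
  rewrite ReN; apply: (@parseval_part (@Re R)).
  - by move=> x y; rewrite ReD ReN.
  - exact: Re_le_cabs.
  - exact: L1_Re.
  - by move=> n; have := congr1 (@Re R) (P n); rewrite ReN.
rewrite ImN; apply: (@parseval_part (@Im R)).
- by move=> x y; rewrite ImD ImN.
- exact: Im_le_cabs.
- exact: L1_Im.
- by move=> n; have := congr1 (@Im R) (P n); rewrite ImN.
Qed.

End ParsevalLimit.

Lemma sup_dominated_lty (R : realType) (f : R -> R[i]) : L1 f ->
  (forall A, borelI A -> L1 (T (f \* chi A))) -> (sup_dominated f < +oo)%E.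
Proof.
move=> fi hA; apply: (le_lt_trans (sup_dominated_le_sup_borel fi)).
have four0 : (0 <= (4 : R)%:E)%E by rewrite lee_fin.
exact: (lte_mul_pinfty four0 isT (sup_borel_lty fi hA)).
Qed.

Lemma TL1_sup_dominated_lty (R : realType) (f : R -> R[i]) : TL1 f ->
  (sup_dominated f < +oo)%E.
Proof.
move=> [fi fd]; apply: (sup_dominated_lty fi) => A bA.
by apply: fd; exact: dominated_chi.
Qed.

Lemma parseval_TL1 (R : realType) (f g : R -> R[i]) : TL1 f -> Linfty g ->
  cint Iab (f \* T g) = - cint Iab (g \* T f).
Proof.
move=> fT gy; have [fi fd] := fT; have [mf _] := fi.
have sy := TL1_sup_dominated_lty fT.
have [S fS] : exists S : R, forall h, dominated f h -> (normL1 (T h) <= S%:E)%E.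
  have s0 := le_trans (normL1_ge0 _) (sup_dominated_ub (dominated_refl fi)).
  case: (sup_dominated f) sy s0 (@sup_dominated_ub R f) => [S _ _ hS|//|//].
  by exists S.
have [M [g' [M0 gM gg]]] := Linfty_bounded gy.
have gi' := bounded_by_L1 gM; have gi := L1_aeI gi' gg; have [[mg _] [mg' _]] := (gi, gi').
have g'y : Linfty g'.
  by split; [exact: mg'|exists M; apply: aeI_W; case: gM].
have mT := L0_T fi; have TT := T_aeI gi' gi gg.
transitivity (cint Iab (f \* T g')).
  apply: eq_cint_aeI; [exact: L0M mf (L0_T gi)|exact: L0M mf (L0_T gi')|].
  by apply: aeI_S TT => x _ e; rewrite /= e.
transitivity (- cint Iab (g' \* T f)).
  exact: (parseval_bounded_right fi fS M0 gM (L1_mul_T fi sy g'y)).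
congr (- _); apply: eq_cint_aeI; [exact: L0M mg' mT|exact: L0M mg mT|].
by apply: aeI_S gg => x _ e; rewrite /= e.
Qed.

Theorem proposition5p1 (R : realType) (f : R -> R[i]) (f_L1 : L1 f) :
  [/\ [<-> TL1 f;
           (sup_dominated f < +oo)%E;
           forall A : set R, borelI A -> L1 (T (f \* chi A));
           (sup_borel f < +oo)%E;
           forall theta : R -> R[i], unimodular theta -> L1 (T (theta \* f));
           (sup_unimodular f < +oo)%E;
           forall g : R -> R[i], Linfty g -> L1 (f \* T g)],
      TL1 f ->
        [/\ (sup_borel f <= sup_unimodular f)%E,
            (sup_unimodular f <= sup_dominated f)%E &
            (sup_dominated f <= 4%:E * sup_borel f)%E] &
      TL1 f -> forall g : R -> R[i], Linfty g ->
        cint Iab (f \* T g) = - cint Iab (g \* T f)].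
Proof.
have four0 : (0 <= (4 : R)%:E)%E by rewrite lee_fin.
have borel_dominated : (sup_borel f < +oo)%E -> (sup_dominated f < +oo)%E.
  move=> h; apply: le_lt_trans (sup_dominated_le_sup_borel f_L1) _.
  exact: lte_mul_pinfty four0 isT h.
split.
- tfae.
  + exact: TL1_sup_dominated_lty.
  + move=> h A bA; apply: L1_T; first exact: L1_borelI.
    exact: le_lt_trans (sup_dominated_ub (dominated_chi f_L1 bA)) h.
  + exact: sup_borel_lty.
  (* From (d) one returns to (b) with the factor 4, and [theta f] is dominated by [f]. *)
  + move=> h theta ut; have du := dominated_unimodular f_L1 ut.
    apply: L1_T; first exact: dominated_L1 du.
    exact: le_lt_trans (sup_dominated_ub du) (borel_dominated h).
  + move=> h; apply: le_lt_trans (sup_unimodular_le_sup_dominated f_L1) _.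
    exact: sup_dominated_lty f_L1 (L1_T_chi_of_unimodular f_L1 h).
  + move=> h; apply: (L1_mul_T f_L1); apply: borel_dominated.
    exact: le_lt_trans (sup_borel_le_sup_unimodular f_L1) h.
  + exact: TL1_of_mul_T.
- move=> _; split.
  + exact: sup_borel_le_sup_unimodular.
  + exact: sup_unimodular_le_sup_dominated.
  + exact: sup_dominated_le_sup_borel.
- by move=> fT g gy; exact: parseval_TL1.
Qed.
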